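(* Suppose $\{X_t\}_{t\in T}$ is an S$\alpha$S process ($0<\alpha<2$) with spectral representation $$\{X_t\}_{t\in T}\stackrel{d}{=}\Big\{\int_S f_t(s)\,M_\alpha(\mathrm{d}s)\Big\}_{t\in T},$$ where $F=\{f_t\}_{t\in T}\subset L^\alpha(S,\mathcal{B}_S,\mu)$ has full support. Let $\{X^{(k)}_t\}_{t\in T}$, $k=1,\dots,n$, be independent S$\alpha$S processes. (i) The decomposition $$\{X_t\}_{t\in T}\stackrel{d}{=}\{X^{(1)}_t+\cdots+X^{(n)}_t\}_{t\in T}\qquad(\mathrm{D})$$ holds if and only if there exist measurable functions $r_k:S\to[-1,1]$, $k=1,\dots,n$, such that $$\{X^{(k)}_t\}_{t\in T}\stackrel{d}{=}\Big\{\int_S r_k(s)f_t(s)\,M_\alpha(\mathrm{d}s)\Big\}_{t\in T},\qquad k=1,\dots,n.\qquad(\mathrm{R})$$ In this case, necessarily $\sum_{k=1}^n|r_k(s)|^\alpha=1$, $\mu$-almost everywhere on $S$. (ii) If (D) holds, then the $r_k$'s in (R) can be chosen to be non-negative and $\rho(F)$-measurable. Such $r_k$'s are unique modulo $\mu$.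
   Context: A random variable $Z$ has a symmetric $\alpha$-stable (S$\alpha$S) distribution if $\mathbb{E}\exp(itZ)=\exp(-\sigma^\alpha|t|^\alpha)$ for all $t\in\mathbb{R}$, with some constant $\sigma>0$. A process $\{X_t\}_{t\in T}$ is S$\alpha$S if all its finite linear combinations follow S$\alpha$S distributions. The index set $T$ is a complete separable metric space, and $\stackrel{d}{=}$ denotes equality of finite-dimensional distributions. $(S,\mathcal{B}_S,\mu)$ is a standard Lebesgue space with $\sigma$-finite measure $\mu$, the functions $f_t$ are real-valued, and $M_\alpha$ is a real-valued S$\alpha$S random measure on $S$ with control measure $\mu$. For $\{g_t\}_{t\in T}\subset L^\alpha(S,\mathcal{B}_S,\mu)$, the finite-dimensional distributions of the process $Y_t=\int_S g_t\,\mathrm{d}M_\alpha$ are determined by $$\mathbb{E}\exp\Big(-i\sum_{j=1}^m a_jY_{t_j}\Big)=\exp\Big(-\int_S\Big|\sum_{j=1}^m a_jg_{t_j}\Big|^\alpha\mathrm{d}\mu\Big),\quad m\in\mathbb{N},\ t_j\in T,\ a_j\in\mathbb{R}.$$ Full support means $S=\mathrm{supp}\{f_t,\ t\in T\}$, i.e. there is no $A\in\mathcal{B}_S$ with $\mu(A)>0$ such that for every $t\in T$, $f_t=0$ $\mu$-almost everywhere on $A$. The ratio $\sigma$-algebra of $F$ is $\rho(F)=\sigma\{f_{t_1}/f_{t_2}:\ t_1,t_2\in T\}$. Unique modulo $\mu$ means unique up to equality $\mu$-almost everywhere.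
   Formalization: In (i), as the literal claims fail, the sum condition on |r_k|^α is part of the condition equivalent to (D), and its necessity is proved only for |r_k| that are ρ(F)-measurable modulo μ; σ=0 is allowed in SαS, and ratios in ρ(F) take x/0=0. *)

(* Defs.v *)
From HB Require Import structures.
From mathcomp Require Import all_boot all_order all_algebra.
From mathcomp Require Import all_classical all_reals all_analysis.
From mathcomp Require Import complex.

Set Implicit Arguments.
Unset Strict Implicit.
Unset Printing Implicit Defensive.

Import Order.TTheory GRing.Theory Num.Theory.
Import numFieldNormedType.Exports.

Local Open Scope classical_set_scope.
Local Open Scope ring_scope.

(* The library's completeType is pointed; this also covers an empty space. *)
Definition complete_space (R : realType) (T : metricType R) : Prop :=
  forall F : set_system T, ProperFilter F -> cauchy F ->
    exists x : T, F --> x.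

Definition separable_space (R : realType) (T : metricType R) : Prop :=
  exists2 D : set T, countable D & dense D.

(* S is Borel isomorphic to a Borel subset of a complete separable metric
   space. *)
Definition standard_borel (R : realType) (d : measure_display)
    (S : measurableType d) : Prop :=
  exists (U : metricType R) (e : S -> U),
    [/\ complete_space U, separable_space U, injective e,
        forall B : set U, <<s open >> B -> measurable (e @^-1` B) &
        forall A : set S, measurable A -> <<s open >> (e @` A)].

(* t |-> E exp(i t Z) *)
Definition char_fun (R : realType) (d : measure_display)
    (Omega : measurableType d) (P : probability Omega R)
    (Z : Omega -> R) (t : R) : R[i] :=
  Complex (fine 'E_P[fun w => cos (t * Z w)])
          (fine 'E_P[fun w => sin (t * Z w)]).

(* sigma = 0 (Z = 0 almost surely) is allowed: it always occurs among the
   linear combinations of a process, the one with zero coefficients for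
   instance. *)
Definition SaS (R : realType) (alpha : R) (d : measure_display)
    (Omega : measurableType d) (P : probability Omega R)
    (Z : Omega -> R) : Prop :=
  exists2 sigma : R, 0 <= sigma &
    forall t : R, char_fun P Z t =
      (expR (- (sigma `^ alpha * `|t| `^ alpha)))%:C%C.

Definition SaS_process (R : realType) (alpha : R) (T : Type)
    (d : measure_display) (Omega : measurableType d)
    (P : probability Omega R) (X : T -> {RV P >-> R}) : Prop :=
  forall (m : nat) (t : 'I_m -> T) (a : 'I_m -> R),
    SaS alpha P (fun w => \sum_(j < m) a j * X (t j) w).

(* Equality of finite-dimensional distributions; the tuple type m.-tuple R
   carries the product sigma-algebra, i.e. the Borel sets of R^m. *)
Definition eq_fdd (R : realType) (T : Type)
    (d : measure_display) (Omega : measurableType d)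
    (P : probability Omega R) (X : T -> Omega -> R)
    (d' : measure_display) (Omega' : measurableType d')
    (P' : probability Omega' R) (Y : T -> Omega' -> R) : Prop :=
  forall (m : nat) (t : 'I_m -> T) (B : set (m.-tuple R)), measurable B ->
    P [set w | B [tuple X (t j) w | j < m]] =
    P' [set w | B [tuple Y (t j) w | j < m]].

Definition sigma_of (R : realType) (I E : Type) (g : I -> E -> R) :
    set (set E) :=
  <<s \bigcup_(i : I) preimage_set_system setT (g i) measurable >>.

(* The events A k may be the whole space, so the product rule over the full
   family contains the one over each subfamily. *)
Definition independent_processes (R : realType) (T : Type)
    (d : measure_display) (Omega : measurableType d)
    (P : probability Omega R) (n : nat)
    (X : 'I_n -> T -> {RV P >-> R}) : Prop :=
  forall A : 'I_n -> set Omega,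
    (forall k, sigma_of (fun t => X k t : Omega -> R) (A k)) ->
    P (\bigcap_(k in [set: 'I_n]) A k) = (\prod_(k < n) P (A k))%E.

(* M g is the stochastic integral of g against an SaS random measure with
   control measure mu, as an SaS process indexed by L^alpha(mu) with the
   prescribed finite-dimensional distributions; the measure itself is
   A |-> M (\1_A), for A of finite mu-measure.  M g is unconstrained when g is
   not in L^alpha(mu). *)
Definition SaS_integral (R : realType) (alpha : R)
    (d : measure_display) (S : measurableType d)
    (mu : {measure set S -> \bar R})
    (d' : measure_display) (Omega : measurableType d')
    (Q : probability Omega R) (M : (S -> R) -> {RV Q >-> R}) : Prop :=
  forall (m : nat) (g : 'I_m -> S -> R) (a : 'I_m -> R),
    (forall j, g j \in Lfun mu alpha%:E) ->
    char_fun Q (fun w => \sum_(j < m) a j * M (g j) w) (-1) =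
    (expR (- \int[mu]_s (`|\sum_(j < m) a j * g j s| `^ alpha)))%:C%C.

Definition full_support (R : realType) (T : Type)
    (d : measure_display) (S : measurableType d)
    (mu : {measure set S -> \bar R}) (f : T -> S -> R) : Prop :=
  ~ exists A : set S, [/\ measurable A, (0 < mu A)%E &
      forall t, {ae mu, forall s, A s -> f t s = 0}].

(* Here x / 0 = 0.  Sending x / 0, x <> 0, to one point at infinity gives the
   same sigma-algebra, since f t / f t is the indicator of f t <> 0.  Signed
   infinities would not: they record the sign of f t1 where f t2 = 0, which no
   law of linear combinations determines. *)
Definition ratio_sigma (R : realType) (T S : Type) (f : T -> S -> R) :
    set (set S) :=
  sigma_of (fun p : T * T => fun s => f p.1 s / f p.2 s).

Definition measurable_wrt (R : realType) (S : Type) (G : set (set S))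
    (r : S -> R) : Prop :=
  forall B : set R, measurable B -> G (r @^-1` B).

(* Main.v *)
Require Import Defs.
From HB Require Import structures.
From mathcomp Require Import all_boot all_order all_algebra.
From mathcomp Require Import all_classical all_reals all_analysis.
From mathcomp Require Import measurable_realfun complex ring lra zify.

(** For a linear combination $Z = \sum_j a_j X_{t_j}$ let
    $Y_Z = \sum_j a_j f_{t_j}$, let $\psi(Z) = \int |Y_Z|^\alpha d\mu$ be the
    exponent of $Z$ for the process $X$, and $\psi_k(Z)$ its exponent for
    $X^{(k)}$.  Laws are determined by characteristic functions
    ([cos_sin_eq_fdd]) and these multiply along independent summands, so (D)
    says that $\psi = \sum_k \psi_k$, and (R) says that
    $\psi_k(Z) = \int |r_k|^\alpha |Y_Z|^\alpha d\mu$ for all $Z$.  The theorem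
    is thus about densities $q = |r_k|^\alpha$ of functionals of $Z$, and it
    rests on their existence ([ratio_density_exists]) and uniqueness
    ([ratio_density_unique]) among functions of the ratios $f_t / f_u$.

    Existence.  Being the limit of $n (1 - E \cos(n^{-1/\alpha} Z_k))$, where
    $Z_k = \sum_j a_j X^{(k)}_{t_j}$, the exponent $\psi_k$ is of negative type ([stable_negative_type]): the linear
    functional that sends $1 - \cos Z$ to $\psi_k(Z)$ is nonnegative at every
    nonnegative trigonometric polynomial vanishing at $0$.  The same holds for
    $\psi - \psi_k = \sum_{j \ne k} \psi_j$, so the functional of $\psi_k$ lies
    between $0$ and that of $\psi$.  The latter is an integral: up to a
    constant, $|y|^\alpha$ is
    $\int (1 - \cos(e^x y)) e^{-\alpha x} dx$, so $\psi$ comes from a measure on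
    $S \times R$ on which trigonometric polynomials are evaluated at the
    functions $e^x f_t(s)$.  Near each $1 - \cos Z$, taken as a weight, a Riesz
    argument in $L^2$ ([riesz_density]) gives a density $0 \le h \le 1$
    measurable for the sigma-algebra generated by these polynomials; such
    densities agree on overlaps and are glued ([levy_density_exists]).  They are
    unique because the indicators of that sigma-algebra lie in the closure of
    the algebra of trigonometric polynomials under bounded limits
    ([bclosure_sigma_of]).  Since $\psi_k$ is homogeneous, translating $h$ along
    $x$ gives another density of $\psi_k$, hence $h$ does not depend on $x$.
    It may therefore be evaluated along a curve on which $e^x |g_0(s)|$ is
    constant, where $g_0$ is the first nonzero function of a countable family of
    $f_t$ without common zero, which full support provides.  Along this curve
    the functions $e^x f_t$ are, up to a common sign, ratios of the $f_t$, and
    the result is the density $q$.  Then $r_k = q^{1/\alpha}$ represents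
    $X^{(k)}$.

    Uniqueness.  A function of the ratios is also measurable, as a function on
    $S \times R$, for the sigma-algebra of the trigonometric polynomials: the
    squares $(e^x Y_Z)^2$ are limits of $2 n^2 (1 - \cos(e^x Y_Z / n))$, and
    polarising them gives the ratios.  So uniqueness on $S \times R$ gives
    uniqueness on $S$.  Applied to $\sum_k q_k$ and $1$, which both represent
    $\psi$, it also yields $\sum_k |r_k|^\alpha = 1$. *)

Set Implicit Arguments.
Unset Strict Implicit.
Unset Printing Implicit Defensive.

Import Order.TTheory GRing.Theory Num.Theory.
Import numFieldNormedType.Exports.

Local Open Scope classical_set_scope.
Local Open Scope ring_scope.

(** * Closing an algebra of functions under bounded limits *)

Section threshold_polynomials.
Context {R : realType}.
Implicit Types (t x y : R).

Lemma bernoulli_lower t k : 0 <= t <= 1 -> 1 - k%:R * t <= (1 - t) ^+ k.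
Proof.
move=> /andP[t0 t1]; elim: k => [|k IH]; first by rewrite mul0r subr0 expr0.
have t1' : 0 <= 1 - t by rewrite subr_ge0.
rewrite exprS; apply: le_trans (ler_wpM2l t1' IH); rewrite -natr1.
have : 0 <= k%:R * (t * t) by rewrite !mulr_ge0.
lra.
Qed.

Lemma bernoulli_upper t k : 0 <= t <= 1 -> (1 - t) ^+ k <= (1 + k%:R * t)^-1.
Proof.
move=> /andP[t0 t1].
have kt n : 0 < 1 + n%:R * t by rewrite ltr_wpDr// mulr_ge0.
suff : (1 - t) ^+ k * (1 + k%:R * t) <= 1 by rewrite -ler_pdivlMr// mul1r.
elim: k => [|k IH]; first by rewrite expr0 mul0r addr0 mulr1.
apply: le_trans IH; rewrite exprSr -mulrA ler_wpM2l ?exprn_ge0 ?subr_ge0//.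
rewrite -natr1.
have : 0 <= k%:R * (t * t) by rewrite !mulr_ge0.
have : 0 <= t * t by rewrite mulr_ge0.
lra.
Qed.

Lemma nat_mul_expr_le y n : 0 <= y < 1 -> n%:R * y ^+ n <= (1 - y)^-1.
Proof.
move=> /andP[y0 y1]; have y1' : 0 < 1 - y by rewrite subr_gt0.
suff : n%:R * y ^+ n * (1 - y) <= 1 - y ^+ n.
  move=> h; rewrite -[leRHS]mul1r ler_pdivlMr// (le_trans h)//.
  by rewrite gerBl exprn_ge0.
elim: n => [|n IH]; first by rewrite mul0r mul0r expr0 subrr.
rewrite -natr1 exprS.
have yn0 : 0 <= y ^+ n by rewrite exprn_ge0.
have yn1 : y * y ^+ n <= 1 by rewrite -exprS exprn_ile1// ltW.
have := ler_wpM2l y0 IH.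
have : 0 <= (1 - y) * (1 - y * y ^+ n) by rewrite mulr_ge0 ?subr_ge0// ltW.
lra.
Qed.

Lemma cvg_nat_mul_expr2 y : 0 <= y < 1 ->
  n%:R * y ^+ n.*2 @[n --> \oo] --> (0 : R).
Proof.
move=> /andP[y0 y1].
apply: (@squeeze_cvgr _ _ _ _ (fun=> 0) (fun n => (1 - y)^-1 * y ^+ n)).
- near=> n; rewrite mulr_ge0 ?exprn_ge0//= -addnn exprD mulrA.
  by rewrite ler_wpM2r ?exprn_ge0// nat_mul_expr_le ?y0.
- exact: cvg_cst.
- rewrite -[X in _ --> X](mulr0 (1 - y)^-1); apply: cvgMr.
  by apply: cvg_expr; rewrite ger0_norm.
Unshelve. all: by end_near. Qed.

(** The rate $n 4^n$ is what makes the threshold sharp: with the factor $n$ the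
    value at $x = 1/2$ also tends to $0$. *)
Lemma threshold_cvg x : 0 <= x <= 1 ->
  (1 - x ^+ n.*2) ^+ (n * 4 ^ n) @[n --> \oo] --> ((x < 2^-1)%R%:R : R).
Proof.
move=> /andP[x0 x1].
have t01 n : 0 <= x ^+ n <= 1 by rewrite exprn_ge0//= exprn_ile1.
have kt n : (n * 4 ^ n)%:R * x ^+ n.*2 = n%:R * (2 * x) ^+ n.*2.
  rewrite exprMn natrM natrX -mulrA; congr (_ * (_ * _)).
  by rewrite -muln2 mulnC exprM; congr (_ ^+ _); rewrite expr2 -natrM.
have [xh|xh] := ltP x 2^-1.
- apply: (@squeeze_cvgr _ _ _ _ (fun n => 1 - n%:R * (2 * x) ^+ n.*2) (fun=> 1)).
  + near=> n; rewrite -kt bernoulli_lower//= exprn_ile1//.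
      by have /andP[_ h] := t01 n.*2; rewrite subr_ge0.
    by have /andP[h _] := t01 n.*2; rewrite gerBl.
  + rewrite -[X in _ --> X]subr0; apply: cvgB; first exact: cvg_cst.
    by apply: cvg_nat_mul_expr2; apply/andP; split; lra.
  + exact: cvg_cst.
- apply: (@squeeze_cvgr _ _ _ _ (fun=> 0) (fun n => n%:R^-1)).
  + near=> n; rewrite exprn_ge0/=; last first.
      by have /andP[_ h] := t01 n.*2; rewrite subr_ge0.
    have n0 : (0 : R) < n%:R by rewrite ltr0n; near: n; exact: nbhs_infty_gt.
    apply: (le_trans (bernoulli_upper _ (t01 _))); rewrite kt lef_pV2 ?posrE//.
      have : n%:R <= n%:R * (2 * x) ^+ n.*2; last by lra.
      have h1 : 1 <= (2 * x) ^+ n.*2 by apply: exprn_ege1; lra.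
      by rewrite ler_peMr// ltW.
    by rewrite ltr_wpDr// mulr_ge0// exprn_ge0//; lra.
  + exact: cvg_cst.
  + rewrite -(cvg_shiftn 1); under eq_fun do rewrite addn1; exact: cvg_harmonic.
Unshelve. all: by end_near. Qed.

End threshold_polynomials.

Section bounded_closure.
Context {R : realType} {E : Type}.
Implicit Types (A : set (E -> R)) (f g : E -> R).

(** The induction is needed: a single passage to the limit would not give a
    set closed under limits. *)
Inductive bclosure A : (E -> R) -> Prop :=
| bclosure_base g : A g -> bclosure A g
| bclosure_lim (g_ : nat -> E -> R) g M :
    (forall n, bclosure A (g_ n)) -> (forall n x, `|g_ n x| <= M) ->
    (forall x, g_ n x @[n --> \oo] --> g x) -> bclosure A g.

Definition bounded_algebra A : Prop :=
  [/\ A (fun=> 1), forall c g, A g -> A (fun x => c * g x),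
      forall f g, A f -> A g -> A (fun x => f x + g x),
      forall f g, A f -> A g -> A (fun x => f x * g x) &
      forall g, A g -> exists M, forall x, `|g x| <= M].

Lemma lim_norm_le (u : R^nat) l M :
  (forall n, `|u n| <= M) -> u n @[n --> \oo] --> l -> `|l| <= M.
Proof.
move=> uM ul.
have ul' : `|u n| @[n --> \oo] --> `|l| by exact: cvg_norm.
rewrite -(cvg_lim _ ul') //; apply: limr_le; first by apply: cvgP ul'.
by near=> n; exact: uM.
Unshelve. all: by end_near. Qed.

Variable A : set (E -> R).
Hypothesis Aalg : bounded_algebra A.

Lemma bclosure_bounded g : bclosure A g -> exists M, forall x, `|g x| <= M.
Proof.
have [_ _ _ _ Ab] := Aalg.
elim=> [f /Ab//|g_ {}g M _ _ gM gl]; exists M => x.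
by apply: (lim_norm_le (u := g_ ^~ x)).
Qed.

Lemma bclosure_scale c g : bclosure A g -> bclosure A (fun x => c * g x).
Proof.
have [_ As _ _ _] := Aalg.
elim=> [f /(As c) ?|g_ {}g M _ IH gM gl]; first exact: bclosure_base.
apply: (bclosure_lim (M := `|c| * M) IH) => [n x|x].
  by rewrite normrM ler_wpM2l.
exact: cvgMr.
Qed.

Let bclosure_op (op : R -> R -> R) :
  (forall M N, exists K, forall x y, `|x| <= M -> `|y| <= N -> `|op x y| <= K) ->
  (forall (u v : R^nat) a b, u n @[n --> \oo] --> a -> v n @[n --> \oo] --> b ->
     op (u n) (v n) @[n --> \oo] --> op a b) ->
  (forall f g, A f -> A g -> A (fun x => op (f x) (g x))) ->
  forall f g, bclosure A f -> bclosure A g ->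
  bclosure A (fun x => op (f x) (g x)).
Proof.
move=> opb opc Aop f g Bf Bg.
elim: Bf => [{}f Af|f_ {}f M _ IH fM fl].
  elim: Bg => [{}g Ag|g_ {}g M _ IH gM gl].
    by apply: bclosure_base; exact: Aop.
  have [N fN] := bclosure_bounded (bclosure_base Af).
  have [K opK] := opb N M.
  apply: (bclosure_lim (M := K) IH) => [n x|x]; first exact: opK.
  by apply: opc => //; exact: cvg_cst.
have [N gN] := bclosure_bounded Bg.
have [K opK] := opb M N.
apply: (bclosure_lim (M := K) IH) => [n x|x]; first exact: opK.
by apply: opc => //; exact: cvg_cst.
Qed.

Lemma bclosure_add f g : bclosure A f -> bclosure A g ->
  bclosure A (fun x => f x + g x).
Proof.
have [_ _ Ad _ _] := Aalg.
apply: (bclosure_op (op := +%R)) => // [M N|u v a b ua vb].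
  by exists (M + N) => x y xM yN; rewrite (le_trans (ler_normD _ _))// lerD.
exact: cvgD.
Qed.

Lemma bclosure_mul f g : bclosure A f -> bclosure A g ->
  bclosure A (fun x => f x * g x).
Proof.
have [_ _ _ Am _] := Aalg.
apply: (bclosure_op (op := *%R)) => // [M N|u v a b ua vb].
  by exists (M * N) => x y xM yN; rewrite normrM ler_pM.
exact: cvgM.
Qed.

Lemma bclosure_cst c : bclosure A (fun=> c).
Proof.
have [A1 _ _ _ _] := Aalg.
have := bclosure_scale c (bclosure_base A1).
by under eq_fun do rewrite mulr1.
Qed.

Lemma bclosure_exp g n : bclosure A g -> bclosure A (fun x => g x ^+ n).
Proof.
move=> Bg; elim: n => [|n IH].
  by under eq_fun do rewrite expr0; exact: bclosure_cst.
by under eq_fun do rewrite exprS; exact: bclosure_mul.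
Qed.

Lemma bclosure_prod (F : nat -> E -> R) n : (forall k, bclosure A (F k)) ->
  bclosure A (fun x => \prod_(k < n) F k x).
Proof.
move=> BF; elim: n => [|n IH].
  by under eq_fun do rewrite big_ord0; exact: bclosure_cst.
by under eq_fun do rewrite big_ord_recr/=; exact: bclosure_mul.
Qed.

(** An affine map sends the values of $f$ into $[0, 1]$ and the threshold $c$
    to $1/2$, where the polynomials of [threshold_cvg] cut. *)
Lemma bclosure_lt f c : bclosure A f -> bclosure A (fun x => (f x < c)%R%:R).
Proof.
move=> Bf; have [M fM] := bclosure_bounded Bf.
pose K := 2 * (`|M| + `|c| + 1).
have K0 : 0 < K by rewrite mulr_gt0// ltr_wpDl// addr_ge0.
pose g x := 2^-1 + K^-1 * (f x + - c).
have Bg : bclosure A g.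
  apply: bclosure_add; first exact: bclosure_cst.
  by apply/bclosure_scale/bclosure_add => //; exact: bclosure_cst.
have gK x : K * g x = `|M| + `|c| + 1 + (f x - c).
  by rewrite /g mulrDr mulrA divff ?gt_eqF// mul1r /K mulrAC divff ?mul1r.
have g01 x : 0 <= g x <= 1.
  have := fM x; have := ler_norm M; rewrite ler_norml => hM /andP[h1 h2].
  have := ler_norm c; have := ler_norm (- c); rewrite normrN => h3 h4.
  have Kg := gK x.
  apply/andP; split; rewrite -(ler_pM2l K0) gK ?mulr0 ?mulr1 /K; lra.
have gh x : (g x < 2^-1) = (f x < c).
  by rewrite /g -subr_gt0 opprD addNKr oppr_gt0 pmulr_rlt0 ?invr_gt0// subr_lt0.
apply: (@bclosure_lim _ (fun n x => (1 + -1 * g x ^+ n.*2) ^+ (n * 4 ^ n)) _ 1).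
- move=> n; apply/bclosure_exp/bclosure_add; first exact: bclosure_cst.
  exact/bclosure_scale/bclosure_exp.
- move=> n x; rewrite mulN1r; have /andP[g0 g1] := g01 x.
  have : 0 <= g x ^+ n.*2 <= 1 by rewrite exprn_ge0//= exprn_ile1.
  move=> /andP[h0 h1]; rewrite normrX exprn_ile1// ger0_norm ?subr_ge0//.
  by rewrite gerBl.
- move=> x; rewrite -gh; under eq_fun do rewrite mulN1r.
  exact: threshold_cvg.
Qed.

Lemma bclosure_indic_sigma_algebra :
  sigma_algebra setT [set C : set E | bclosure A (\1_C)].
Proof.
split => /=.
- rewrite (_ : \1_set0 = fun=> 0); first exact: bclosure_cst.
  by apply/funext => x; rewrite indicE in_set0.
- move=> C BC; rewrite (_ : \1__ = fun x => 1 + -1 * \1_C x).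
    by apply: bclosure_add; [exact: bclosure_cst|exact: bclosure_scale].
  apply/funext => x; rewrite setTD !indicE in_setC mulN1r.
  by case: (x \in C); rewrite ?subrr ?subr0.
- move=> F BF.
  pose G n x : R := \prod_(k < n) (1 + -1 * \1_(F k) x).
  have G01 n x : 0 <= G n x <= 1.
    apply/andP; split; first apply: prodr_ge0 => k _.
      by rewrite indicE; case: (_ \in _) => /=; lra.
    apply: prodr_ile1 => k _; rewrite indicE; case: (_ \in _) => /=; lra.
  apply: (@bclosure_lim _ (fun n x => 1 + -1 * G n x) _ 1).
  + move=> n; apply: bclosure_add; first exact: bclosure_cst.
    apply/bclosure_scale/(@bclosure_prod (fun k x => 1 + -1 * \1_(F k) x)) => k.
    by apply: bclosure_add; [exact: bclosure_cst|exact/bclosure_scale/BF].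
  + move=> n x; have := G01 n x; rewrite ler_norml; lra.
  + move=> x; rewrite indicE.
    have [xF|xF] := boolP (x \in _).
      move: xF; rewrite inE => -[k _ Fkx].
      apply: cvg_near_cst; near=> n.
      have kn : (k < n)%N by near: n; exact: nbhs_infty_gt.
      rewrite /G (bigD1 (Ordinal kn))//= indicE mem_set//=.
      by rewrite mulr1 subrr mul0r mulr0 addr0.
    apply: cvg_near_cst; near=> n.
    rewrite /G big1/=; first by rewrite mulN1r subrr.
    move=> k _; rewrite indicE memNset; first by rewrite mulr0 addr0.
    by move=> Fkx; move/negP: xF; apply; rewrite inE; exists k.
Unshelve. all: by end_near. Qed.

(** The functional form of the monotone class theorem: the sets whose indicator
    lies in the closure form a sigma-algebra, and it contains the sets
    $\{g_i < c\}$. *)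
Lemma bclosure_sigma_of (I : Type) (g : I -> E -> R) C :
  (forall i c, bclosure A (fun x => (g i x < c)%R%:R)) -> sigma_of g C ->
  bclosure A (\1_C).
Proof.
move=> Bg; move: C; apply: smallest_sub; first exact: bclosure_indic_sigma_algebra.
move=> _ [i _ [B mB <-]]; rewrite setTI /=.
have [h0 hC hU] := bclosure_indic_sigma_algebra.
have : (<<s @measurable_realfun.RGenInftyO.G R>>) B.
  have : (@ocitv R).-sigma.-measurable B by exact: mB.
  by rewrite measurable_realfun.RGenInftyO.measurableE.
move: B {mB}; apply: smallest_sub.
  split => /=.
  - by rewrite preimage_set0.
  - by move=> B /hC /=; rewrite !setTD preimage_setC.
  - by move=> F BF; rewrite preimage_bigcup; exact: hU.
move=> _ [c ->] /=.
rewrite (_ : \1__ = fun x => (g i x < c)%R%:R)//.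
apply/funext => x; rewrite indicE (_ : (x \in _) = (g i x < c))//.
by apply/idP/idP; rewrite inE /= in_itv.
Qed.

End bounded_closure.

(** * Dominated limits, generated sigma-algebras, annihilators of an algebra *)

Section real_integrals.
Context d {E : measurableType d} {R : realType} (m : {measure set E -> \bar R}).
Implicit Types f g w : E -> R.

Lemma integrable_mul_bounded g w M : measurable_fun setT g ->
  (forall x, `|g x| <= M) -> m.-integrable setT (EFin \o w) ->
  m.-integrable setT (EFin \o (fun x => g x * w x)).
Proof.
move=> mg gM iw; have mw : measurable_fun setT w.
  by apply/measurable_EFinP; exact: measurable_int iw.
apply: (le_integrable _ _ _ (integrableZl measurableT M iw)) => //.
  by apply/measurable_EFinP; exact: measurable_funM.
move=> x _ /=; rewrite lee_fin !normrM ler_wpM2r//.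
exact: le_trans (gM x) (ler_norm M).
Qed.

Lemma integrable_add f g : m.-integrable setT (EFin \o f) ->
  m.-integrable setT (EFin \o g) ->
  m.-integrable setT (EFin \o (fun x => f x + g x)).
Proof.
move=> fi gi; have := integrableD measurableT fi gi.
by congr (_.-integrable _ _); apply/funext => x /=; rewrite EFinD.
Qed.

Lemma integrable_scale c f : m.-integrable setT (EFin \o f) ->
  m.-integrable setT (EFin \o (fun x => c * f x)).
Proof.
move=> fi; have := integrableZl measurableT c fi.
by congr (_.-integrable _ _); apply/funext => x /=; rewrite EFinM.
Qed.

Lemma cvg_Rintegral_dominated (f_ : nat -> E -> R) f w :
  (forall n, measurable_fun setT (f_ n)) ->
  {ae m, forall x, f_ n x @[n --> \oo] --> f x} -> measurable_fun setT f ->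
  {ae m, forall x, forall n, `|f_ n x| <= w x} ->
  m.-integrable setT (EFin \o w) ->
  m.-integrable setT (EFin \o f) /\
  \int[m]_x f_ n x @[n --> \oo] --> \int[m]_x f x.
Proof.
move=> mf_ f_f mf f_w iw.
have [|||||i1 _] := @dominated_convergence _ _ _ m setT measurableT
    (fun n => EFin \o f_ n) (EFin \o f) (EFin \o w).
- by move=> n; exact/measurable_EFinP.
- exact/measurable_EFinP.
- by apply: filterS f_f => x f_fx _; apply: cvg_EFin => //; exact: nearW.
- exact: iw.
- by apply: filterS f_w => x f_wx n _; rewrite /= lee_fin.
have -> : (\int[m]_x (EFin \o f) x = (\int[m]_x f x)%:E)%E.
  by rewrite /Rintegral fineK//; exact: integrable_fin_num.
by move=> /fine_cvgP[_ h]; split.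
Qed.

Lemma cvg_Rintegral_bounded (g_ : nat -> E -> R) g w M :
  (forall n, measurable_fun setT (g_ n)) ->
  (forall x, g_ n x @[n --> \oo] --> g x) ->
  (forall n x, `|g_ n x| <= M) -> m.-integrable setT (EFin \o w) ->
  \int[m]_x (g_ n x * w x) @[n --> \oo] --> \int[m]_x (g x * w x).
Proof.
move=> mg_ g_g gM iw; have mw : measurable_fun setT w.
  by apply/measurable_EFinP; exact: measurable_int iw.
apply: (proj2 (@cvg_Rintegral_dominated _ _ (fun x => M * `|w x|) _ _ _ _ _)).
- by move=> n; exact: measurable_funM.
- by apply: aeW => x; apply: cvgMl; exact: g_g.
- apply: measurable_funM => //.
  by apply: (measurable_fun_cvg mg_) => x _; exact: g_g.
- by apply: aeW => x n; rewrite normrM ler_wpM2r.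
- exact: (integrableZl measurableT M (integrable_abse iw)).
Qed.

Lemma Rintegral_eq0_ae f : m.-integrable setT (EFin \o f) ->
  (forall x, 0 <= f x) -> \int[m]_x f x <= 0 -> {ae m, forall x, f x = 0}.
Proof.
move=> fi f0 fle.
have fE : (\int[m]_x `|(EFin \o f) x| = 0)%E.
  under eq_integral => x _ do rewrite /= ger0_norm//.
  apply/eqP; rewrite eq_le integral_ge0 ?andbT; last first.
    by move=> x _; rewrite lee_fin.
  rewrite -[leLHS]fineK ?lee_fin//; exact: integrable_fin_num.
have mf : measurable_fun setT (EFin \o f) := measurable_int m fi.
have /(ae_eq_integral_abs m measurableT mf)  := fE.
by apply: filterS => x /(_ I) /= [].
Qed.

End real_integrals.

Lemma measurable_cos_fun {R : realType} d {E : measurableType d} (f : E -> R) :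
  measurable_fun setT f -> measurable_fun setT (fun x => cos (f x)).
Proof.
move=> mf; have mc : measurable_fun setT (@cos R).
  by apply: continuous_measurable_fun; exact: continuous_cos.
exact: measurableT_comp mc mf.
Qed.

Lemma measurable_sin_fun {R : realType} d {E : measurableType d} (f : E -> R) :
  measurable_fun setT f -> measurable_fun setT (fun x => sin (f x)).
Proof.
move=> mf; have mc : measurable_fun setT (@sin R).
  by apply: continuous_measurable_fun; exact: continuous_sin.
exact: measurableT_comp mc mf.
Qed.

Lemma measurable_wrt_generator {R : realType} (I E : Type) (g : I -> E -> R) i :
  measurable_wrt (sigma_of g) (g i).
Proof.
move=> B mB; apply: sub_sigma_algebra; exists i => //.
by exists B => //; rewrite setTI.
Qed.

Section sigma_of_measurable.
Context {R : realType} d {E : measurableType d} (I : Type) (g : I -> E -> R).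
Hypothesis mg : forall i, measurable_fun setT (g i).

Lemma sigma_of_measurable C : sigma_of g C -> measurable C.
Proof.
move: C; apply: smallest_sub; first exact: sigma_algebra_measurable.
by move=> _ [i _ [B mB <-]]; exact: mg.
Qed.

Lemma measurable_wrt_measurable (h : E -> R) : measurable_wrt (sigma_of g) h ->
  measurable_fun setT h.
Proof. by move=> mh _ B mB; rewrite setTI; apply: sigma_of_measurable; exact: mh. Qed.

End sigma_of_measurable.

Lemma measurable_wrtP {R : realType} (T : pointedType) (G : set (set T))
    (r : T -> R) :
  measurable_wrt <<s G >> r <->
  measurable_fun [set: g_sigma_algebraType G] (r : g_sigma_algebraType G -> R).
Proof.
split=> [mr _ B mB|mr B mB]; first by rewrite setTI; exact: mr.
by have := mr measurableT B mB; rewrite setTI.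
Qed.

Section first_value.
Context {R : realType} {X : Type}.
Implicit Types (P : nat -> X -> bool) (a : nat -> X -> R).

(** Glues countably many partially meaningful functions; the point is that
    [first_value_sum] makes it a limit of polynomial expressions in the $a_n$
    and the indicators of the $P_n$, whatever the sigma-algebra. *)
Definition first_value P a (x : X) : R :=
  if pselect (exists n, P n x) is left e then a (ex_minn e) x else 0.

Lemma first_valueP P a x n : P n x ->
  exists k, [/\ P k x, forall j, P j x -> (k <= j)%N & first_value P a x = a k x].
Proof.
move=> Pn; rewrite /first_value; case: pselect => [e|]; last by case; exists n.
by exists (ex_minn e); split=> //; case: ex_minnP.
Qed.

Lemma first_value_none P a x : (forall n, ~~ P n x) -> first_value P a x = 0.
Proof.
move=> Px; rewrite /first_value; case: pselect => // e; have [n Pn] := e.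
by have := Px n; rewrite Pn.
Qed.

Definition first_value_sum P a n x : R :=
  \sum_(k < n) (\prod_(j < k) (1 - (P j x)%:R)) * (P k x)%:R * a k x.

Lemma first_value_cvg P a x :
  first_value_sum P a n x @[n --> \oo] --> first_value P a x.
Proof.
have [[n Pn]|/forallNP noP] := pselect (exists n, P n x); last first.
  rewrite first_value_none; last by move=> n; apply/negP/noP.
  apply: cvg_near_cst; apply: nearW => n; rewrite /first_value_sum big1// => k _.
  by have /negP/negbTE -> := noP k; rewrite mulr0 mul0r.
have [k [Pk kmin ->]] := first_valueP a Pn.
apply: cvg_near_cst; near=> m.
have km : (k < m)%N by near: m; exact: nbhs_infty_gt.
rewrite /first_value_sum (bigD1 (Ordinal km))//= Pk mulr1.
rewrite big1 ?mul1r; last first.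
  move=> j _; have [/kmin|_] := boolP (P j x); last by rewrite subr0.
  by rewrite leqNgt ltn_ord.
rewrite big1 ?addr0// => -[j jm] /=; rewrite -val_eqE/= => jk.
have [/kmin kj|_] := boolP (P j x); last by rewrite mulr0 mul0r.
have kj' : (k < j)%N by rewrite ltn_neqAle eq_sym jk.
by rewrite (bigD1 (Ordinal kj'))//= Pk subrr !mul0r.
Unshelve. all: by end_near. Qed.

End first_value.

Lemma measurable_first_value {R : realType} d {X : measurableType d}
    (P : nat -> X -> bool) (a : nat -> X -> R) :
  (forall n, measurable_fun setT (fun x => (P n x)%:R : R)) ->
  (forall n, measurable_fun setT (a n)) ->
  measurable_fun setT (first_value P a).
Proof.
move=> mP ma; apply: (@measurable_fun_cvg _ _ _ _ (first_value_sum P a)); last first.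
  by move=> x _; exact: first_value_cvg.
move=> n; apply: measurable_sum => k; apply: measurable_funM => //.
apply: measurable_funM => //; apply: measurable_prod => j _.
exact: measurable_funB.
Qed.

Lemma measurable_wrt_comp {R : realType} (I J X Y : Type) (g : I -> Y -> R)
    (g' : J -> X -> R) (phi : X -> Y) (h : Y -> R) :
  (forall i, measurable_wrt (sigma_of g') (g i \o phi)) ->
  measurable_wrt (sigma_of g) h -> measurable_wrt (sigma_of g') (h \o phi).
Proof.
move=> gphi mh B mB.
have [s0 sC sU] : sigma_algebra setT (sigma_of g') by exact: smallest_sigma_algebra.
have sub : sigma_of g `<=` [set C | sigma_of g' (phi @^-1` C)].
  apply: smallest_sub; first split.
  - by rewrite /= preimage_set0.
  - by move=> A /sC; rewrite /= !setTD preimage_setC.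
  - by move=> F FG; rewrite /= preimage_bigcup; exact: sU.
  - by move=> _ [i _ [D mD <-]]; rewrite /= setTI -comp_preimage; exact: gphi.
exact: (sub _ (mh B mB)).
Qed.

Section algebra_density.
Context {R : realType} d {E : measurableType d} (m : {measure set E -> \bar R}).
Context (I : Type) (g : I -> E -> R).
Hypothesis mg : forall i, measurable_fun setT (g i).
Hypothesis galg : bounded_algebra (range g).

Let bclosure_g C : sigma_of g C -> bclosure (range g) (\1_C).
Proof.
apply: bclosure_sigma_of => // i c; apply: bclosure_lt => //.
by apply: bclosure_base; exists i.
Qed.

Lemma bclosure_measurable f : bclosure (range g) f -> measurable_fun setT f.
Proof.
elim=> [_ [i _ <-]//|f_ {}f M _ IH _ fl].
by apply: (measurable_fun_cvg IH) => x _; exact: fl.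
Qed.

(** By bounded limits the annihilated functions include the indicators of
    $\{h > 0\}$ and $\{h < 0\}$. *)
Lemma annihilator_ae0 h w : measurable_wrt (sigma_of g) h ->
  (forall x, 0 <= w x) -> m.-integrable setT (EFin \o (fun x => h x * w x)) ->
  (forall i, \int[m]_x (g i x * (h x * w x)) = 0) ->
  {ae m, forall x, h x * w x = 0}.
Proof.
move=> mh w0 ihw ann.
have annC C : sigma_of g C -> \int[m]_x (\1_C x * (h x * w x)) = 0.
  move=> /bclosure_g; elim=> [_ [i _ <-]//|f_ f M Bf IH fM fl].
  have cf := cvg_Rintegral_bounded (fun n => bclosure_measurable (Bf n)) fl fM ihw.
  by rewrite -(cvg_lim _ cf)//; apply: lim_near_cst => //; exact: nearW.
have ind_ihw C : sigma_of g C ->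
    m.-integrable setT (EFin \o (fun x => \1_C x * (h x * w x))).
  move=> sC; apply: (@integrable_mul_bounded _ _ _ _ _ _ 1) => //.
    exact/measurable_indicP/(sigma_of_measurable mg).
  by move=> x; rewrite indicE; case: (_ \in _); rewrite ?normr1 ?normr0.
have sp : sigma_of g [set x | 0 < h x].
  have := mh _ (measurable_itv `]0, +oo[).
  by congr (sigma_of g _); apply/seteqP; split=> x /=; rewrite in_itv/= andbT.
have sn : sigma_of g [set x | h x < 0].
  have := mh _ (measurable_itv `]-oo, 0[).
  by congr (sigma_of g _); apply/seteqP; split=> x /=; rewrite in_itv/=.
have ap := Rintegral_eq0_ae (ind_ihw _ sp).
have an := Rintegral_eq0_ae (integrableN (ind_ihw _ sn)).
have {}ap : {ae m, forall x, \1_[set x | 0 < h x] x * (h x * w x) = 0}.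
  apply: ap; last by rewrite annC.
  move=> x; rewrite indicE; have [|] := boolP (_ \in _); last by rewrite mul0r.
  by rewrite inE/= => hx; rewrite mul1r mulr_ge0// ltW.
have {}an : {ae m, forall x, - (\1_[set x | h x < 0] x * (h x * w x)) = 0}.
  apply: an.
    move=> x; rewrite indicE; have [|] := boolP (_ \in _); last by rewrite mul0r oppr0.
    by rewrite inE/= => hx; rewrite mul1r -mulNr mulr_ge0// oppr_ge0 ltW.
  rewrite (_ : \int[m]_x _ = 0)//.
  have := RintegralZl (-1) measurableT (ind_ihw _ sn).
  rewrite annC// mulr0 => e; rewrite -[RHS]e; by apply: eq_Rintegral => x _; rewrite mulN1r.
apply: filterS2 ap an => x.
rewrite !indicE; have [hx|hx|->] := ltrgtP (h x) 0; last by rewrite mul0r.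
  have hx' : [set y | h y < 0] x := hx.
  by rewrite (mem_set hx') mul1r => _ /eqP; rewrite oppr_eq0 => /eqP.
have hx' : [set y | 0 < h y] x := hx.
by rewrite (mem_set hx') mul1r.
Qed.

(** Squares suffice as test functions because the indicator of $\{h < 0\}$ is
    its own square and a bounded limit of elements of the algebra. *)
Lemma square_positive_ae h w : measurable_wrt (sigma_of g) h ->
  (forall x, 0 <= w x) -> m.-integrable setT (EFin \o (fun x => h x * w x)) ->
  (forall i, 0 <= \int[m]_x (g i x ^+ 2 * (h x * w x))) ->
  {ae m, forall x, 0 <= h x * w x}.
Proof.
move=> mh w0 ihw pos.
have posC C : sigma_of g C -> 0 <= \int[m]_x (\1_C x ^+ 2 * (h x * w x)).
  move=> /bclosure_g; elim=> [_ [i _ <-]//|f_ f M Bf IH fM fl].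
  have cf : \int[m]_x (f_ n x ^+ 2 * (h x * w x)) @[n --> \oo] -->
      \int[m]_x (f x ^+ 2 * (h x * w x)).
    apply: (@cvg_Rintegral_bounded _ _ _ _ _ _ _ (M ^+ 2)) => //.
    - by move=> n; apply: measurable_funX; exact: bclosure_measurable.
    - by move=> x; under eq_fun do rewrite expr2; rewrite expr2; exact: cvgM.
    - by move=> n x; rewrite normrX lerXn2r ?nnegrE// (le_trans _ (fM 0%N x)).
  by rewrite -(cvg_lim _ cf)//; apply: limr_ge; [exact: cvgP cf|exact: nearW].
have sn : sigma_of g [set x | h x < 0].
  have := mh _ (measurable_itv `]-oo, 0[).
  by congr (sigma_of g _); apply/seteqP; split=> x /=; rewrite in_itv/=.
have ii : m.-integrable setT
    (EFin \o (fun x => - \1_[set x | h x < 0] x ^+ 2 * (h x * w x))).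
  apply: (@integrable_mul_bounded _ _ _ _ _ _ 1) => //.
    apply: measurableT_comp => //; apply: measurable_funX.
    exact/measurable_indicP/(sigma_of_measurable mg).
  by move=> x; rewrite indicE normrN; case: (_ \in _); rewrite ?expr1n ?expr0n ?normr1 ?normr0.
have : {ae m, forall x, - \1_[set x | h x < 0] x ^+ 2 * (h x * w x) = 0}.
  apply: (Rintegral_eq0_ae ii).
    move=> x; rewrite indicE; have [|] := boolP (_ \in _); last first.
      by rewrite expr0n/= oppr0 mul0r.
    by rewrite inE/= expr1n => hx; rewrite mulN1r -mulNr mulr_ge0// oppr_ge0 ltW.
  rewrite (_ : \int[m]_x _ = -1 * \int[m]_x (\1_[set x | h x < 0] x ^+ 2 * (h x * w x))).
    by rewrite mulN1r oppr_le0 posC.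
  rewrite -RintegralZl//.
    by apply: eq_Rintegral => x _; rewrite mulN1r mulNr.
  have := integrableN ii; congr (_.-integrable _ _); apply/funext => x /=.
  by rewrite mulNr opprK.
apply: filterS => x; rewrite indicE; have [hx _|hx] := leP 0 (h x).
  by rewrite mulr_ge0.
by rewrite mem_set// expr1n mulN1r => /eqP; rewrite oppr_eq0 => /eqP ->.
Qed.

End algebra_density.

(** * Densities of functionals bounded in a weighted $L^2$ *)

Lemma quadratic_ge0_discr {R : realFieldType} (a b c : R) :
  (forall t, 0 <= a + 2 * t * b + t ^+ 2 * c) -> 0 <= c -> b ^+ 2 <= a * c.
Proof.
move=> q; rewrite le_eqVlt => /predU1P[c0|c0].
  rewrite -c0 mulr0; have [->|b0] := eqVneq b 0; first by rewrite expr0n.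
  have := q (- (a + 1) / (2 * b)); rewrite -c0 mulr0 addr0.
  have -> : 2 * (- (a + 1) / (2 * b)) * b = - (a + 1) by field.
  lra.
have := q (- b / c).
have -> : a + 2 * (- b / c) * b + (- b / c) ^+ 2 * c = (a * c - b ^+ 2) / c.
  by field; rewrite gt_eqF.
by rewrite pmulr_lge0 ?invr_gt0// subr_ge0.
Qed.

(** Turns summable increments into pointwise convergence, with a majorant to
    which dominated convergence applies. *)
Lemma cvg_series_abs_bound {R : realType} (u : R^nat) :
  (\sum_(0 <= n <oo) `|u n.+1 - u n|%:E)%E \is a fin_num ->
  (forall n, `|u n| <= `|u 0%N| +
     fine (\sum_(0 <= n <oo) `|u n.+1 - u n|%:E)%E) /\ cvgn u.
Proof.
set S := (\sum_(0 <= n <oo) _)%E => Sfin.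
have part n : \sum_(0 <= k < n) `|u k.+1 - u k| <= fine S.
  rewrite -lee_fin fineK// -sumEFin.
  by apply: nneseries_lim_ge => k _ _; rewrite lee_fin.
split=> [n|].
  rewrite {1}(eq_sum_telescope u n) (le_trans (ler_normD _ _))// lerD2l.
  by rewrite /series/=; apply: le_trans (part n); exact: ler_norm_sum.
have cs : cvgn (series (telescope u)).
  apply: normed_cvg; apply: nondecreasing_is_cvgn.
    by apply: nondecreasing_series => k _ _; exact: normr_ge0.
  by exists (fine S) => _ [n _ <-]; exact: part.
have -> : u = (fun n => u 0%N + series (telescope u) n).
  by apply/funext => n; rewrite -eq_sum_telescope.
by apply: is_cvgD => //; exact: is_cvg_cst.
Qed.

Section weighted_riesz.
Context {R : realType} d {E : measurableType d} (m : {measure set E -> \bar R}).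
Context (I : Type) (i0 : I) (g : I -> E -> R).
Context (add : I -> I -> I) (scl : R -> I -> I) (L : I -> R).
Hypothesis mg : forall i, measurable_fun setT (g i).
Hypothesis bg : forall i, exists M, forall x, `|g i x| <= M.
Hypothesis gadd : forall i j x, g (add i j) x = g i x + g j x.
Hypothesis gscl : forall c i x, g (scl c i) x = c * g i x.
Hypothesis Ladd : forall i j, L (add i j) = L i + L j.
Hypothesis Lscl : forall c i, L (scl c i) = c * L i.
Variables (w : E -> R) (c : R).
Hypothesis w0 : forall x, 0 <= w x.
Hypothesis iw : m.-integrable setT (EFin \o w).
Hypothesis c0 : 0 <= c.
Hypothesis Lle : forall i, L i ^+ 2 <= c * \int[m]_x (g i x * g i x * w x).

Let B i j := \int[m]_x (g i x * g j x * w x).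

Let iB i j : m.-integrable setT (EFin \o (fun x => g i x * g j x * w x)).
Proof.
have [M gM] := bg i; have [N gN] := bg j.
apply: (@integrable_mul_bounded _ _ _ _ (fun x => g i x * g j x) _ (M * N)) => //.
  exact: measurable_funM.
by move=> x; rewrite normrM ler_pM.
Qed.

Let BC i j : B i j = B j i.
Proof. by apply: eq_Rintegral => x _; rewrite (mulrC (g i x)). Qed.

Let Badd i j k : B (add i j) k = B i k + B j k.
Proof.
rewrite /B -RintegralD//; apply: eq_Rintegral => x _.
by rewrite gadd !mulrDl.
Qed.

Let Bscl a i k : B (scl a i) k = a * B i k.
Proof.
rewrite /B -RintegralZl//; apply: eq_Rintegral => x _.
by rewrite gscl !mulrA.
Qed.

Let B0 i : 0 <= B i i.
Proof. by apply: Rintegral_ge0 => x _; rewrite mulr_ge0// -expr2 sqr_ge0. Qed.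

(** The minimiser of this functional is the element that represents $L$. *)
Let J i := B i i - 2 * L i.

Let J_lb : lbound (range J) (- c).
Proof.
move=> _ [i _ <-]; rewrite /J lerBrDr addrC.
have h : (2 * L i) ^+ 2 <= (B i i + c) ^+ 2.
  rewrite exprMn; have := Lle i; rewrite -/(B i i).
  have : 0 <= (B i i - c) ^+ 2 by exact: sqr_ge0.
  rewrite !expr2; lra.
have : `|2 * L i| <= B i i + c.
  by rewrite -ler_sqr ?nnegrE ?addr_ge0// real_normK ?num_real.
by move/(le_trans (ler_norm _)); lra.
Qed.

Let J_inf : has_inf (range J).
Proof. by split; [exists (J i0); exists i0|exists (- c); exact: J_lb]. Qed.

Let minimizing : {s : nat -> I &
  forall n, J (s n) < inf (range J) + 4^-1 ^+ n}.
Proof.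
suff h n : exists i, J i < inf (range J) + 4^-1 ^+ n by exact: choice h.
have e0 : (0 : R) < 4^-1 ^+ n by rewrite exprn_gt0.
by have [_ [i _ <-] Ji] := inf_adherent e0 J_inf; exists i.
Qed.

Let s := projT1 minimizing.

(** Perturbing an almost-minimiser in the direction $j$ shows that it almost
    represents $L$ at $j$. *)
Let almost_represents n j : (B (s n) j - L j) ^+ 2 <= 4^-1 ^+ n * B j j.
Proof.
apply: quadratic_ge0_discr => // t.
have Js := projT2 minimizing n; rewrite -/s in Js.
have := inf_lbound (proj2 J_inf) (imageT J (add (s n) (scl t j))).
rewrite [J (add _ _)]/J Badd Bscl Ladd Lscl (BC (s n)) (BC j) !Badd !Bscl (BC j (s n)).
by move: Js; rewrite /J expr2; lra.
Qed.

Let step n := add (s n.+1) (scl (-1) (s n)).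

Let B_step n : B (step n) (step n) <= 4 * 4^-1 ^+ n.
Proof.
pose j := step n; rewrite -/j; have hn := almost_represents n j.
have hn1 := almost_represents n.+1 j.
have e0 : (0 : R) < 4^-1 ^+ n by rewrite exprn_gt0.
have jj : B j j = (B (s n.+1) j - L j) - (B (s n) j - L j).
  by rewrite {1}/j /step Badd Bscl; lra.
have N0 := B0 j.
rewrite [4^-1 ^+ n.+1]exprS in hn1.
have : B j j * B j j <= 4 * 4^-1 ^+ n * B j j.
  have NN : B j j * B j j = (B (s n.+1) j - L j) ^+ 2 + (B (s n) j - L j) ^+ 2 -
      2 * ((B (s n.+1) j - L j) * (B (s n) j - L j)).
    by rewrite {1 2}jj; ring.
  have : 0 <= ((B (s n.+1) j - L j) + (B (s n) j - L j)) ^+ 2 by exact: sqr_ge0.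
  have : 0 <= 4^-1 ^+ n * B j j by rewrite mulr_ge0// ltW.
  rewrite NN; move: hn hn1.
  move: (B (s n.+1) j - L j) (B (s n) j - L j) (4^-1 ^+ n) (B j j) => x y e z.
  lra.
have [->|N1] := eqVneq (B j j) 0; first by move=> _; rewrite mulr_ge0// ltW.
by rewrite ler_pM2r// lt_neqAle eq_sym N1.
Qed.

Let W := \int[m]_x w x.

Let u n x := g (s n) x * w x.
Let a n x := `|u n.+1 x - u n x|.
Let S x := (\sum_(0 <= n <oo) (a n x)%:E)%E.

Let iu n : m.-integrable setT (EFin \o u n).
Proof. by have [M gM] := bg (s n); exact: integrable_mul_bounded gM iw. Qed.

Let ia n : m.-integrable setT (EFin \o a n).
Proof.
have := integrable_abse (integrableB measurableT (iu n.+1) (iu n)).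
by congr (_.-integrable _ _); apply/funext => x.
Qed.

(** The increments decrease like $2^{-n}$ in $L^2(w)$, hence in $L^1(w)$ since
    $w$ is integrable; the choice of $4^{-n}$ in the minimising sequence makes
    them summable. *)
Let ia_le n : (\int[m]_x (a n x)%:E <= ((2 + W / 2) * 2^-1 ^+ n)%:E)%E.
Proof.
have -> : (\int[m]_x (a n x)%:E = (\int[m]_x (a n x))%:E)%E.
  by rewrite /Rintegral fineK//; exact: integrable_fin_num (ia n).
rewrite lee_fin; pose j := step n.
have p0 : (0 : R) < 2^-1 ^+ n by rewrite exprn_gt0.
have pE : (4^-1 : R) ^+ n = 2^-1 ^+ n * 2^-1 ^+ n.
  by rewrite -exprMn; congr (_ ^+ _); field.
have p1 : (2^-1 : R) ^+ n * 2 ^+ n = 1.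
  by rewrite -exprMn mulVf ?expr1n// pnatr_eq0.
have q0 : (0 : R) < 2 ^+ n by rewrite exprn_gt0.
apply: (@le_trans _ _ (\int[m]_x (2^-1 * 2 ^+ n * (g j x * g j x * w x) +
    2^-1 * 2^-1 ^+ n * w x))).
  apply: le_Rintegral => //.
    by apply: integrable_add; apply: integrable_scale => //; exact: (iB j j).
  move=> x _; rewrite /a /u -mulrBl normrM (ger0_norm (w0 x)).
  rewrite mulrA -mulrDl ler_wpM2r//.
  have -> : g (s n.+1) x - g (s n) x = g j x by rewrite /j /step gadd gscl mulN1r.
  have : 0 <= 2 ^+ n * (`|g j x| - 2^-1 ^+ n) ^+ 2.
    by rewrite mulr_ge0 ?sqr_ge0// ltW.
  have -> : g j x * g j x = `|g j x| * `|g j x|.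
    by rewrite -!expr2 real_normK ?num_real.
  move: (2^-1 ^+ n) (2 ^+ n) p1 (`|g j x|) => p q pq z.
  have -> : q * (z - p) ^+ 2 = q * (z * z) - 2 * z * (p * q) + (p * q) * p by ring.
  by rewrite pq; lra.
rewrite RintegralD//; last 2 first.
  - exact: integrable_scale (iB j j).
  - exact: integrable_scale iw.
rewrite RintegralZl// RintegralZl// -/W -/(B j j).
have := B_step n; rewrite -/j => /(ler_wpM2l (ltW q0)).
rewrite pE (_ : 2 ^+ n * (4 * (2^-1 ^+ n * 2^-1 ^+ n)) =
  4 * ((2^-1 ^+ n * 2 ^+ n) * 2^-1 ^+ n)); last by ring.
rewrite p1; lra.
Qed.

Let mS : measurable_fun setT S.
Proof.
apply: ge0_emeasurable_sum => [k x _ _|k _]; first by rewrite lee_fin /a.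
exact: measurable_int (ia k).
Qed.

Let S0 x : (0 <= S x)%E.
Proof. by apply: nneseries_ge0 => n _ _; rewrite lee_fin /a. Qed.

Let iS : m.-integrable setT S.
Proof.
apply/integrableP; split=> //.
under eq_integral => x _ do rewrite (gee0_abs (S0 x)).
rewrite /S integral_nneseries//; last 2 first.
  - by move=> n; exact: measurable_int (ia n).
  - by move=> n x _; rewrite lee_fin /a.
have W0 : 0 <= W by exact: Rintegral_ge0.
apply: (@le_lt_trans _ _ ((2 + W / 2) * 2)%:E); last exact: ltry.
apply: lime_le.
  by apply: is_cvg_nneseries => n _ _; apply: integral_ge0 => x _; rewrite lee_fin /a.
apply: nearW => n.
apply: (le_trans (lee_sum _ (fun k _ => ia_le k))).
rewrite sumEFin lee_fin -mulr_sumr ler_wpM2l//; first by rewrite addr_ge0// divr_ge0.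
have -> : \sum_(0 <= k < n) (2^-1 : R) ^+ k = 2 - 2 * 2^-1 ^+ n.
  elim: n => [|n IH]; first by rewrite big_nil expr0; lra.
  by rewrite big_nat_recr//= IH exprS; lra.
have : (0 : R) < 2^-1 ^+ n by rewrite exprn_gt0.
lra.
Qed.

(** A functional bounded for the weighted $L^2$ norm on a space of bounded
    functions is integration against a density; it is the limit of a
    minimising sequence, so it is measurable for the sigma-algebra generated by
    that space, a fact that an abstract representation theorem would hide. *)
Lemma riesz_density : exists h : E -> R,
  [/\ measurable_wrt (sigma_of g) h,
      m.-integrable setT (EFin \o (fun x => h x * w x)) &
      forall i, L i = \int[m]_x (g i x * (h x * w x))].
Proof.
pose h x := fine (limn_esup (fun n => (g (s n) x)%:E)).
have mh : measurable_wrt (sigma_of g) h.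
  apply/measurable_wrtP.
  apply: measurableT_comp; first exact: fine_measurable.
  apply: measurable_fun_limn_esup => n; apply/measurable_EFinP/measurable_wrtP.
  exact: (@measurable_wrt_generator _ _ _ g (s n)).
have mh' := measurable_wrt_measurable mg mh.
have mw : measurable_fun setT w by apply/measurable_EFinP; exact: measurable_int iw.
have aeS : {ae m, forall x, S x \is a fin_num}.
  by apply: filterS (integrable_ae measurableT iS) => x; apply.
have uh x : S x \is a fin_num -> u n x @[n --> \oo] --> h x * w x.
  move=> Sx; have [_ cu] := @cvg_series_abs_bound _ (u ^~ x) Sx.
  have [wx|wx] := eqVneq (w x) 0.
    by rewrite wx mulr0 /u; under eq_fun do rewrite wx mulr0; exact: cvg_cst.
  have gl : g (s n) x @[n --> \oo] --> limn (u ^~ x) * (w x)^-1.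
    have : u n x * (w x)^-1 @[n --> \oo] --> limn (u ^~ x) * (w x)^-1.
      by apply: cvgMl.
    by under eq_fun do rewrite /u mulfK//.
  have -> : h x * w x = limn (u ^~ x).
    have gl' : (g (s n) x)%:E @[n --> \oo] --> (limn (u ^~ x) * (w x)^-1)%:E.
      by apply: cvg_EFin => //; exact: nearW.
    rewrite /h (cvg_limn_einf_sup gl').2 /=.
    by rewrite divfK.
  exact: cu.
pose D x := `|u 0%N x| + fine (S x).
have iD : m.-integrable setT (EFin \o D).
  apply: integrable_add; first exact: integrable_abse (iu 0%N).
  apply: (le_integrable measurableT _ _ iS).
    by apply/measurable_EFinP; apply: measurableT_comp => //; exact: fine_measurable.
  move=> x _ /=; by case: (S x) => [r||]; rewrite /= ?leey.
have uD x n : S x \is a fin_num -> `|u n x| <= D x.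
  by move=> Sx; have [h1 _] := @cvg_series_abs_bound _ (u ^~ x) Sx; exact: h1.
have mhw : measurable_fun setT (fun x => h x * w x) by exact: measurable_funM.
have mu n : measurable_fun setT (u n).
  by apply/measurable_EFinP; exact: measurable_int (iu n).
have uhae : {ae m, forall x, u n x @[n --> \oo] --> h x * w x}.
  by apply: filterS aeS.
have uDae : {ae m, forall x, forall n, `|u n x| <= D x}.
  by apply: filterS aeS => x Sx n; exact: uD.
have [ihw _] := cvg_Rintegral_dominated mu uhae mhw uDae iD.
exists h; split=> // i.
have [M gM] := bg i.
have [|||||_ cB] := @cvg_Rintegral_dominated _ _ _ m (fun n x => g i x * u n x)
    (fun x => g i x * (h x * w x)) (fun x => M * D x).
- by move=> n; exact: measurable_funM.
- by apply: filterS uhae => x; exact: cvgMr.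
- exact: measurable_funM.
- by apply: filterS uDae => x uDx n; rewrite normrM ler_pM.
- exact: integrable_scale iD.
apply/eqP; rewrite eq_sym -subr_eq0 -sqrf_eq0 eq_le sqr_ge0 andbT.
have c1 : (B (s n) i - L i) ^+ 2 @[n --> \oo] -->
    (\int[m]_x (g i x * (h x * w x)) - L i) ^+ 2.
  under eq_fun do rewrite expr2; rewrite expr2.
  have cd : B (s n) i - L i @[n --> \oo] --> \int[m]_x (g i x * (h x * w x)) - L i.
    apply: cvgB; last exact: cvg_cst.
    have -> : (fun n => B (s n) i) = (fun n => \int[m]_x (g i x * u n x)).
      apply/funext => n; apply: eq_Rintegral => x _.
      by rewrite /u mulrA (mulrC (g i x)).
    exact: cB.
  exact: cvgM.
have c2 : (4^-1 ^+ n * B i i) @[n --> \oo] --> (0 : R).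
  rewrite -[X in _ --> X](mul0r (B i i)); apply: cvgMl.
  by apply: cvg_expr; rewrite ger0_norm//; lra.
by apply: (ler_cvg_to c1 c2); apply: nearW => n; exact: almost_represents.
Qed.

End weighted_riesz.

(** * Formal trigonometric polynomials and negative type *)

Section formal_trigonometric_polynomials.
Context {R : realType} {T : Type}.
Implicit Types (g : T -> R) (Z : seq (R * T)) (p q : seq (R * seq (R * T))).

Definition lin g Z : R := \sum_(c <- Z) c.1 * g c.2.
Definition lscale a Z := [seq (a * c.1, c.2) | c <- Z].

Lemma lin_nil g : lin g [::] = 0. Proof. exact: big_nil. Qed.

Lemma lin_cat g Z1 Z2 : lin g (Z1 ++ Z2) = lin g Z1 + lin g Z2.
Proof. exact: big_cat. Qed.

Lemma lin_lscale g a Z : lin g (lscale a Z) = a * lin g Z.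
Proof.
rewrite /lin big_map mulr_sumr; apply: eq_bigr => c _; exact/esym/mulrA.
Qed.

Lemma lin_scale a g Z : lin (fun t => a * g t) Z = a * lin g Z.
Proof.
rewrite /lin mulr_sumr; apply: eq_bigr => c _.
by rewrite mulrCA.
Qed.

Lemma lin0 Z : lin (fun=> 0) Z = 0.
Proof. by rewrite /lin big1// => c _; rewrite mulr0. Qed.

(** Formal trigonometric polynomials: a list of coefficients and frequencies,
    kept formal because the functionals below are known on frequencies only. *)
Definition tev g p : R := \sum_(c <- p) c.1 * cos (lin g c.2).
Definition tscale a p := [seq (a * c.1, c.2) | c <- p].
(** The product formula $\cos a \cos b = (\cos(a + b) + \cos(a - b)) / 2$. *)
Definition tmul p q :=
  [seq (c.1 * e.1 / 2, c.2 ++ e.2) | c <- p, e <- q] ++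
  [seq (c.1 * e.1 / 2, c.2 ++ lscale (-1) e.2) | c <- p, e <- q].
Definition one_minus_cos Z : seq (R * seq (R * T)) := [:: (1, [::]); (-1, Z)].

Lemma tev_cat g p q : tev g (p ++ q) = tev g p + tev g q.
Proof. exact: big_cat. Qed.

Lemma tev_scale g a p : tev g (tscale a p) = a * tev g p.
Proof.
rewrite /tev big_map mulr_sumr; apply: eq_bigr => c _; exact/esym/mulrA.
Qed.

Lemma tev_mul g p q : tev g (tmul p q) = tev g p * tev g q.
Proof.
rewrite /tev big_cat /= !big_allpairs_dep /= -big_split /= mulr_suml.
apply: eq_bigr => c _; rewrite -big_split mulr_sumr; apply: eq_bigr => e _ /=.
rewrite !lin_cat lin_lscale mulN1r cosD cosB.
by field.
Qed.

Lemma tev_one_minus_cos g Z : tev g (one_minus_cos Z) = 1 - cos (lin g Z).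
Proof.
by rewrite /tev /one_minus_cos !big_cons big_nil /= lin_nil cos0; ring.
Qed.

Lemma tev_one g : tev g [:: (1, [::])] = 1.
Proof. by rewrite /tev big_seq1 lin_nil cos0 mulr1. Qed.

Lemma tev_bounded p : exists M, forall g, `|tev g p| <= M.
Proof.
exists (\sum_(c <- p) `|c.1|) => g.
rewrite (le_trans (ler_norm_sum _ _ _))//; apply: ler_sum => c _.
by rewrite normrM ler_piMr// cos_max.
Qed.

(** The value on a trigonometric polynomial vanishing at $0$ of the functional
    that sends $1 - \cos Z$ to $\varphi(Z)$. *)
Definition levy_functional (phi : seq (R * T) -> R) p : R :=
  - \sum_(c <- p) c.1 * phi c.2.

(** Schoenberg's condition on $\varphi$, stated for the functional because this
    is the positivity that bounds densities. *)
Definition negative_type (phi : seq (R * T) -> R) : Prop :=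
  forall p, (forall g, 0 <= tev g p) -> tev (fun=> 0) p = 0 ->
    0 <= levy_functional phi p.

Lemma levy_functional_cat phi p q :
  levy_functional phi (p ++ q) = levy_functional phi p + levy_functional phi q.
Proof. by rewrite /levy_functional big_cat opprD. Qed.

Lemma levy_functional_scale phi a p :
  levy_functional phi (tscale a p) = a * levy_functional phi p.
Proof.
rewrite /levy_functional big_map mulrN mulr_sumr; congr (- _).
by apply: eq_bigr => c _; exact/esym/mulrA.
Qed.

Lemma levy_functional_one_minus_cos phi Z : phi [::] = 0 ->
  levy_functional phi (one_minus_cos Z) = phi Z.
Proof.
by move=> phi0; rewrite /levy_functional !big_cons big_nil /= phi0; ring.
Qed.

Lemma negative_type_mono phi p q : negative_type phi ->
  (forall g, tev g p <= tev g q) ->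
  tev (fun=> 0) p = 0 -> tev (fun=> 0) q = 0 ->
  levy_functional phi p <= levy_functional phi q.
Proof.
move=> nphi pq p0 q0; rewrite -subr_ge0 -mulN1r -levy_functional_scale addrC.
rewrite -levy_functional_cat; apply: nphi => [g|].
  by rewrite tev_cat tev_scale mulN1r addrC subr_ge0.
by rewrite tev_cat tev_scale p0 q0 mulr0 addr0.
Qed.

(** The functional of a $\varphi$ of negative type descends from formal
    polynomials to the functions that they define. *)
Lemma negative_type_ext phi p q : negative_type phi ->
  (forall g, tev g p = tev g q) -> tev (fun=> 0) p = 0 ->
  levy_functional phi p = levy_functional phi q.
Proof.
move=> nphi pq p0; have q0 : tev (fun=> 0) q = 0 by rewrite -pq.
by apply/eqP; rewrite eq_le !negative_type_mono// => g; rewrite pq.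
Qed.

End formal_trigonometric_polynomials.

(** * The stable Levy density on a logarithmic scale *)
Section stable_kernel.
Context {R : realType}.
Implicit Types (x y t alpha : R).
Local Notation leb := (@lebesgue_measure R).

(** The bound on $c$ is what gives $n \sin(y / n) \to y$. *)
Lemma sin_mean_value t : exists2 c, `|c| <= `|t| & sin t = cos c * t.
Proof.
wlog t0 : t / 0 <= t.
  move=> h; have [|/ltW t0] := leP 0 t; first exact: h.
  have [|c ct e] := h (- t); first by rewrite oppr_ge0.
  exists c; first by rewrite -(normrN t).
  by apply: oppr_inj; rewrite -sinN e mulrN.
move: t0; rewrite le_eqVlt => /predU1P[<-|t0].
  by exists 0; rewrite ?sin0 ?mulr0.
have sd y : is_derive y 1 (@sin R) (cos y) by exact: is_derive_sin.
have [c] : exists2 c, c \in `]0, t[ & sin t - sin 0 = cos c * (t - 0).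
  apply: MVT => //; apply: continuous_subspaceT => y.
  exact: continuous_sin.
rewrite in_itv/= sin0 !subr0 => /andP[c0 ct] ->; exists c => //.
by rewrite !gtr0_norm// ltW.
Qed.

Lemma sin_sqr_le x : sin x ^+ 2 <= x ^+ 2.
Proof.
have [c _ ->] := sin_mean_value x.
by rewrite exprMn ler_piMl ?sqr_ge0// -real_normK ?num_real// exprn_ile1// cos_max.
Qed.

Lemma one_minus_cos_le t : 1 - cos t <= t ^+ 2.
Proof.
have -> : cos t = cos ((t / 2) *+ 2) by congr cos; rewrite -mulr_natr divfK.
rewrite cos_mulr2n cos2sin2 mulr2n; have := sin_sqr_le (t / 2).
by have := sqr_ge0 t; rewrite exprMn exprVn !expr2; lra.
Qed.

Lemma one_minus_cos_ge0 t : 0 <= 1 - cos t.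
Proof. by rewrite subr_ge0 cos_le1. Qed.

Lemma lebesgue_measure_shift c (A : set R) : measurable A ->
  pushforward leb (fun x : R => x + c : measurableTypeR R) A = leb A.
Proof.
move=> mA; have mp : measurable_fun setT (fun x : R => x + c : measurableTypeR R).
  exact: measurable_funD.
apply/esym/lebesgue_measure_unique => //= _ [[a b]] _ <-.
rewrite /pushforward (_ : _ @^-1` _ = `]a - c, b - c]%classic); last first.
  by apply/seteqP; split=> x /=; rewrite !in_itv/= ltrBlDr lerBrDr.
rewrite !lebesgue_measure_itv/= !lte_fin ltrD2r.
by case: ifP => // _; rewrite -!EFinB; congr (_%:E); ring.
Qed.

Lemma integral_lebesgue_invariant (phi : R -> R) (f : R -> \bar R) :
  measurable_fun setT phi ->
  (forall A, measurable A ->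
    pushforward leb (phi : R -> measurableTypeR R) A = leb A) ->
  measurable_fun setT f -> (forall x, (0 <= f x)%E) ->
  (\int[leb]_x f (phi x) = \int[leb]_x f x)%E.
Proof.
move=> mphi inv mf f0.
transitivity (\int[pushforward leb (phi : R -> measurableTypeR R)]_x f x)%E.
  by rewrite ge0_integral_pushforward.
by apply: eq_measure_integral => A mA _; exact: inv.
Qed.

Lemma integral_lebesgue_shift c (f : R -> \bar R) :
  measurable_fun setT f -> (forall x, (0 <= f x)%E) ->
  (\int[leb]_x f ((x : R) + c)%R = \int[leb]_x f x)%E.
Proof.
move=> mf f0; apply: (integral_lebesgue_invariant (phi := fun x => x + c)) => //.
  exact: measurable_funD.
by move=> A mA; exact: lebesgue_measure_shift.
Qed.

Lemma integral_lebesgue_opp (f : R -> \bar R) :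
  measurable_fun setT f -> (forall x, (0 <= f x)%E) ->
  (\int[leb]_x f (- (x : R))%R = \int[leb]_x f x)%E.
Proof.
move=> mf f0; apply: (integral_lebesgue_invariant (phi := -%R)) => //.
by move=> A mA; exact: lebesgue_measureN.
Qed.

(** The Levy density of the symmetric $\alpha$-stable law on a logarithmic
    scale: with $u = e^x$ this is $(1 - \cos(u y)) u^{-1-\alpha} du$. *)
Definition stable_kernel alpha y x : R :=
  (1 - cos (expR x * y)) * expR (- (alpha * x)).

Lemma stable_kernel_ge0 alpha y x : 0 <= stable_kernel alpha y x.
Proof. by rewrite mulr_ge0 ?one_minus_cos_ge0// expR_ge0. Qed.

Lemma stable_kernel_shift alpha y x c :
  stable_kernel alpha y (x + c) =
  expR (- (alpha * c)) * stable_kernel alpha (expR c * y) x.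
Proof.
rewrite /stable_kernel expRD mulrDr opprD expRD (mulrC (expR x)) -!mulrA.
by rewrite (mulrCA (expR x)); ring.
Qed.

Lemma stable_kernel_norm alpha y x : stable_kernel alpha `|y| x = stable_kernel alpha y x.
Proof.
rewrite /stable_kernel; case: (ger0P y) => // _.
by rewrite mulrN cosN.
Qed.

Lemma measurable_stable_kernel alpha y : measurable_fun setT (stable_kernel alpha y).
Proof.
have m1 : measurable_fun setT (fun x : R => expR x * y).
  by apply: measurable_funM => //; exact: measurable_expR.
have m2 : measurable_fun setT (fun x : R => - (alpha * x)).
  by apply: (measurableT_comp (@oppr_measurable R setT)); exact: measurable_funM.
apply: measurable_funM; last exact: (measurableT_comp (@measurable_expR R) m2).
by apply: measurable_funB => //; exact: measurable_cos_fun.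
Qed.

Variable alpha : R.
Hypothesis alpha02 : 0 < alpha < 2.

(** For $x \ge 0$ the factor $1 - \cos$ is bounded and $\alpha > 0$ gives decay;
    for $x < 0$ it is at most $e^{2x}$ and $\alpha < 2$ does.  Both bounds are
    multiples of exponential densities. *)
Lemma integrable_stable_kernel1 :
  leb.-integrable setT (EFin \o stable_kernel alpha 1).
Proof.
have /andP[a0 a2] := alpha02; have b0 : 0 < 2 - alpha by rewrite subr_gt0.
pose p x := 2 / alpha * exponential_pdf alpha x.
pose q x := (2 - alpha)^-1 * exponential_pdf (2 - alpha) (- x).
have ip : leb.-integrable setT (EFin \o p).
  exact: integrable_scale (integrable_exponential_pdf a0).
have iq : leb.-integrable setT (EFin \o q).
  apply: integrable_scale; apply/integrableP; split.
    apply/measurable_EFinP; apply: (measurableT_comp (f := exponential_pdf _)) => //.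
    exact: measurable_exponential_pdf.
  rewrite (integral_lebesgue_opp (f := fun x => `|(exponential_pdf (2 - alpha) x)%:E|%E)).
  - by have /integrableP[] := integrable_exponential_pdf b0.
  - apply: measurableT_comp => //; apply/measurable_EFinP.
    exact: measurable_exponential_pdf.
  - by move=> x; exact: abse_ge0.
have ipq := integrable_add ip iq.
apply: (le_integrable measurableT _ _ ipq).
  by apply/measurable_EFinP; exact: measurable_stable_kernel.
have p0 x : 0 <= p x by rewrite mulr_ge0 ?exponential_pdf_ge0 ?divr_ge0// ltW.
have q0 x : 0 <= q x by rewrite mulr_ge0 ?exponential_pdf_ge0 ?invr_ge0// ltW.
move=> x _ /=; rewrite lee_fin !ger0_norm ?stable_kernel_ge0 ?addr_ge0//.
have [x0|x0] := leP 0 x.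
  apply: (@le_trans _ _ (p x)); last by rewrite lerDl.
  rewrite /p exponential_pdfE// /= [2 / _ * _]mulrA divfK ?gt_eqF//.
  rewrite /stable_kernel mulNr ler_wpM2r ?expR_ge0//.
  by have := cos_geN1 (expR x * 1); lra.
apply: (@le_trans _ _ (q x)); last by rewrite lerDr.
rewrite /q exponential_pdfE ?oppr_ge0 ?(ltW x0)// /= mulrA.
rewrite mulVf ?gt_eqF// mul1r /stable_kernel mulr1.
have -> : - (2 - alpha) * - x = x + x + - (alpha * x) by ring.
rewrite expRD ler_wpM2r ?expR_ge0// expRD -expr2.
exact: one_minus_cos_le.
Qed.

Definition stable_const : R := \int[leb]_x stable_kernel alpha 1 x.

Lemma stable_constE :
  (\int[leb]_x (stable_kernel alpha 1 x)%:E = stable_const%:E)%E.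
Proof.
by rewrite /stable_const /Rintegral fineK//; exact: integrable_fin_num integrable_stable_kernel1.
Qed.

Lemma stable_const_gt0 : 0 < stable_const.
Proof.
have k0 : 0 <= stable_const by apply: Rintegral_ge0 => x _; exact: stable_kernel_ge0.
rewrite lt_neqAle k0 andbT; apply/negP => /eqP k00.
have := Rintegral_eq0_ae integrable_stable_kernel1 (stable_kernel_ge0 alpha 1).
rewrite -/stable_const -k00 => /(_ (lexx _)) ae0.
have [N [mN N0 sN]] := ae0.
have : (leb `[(-1)%R, 0%R]%classic <= leb N)%E.
  apply: le_measure; rewrite ?inE//.
  move=> x /=; rewrite in_itv/= => /andP[x1 x0]; apply: sN => /=.
  rewrite /stable_kernel mulr1 => /eqP; rewrite mulf_eq0 (gt_eqF (expR_gt0 _)) orbF.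
  rewrite subr_eq0 eq_sym => /eqP c1.
  have e0 := expR_gt0 x.
  have e1 : expR x <= 1 by rewrite -expR0 ler_expR.
  have : cos (expR x) < cos 0.
    have p1 := pihalf_ge1 R.
    by rewrite ltr_cos ?in_itv//=; apply/andP; split; lra.
  by rewrite c1 cos0 ltxx.
by rewrite [X in (_ <= X)%E]N0 lebesgue_measure_itv/= lte_fin ltrN10 -EFinB lee_fin; lra.
Qed.

(** Scaling by $|y|$ is a translation of $x$. *)
Lemma integral_stable_kernel y :
  (\int[leb]_x (stable_kernel alpha y x)%:E = (stable_const * `|y| `^ alpha)%:E)%E.
Proof.
have /andP[a0 _] := alpha02.
have [->|y0] := eqVneq y 0.
  rewrite normr0 powR0 ?gt_eqF// mulr0.
  apply: integral0_eq => x _; rewrite /stable_kernel mulr0 cos0 subrr mul0r//.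
have ny : 0 < `|y| by rewrite normr_gt0.
have -> : (\int[leb]_x (stable_kernel alpha y x)%:E =
    \int[leb]_x ((`|y| `^ alpha)%:E * (stable_kernel alpha 1 (x + ln `|y|))%:E))%E.
  apply: eq_integral => x _; rewrite stable_kernel_shift mulr1 lnK ?posrE//.
  rewrite stable_kernel_norm -EFinM mulrA; congr (_%:E).
  by rewrite /powR gt_eqF// -expRD addrN expR0 mul1r.
rewrite ge0_integralZl//; last 2 first.
- apply/measurable_EFinP; apply: (measurableT_comp (measurable_stable_kernel _ _)).
  exact: measurable_funD.
- by move=> x _; rewrite lee_fin stable_kernel_ge0.
rewrite (@integral_lebesgue_shift (ln `|y|) (fun x => (stable_kernel alpha 1 x)%:E)).
- by rewrite stable_constE -EFinM mulrC.
- by apply/measurable_EFinP; exact: measurable_stable_kernel.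
- by move=> x; rewrite lee_fin stable_kernel_ge0.
Qed.

End stable_kernel.

(** * The Levy measure of a family of spectral functions *)

Section levy_space.
Context {R : realType} (alpha : R) (T : Type).
Context {dS : measure_display} {S : measurableType dS}.
Variable mu : {sigma_finite_measure set S -> \bar R}.
Variable f : T -> S -> R.
Hypothesis alpha02 : 0 < alpha < 2.
Hypothesis mf : forall t, measurable_fun setT (f t).

Local Notation E := (S * measurableTypeR R)%type.
Local Notation Pi := (mu \x @lebesgue_measure R)%E.
Local Notation comb := (seq (R * T)).
Local Notation tpoly := (seq (R * seq (R * T))).
Local Notation kappa := (stable_const alpha).
Implicit Types (Z b : comb) (p q : tpoly) (h : E -> R).

Definition lin_comb Z (s : S) : R := lin (f ^~ s) Z.

Lemma measurable_lin_fun Z : measurable_fun setT (lin_comb Z).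
Proof.
by apply: measurable_sum => c; apply: measurable_funM.
Qed.

Hypothesis iY : forall Z,
  mu.-integrable setT (EFin \o (fun s => `|lin_comb Z s| `^ alpha)).

(** A point $(s, x)$ stands for the jump $(e^x f_t(s))_t$ of the process, and
    [trig] evaluates a trigonometric polynomial there.  The Levy measure has the
    density [log_density] with respect to the product of $\mu$ and the Lebesgue
    measure, and [cos_weight] is this density times $1 - \cos Z$. *)
Definition trig p (z : E) : R := tev (fun t => expR z.2 * f t z.1) p.
Definition log_density (z : E) : R := kappa^-1 * expR (- (alpha * z.2)).
Definition cos_weight Z (z : E) : R := kappa^-1 * stable_kernel alpha (lin_comb Z z.1) z.2.
Definition psi Z : R := \int[mu]_s (`|lin_comb Z s| `^ alpha).

Lemma evE p z : trig p z = \sum_(c <- p) c.1 * cos (expR z.2 * lin_comb c.2 z.1).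
Proof. by apply: eq_bigr => c _; rewrite lin_scale. Qed.

Lemma weightE Z z : cos_weight Z z = trig (one_minus_cos Z) z * log_density z.
Proof.
rewrite /cos_weight /log_density /stable_kernel /trig tev_one_minus_cos lin_scale -/(lin_comb _ _).
by rewrite mulrCA.
Qed.

Lemma kappa_inv_gt0 : 0 < kappa^-1.
Proof. by rewrite invr_gt0 stable_const_gt0. Qed.

Lemma density_gt0 z : 0 < log_density z.
Proof. by rewrite mulr_gt0 ?expR_gt0// kappa_inv_gt0. Qed.

Lemma weight_ge0 Z z : 0 <= cos_weight Z z.
Proof. by rewrite mulr_ge0 ?stable_kernel_ge0// ltW// kappa_inv_gt0. Qed.

Let mfst : measurable_fun setT (fst : E -> S). Proof. exact: measurable_fst. Qed.
Let msnd : measurable_fun setT (snd : E -> R).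
Proof. exact: (@measurable_snd _ _ S (measurableTypeR R)). Qed.

Lemma measurable_scaled_lin Z :
  measurable_fun setT (fun z : E => expR z.2 * lin_comb Z z.1).
Proof.
apply: measurable_funM; first exact: (measurableT_comp (@measurable_expR R) msnd).
exact: (measurableT_comp (measurable_lin_fun Z) mfst).
Qed.

Lemma measurable_ev p : measurable_fun setT (trig p).
Proof.
rewrite (_ : trig p = fun z => \sum_(c <- p) c.1 * cos (expR z.2 * lin_comb c.2 z.1)).
  apply: measurable_sum => c; apply: measurable_funM => //.
  exact: measurable_cos_fun (measurable_scaled_lin _).
by apply/funext => z; rewrite evE.
Qed.

Lemma measurable_density : measurable_fun setT log_density.
Proof.
apply: measurable_funM => //; apply: (measurableT_comp (@measurable_expR R)).
apply: (measurableT_comp (@oppr_measurable R setT)).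
by apply: measurable_funM.
Qed.

Lemma measurable_weight Z : measurable_fun setT (cos_weight Z).
Proof.
rewrite (_ : cos_weight Z = fun z => trig (one_minus_cos Z) z * log_density z).
  by apply: measurable_funM; [exact: measurable_ev|exact: measurable_density].
by apply/funext => z; rewrite weightE.
Qed.

Lemma integral_weight (q : S -> R) Z : measurable_fun setT q ->
  (forall s, 0 <= q s) ->
  (\int[Pi]_z (q z.1 * cos_weight Z z)%:E =
   \int[mu]_s (q s * `|lin_comb Z s| `^ alpha)%:E)%E.
Proof.
move=> mq q0.
rewrite (@fubini_tonelli1 _ _ S (measurableTypeR R) R mu lebesgue_measure); last 2 first.
- apply/measurable_EFinP; apply: measurable_funM; last exact: measurable_weight.
  exact: (measurableT_comp mq mfst).
- by move=> z; rewrite lee_fin mulr_ge0// weight_ge0.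
apply: eq_integral => s _; rewrite /fubini_F /=.
under eq_integral => x _ do rewrite /cos_weight /= mulrA EFinM.
rewrite ge0_integralZl//; last 3 first.
- by apply/measurable_EFinP; exact: measurable_stable_kernel.
- by move=> x _; rewrite lee_fin stable_kernel_ge0.
- by rewrite lee_fin mulr_ge0// ltW// kappa_inv_gt0.
rewrite integral_stable_kernel// -EFinM; congr (_%:E).
by rewrite -mulrA mulKf// gt_eqF// stable_const_gt0.
Qed.

Lemma integrable_weight Z : Pi.-integrable setT (EFin \o cos_weight Z).
Proof.
apply/integrableP; split; first by apply/measurable_EFinP; exact: measurable_weight.
under eq_integral => z _ do rewrite /= ger0_norm ?weight_ge0// -[cos_weight _ _]mul1r.
rewrite (integral_weight (q := fun=> 1))//.
have /integrableP[_] := iY Z; apply: le_lt_trans; apply: ge0_le_integral => //.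
- apply/measurable_EFinP; apply: measurable_funM => //; apply/measurable_EFinP.
  exact: measurable_int (iY Z).
- by apply: measurableT_comp => //; exact: measurable_int (iY Z).
- by move=> s _; rewrite mul1r /= lee_fin ler_norm.
Qed.

Lemma Rintegral_weight (q : S -> R) Z : measurable_fun setT q ->
  (forall s, 0 <= q s) ->
  \int[Pi]_z (q z.1 * cos_weight Z z) = \int[mu]_s (q s * `|lin_comb Z s| `^ alpha).
Proof. by move=> mq q0; rewrite /Rintegral integral_weight. Qed.

Section bounded_multiplier.
Variables (h : E -> R) (M : R).
Hypothesis mh : measurable_fun setT h.
Hypothesis hM : forall z, `|h z| <= M.

Lemma integrable_mul_weight Z :
  Pi.-integrable setT (EFin \o (fun z => h z * cos_weight Z z)).
Proof. exact: integrable_mul_bounded mh hM (integrable_weight Z). Qed.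

(** Summing $1 - \cos$ instead of $\cos$ changes nothing for a polynomial
    vanishing at $0$, and makes each term integrable for the infinite Levy
    measure. *)
Lemma levy_functional_integral p : tev (fun=> 0) p = 0 ->
  Pi.-integrable setT (EFin \o (fun z => trig p z * (h z * log_density z))) /\
  \int[Pi]_z (trig p z * (h z * log_density z)) =
  levy_functional (fun Z => \int[Pi]_z (h z * cos_weight Z z)) p.
Proof.
move=> p0; have cE z :
    trig p z * (h z * log_density z) = -1 * (\sum_(c <- p) c.1 * (h z * cos_weight c.2 z)).
  have -> : trig p z = - (\sum_(c <- p) c.1 * (1 - cos (expR z.2 * lin_comb c.2 z.1))).
    rewrite evE; under [in RHS]eq_bigr do rewrite mulrBr mulr1.
    rewrite sumrB opprB; move: p0; rewrite /tev.
    under eq_bigr do rewrite lin0 cos0 mulr1.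
    by move=> ->; rewrite subr0.
  rewrite mulN1r mulNr; congr (- _); rewrite mulr_suml; apply: eq_bigr => c _.
  rewrite weightE /trig tev_one_minus_cos lin_scale -/(lin_comb _ _).
  by ring.
have [i1 e1] : Pi.-integrable setT
    (EFin \o (fun z => \sum_(c <- p) c.1 * (h z * cos_weight c.2 z))) /\
    \int[Pi]_z (\sum_(c <- p) c.1 * (h z * cos_weight c.2 z)) =
    \sum_(c <- p) c.1 * \int[Pi]_z (h z * cos_weight c.2 z).
  elim: p {p0 cE} => [|c p [IH1 IH2]].
    rewrite big_nil; split.
      have := integrable0 Pi setT; congr (_.-integrable _ _).
      by apply/funext => z /=; rewrite big_nil.
    by under eq_Rintegral do rewrite big_nil; rewrite Rintegral_cst// mul0r.
  have ic := integrable_scale c.1 (integrable_mul_weight c.2).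
  split.
    have := integrable_add ic IH1; congr (_.-integrable _ _).
    by apply/funext => z /=; rewrite big_cons.
  rewrite big_cons -IH2 -RintegralZl ?integrable_mul_weight//.
  rewrite -RintegralD//; apply: eq_Rintegral => z _.
  by rewrite big_cons.
split.
  have := integrable_scale (-1) i1; congr (_.-integrable _ _).
  by apply/funext => z /=; rewrite cE.
under eq_Rintegral do rewrite cE.
by rewrite RintegralZl// e1 mulN1r.
Qed.

End bounded_multiplier.

Lemma psi_weight Z : psi Z = \int[Pi]_z cos_weight Z z.
Proof.
transitivity (\int[mu]_s (1 * `|lin_comb Z s| `^ alpha)).
  by apply: eq_Rintegral => s _; rewrite mul1r.
rewrite -(Rintegral_weight (q := fun=> 1))//.
by apply: eq_Rintegral => z _; rewrite mul1r.
Qed.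

Lemma levy_functional_psi p : tev (fun=> 0) p = 0 ->
  levy_functional psi p = \int[Pi]_z (trig p z * log_density z).
Proof.
move=> p0.
have n1 (z : E) : `|1 : R| <= 1 by rewrite normr1.
have m1 : measurable_fun setT (fun _ : E => 1 : R) by exact: measurable_cst.
have [_] := levy_functional_integral m1 n1 p0.
under eq_Rintegral do rewrite mul1r.
move=> ->; rewrite /levy_functional; congr (- _); apply: eq_bigr => c _.
by rewrite psi_weight; congr (_ * _); apply: eq_Rintegral => z _; rewrite mul1r.
Qed.

Lemma ev_bounded_algebra : bounded_algebra (range trig).
Proof.
split.
- exists [:: (1, [::])] => //; apply/funext => z.
  by rewrite /trig tev_one.
- move=> c _ [p _ <-]; exists (tscale c p) => //; apply/funext => z.
  by rewrite /trig tev_scale.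
- move=> _ _ [p _ <-] [q _ <-]; exists (p ++ q) => //; apply/funext => z.
  by rewrite /trig tev_cat.
- move=> _ _ [p _ <-] [q _ <-]; exists (tmul p q) => //; apply/funext => z.
  by rewrite /trig tev_mul.
- by move=> _ [p _ <-]; have [M pM] := tev_bounded p; exists M => z; exact: pM.
Qed.

Local Notation G := (sigma_of trig).

Lemma G_measurable h : measurable_wrt G h -> measurable_fun setT h.
Proof. by move=> mh; exact: (measurable_wrt_measurable measurable_ev mh). Qed.

Lemma weighted_unique h h' (w : E -> R) :
  measurable_wrt G h -> measurable_wrt G h' -> (forall z, 0 <= w z) ->
  Pi.-integrable setT (EFin \o (fun z => h z * w z)) ->
  Pi.-integrable setT (EFin \o (fun z => h' z * w z)) ->
  (forall p, \int[Pi]_z (trig p z * (h z * w z)) = \int[Pi]_z (trig p z * (h' z * w z))) ->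
  {ae Pi, forall z, w z != 0 -> h z = h' z}.
Proof.
move=> mh mh' w0 ih ih' eqp.
have mB : measurable_wrt G (fun z => h z - h' z).
  move/measurable_wrtP : mh => mh; move/measurable_wrtP : mh' => mh'.
  by apply/measurable_wrtP; exact: measurable_funB.
have : {ae Pi, forall z, (h z - h' z) * w z = 0}.
  apply: (annihilator_ae0 measurable_ev ev_bounded_algebra mB w0).
    have := integrable_add ih (integrable_scale (-1) ih').
    by congr (_.-integrable _ _); apply/funext => z /=; rewrite mulN1r mulrBl.
  move=> p; have [M pM] := tev_bounded p.
  have ip h1 : Pi.-integrable setT (EFin \o (fun z => h1 z * w z)) ->
      Pi.-integrable setT (EFin \o (fun z => trig p z * (h1 z * w z))).
    by move=> i1; apply: (integrable_mul_bounded (measurable_ev p) _ i1) => z; exact: pM.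
  have := eqp p; move=> /eqP; rewrite -subr_eq0 -RintegralB ?ip// => /eqP <-.
  by apply: eq_Rintegral => z _; rewrite -mulrBr -mulrBl.
apply: filterS => z /eqP; rewrite mulf_eq0 subr_eq0 => /orP[/eqP//|/eqP -> /eqP//].
Qed.

(** Two densities with the same exponents agree: by the product formula
    $p (1 - \cos b)$ is a trigonometric polynomial vanishing at $0$, so its
    integral is a combination of exponents. *)
Lemma levy_density_unique h h' M b :
  measurable_wrt G h -> measurable_wrt G h' ->
  (forall z, `|h z| <= M) -> (forall z, `|h' z| <= M) ->
  (forall Z, \int[Pi]_z (h z * cos_weight Z z) = \int[Pi]_z (h' z * cos_weight Z z)) ->
  {ae Pi, forall z, cos_weight b z != 0 -> h z = h' z}.
Proof.
move=> mh mh' hM hM' hw; have := G_measurable mh => mh1.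
have := G_measurable mh' => mh1'.
apply: weighted_unique => //; first exact: weight_ge0.
- exact: integrable_mul_weight mh1 hM b.
- exact: integrable_mul_weight mh1' hM' b.
move=> p; pose q := tmul p (one_minus_cos b).
have q0 : tev (fun=> 0) q = 0.
  by rewrite tev_mul tev_one_minus_cos lin0 cos0 subrr mulr0.
have [_ e1] := levy_functional_integral mh1 hM q0.
have [_ e2] := levy_functional_integral mh1' hM' q0.
have qE h1 z : trig q z * (h1 z * log_density z) = trig p z * (h1 z * cos_weight b z).
  by rewrite weightE /trig tev_mul; ring.
under eq_Rintegral do rewrite -qE; under [in RHS]eq_Rintegral do rewrite -qE.
rewrite e1 e2 /levy_functional; congr (- _); apply: eq_bigr => c _.
by rewrite hw.
Qed.

End levy_space.

(** * Densities of the exponents dominated by the spectral exponent *)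

Section density_of_negative_type.
Context {R : realType} (alpha : R) (T : Type).
Context {dS : measure_display} {S : measurableType dS}.
Variable mu : {sigma_finite_measure set S -> \bar R}.
Variable f : T -> S -> R.
Hypothesis alpha02 : 0 < alpha < 2.
Hypothesis mf : forall t, measurable_fun setT (f t).

Local Notation E := (S * measurableTypeR R)%type.
Local Notation Pi := (mu \x @lebesgue_measure R)%E.
Local Notation comb := (seq (R * T)).
Local Notation tpoly := (seq (R * seq (R * T))).
Local Notation lin_fun := (lin_comb f).
Local Notation ev := (trig f).
Local Notation density := (log_density (S := S) alpha).
Local Notation weight := (cos_weight alpha f).
Local Notation psi := (psi alpha mu f).
Local Notation G := (sigma_of ev).
Implicit Types (Z b : comb) (p q : tpoly) (h : E -> R).

Hypothesis iY : forall Z,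
  mu.-integrable setT (EFin \o (fun s => `|lin_fun Z s| `^ alpha)).

Let mev := measurable_ev mf.
Let mwt := measurable_weight alpha mf.
Let wt0 := @weight_ge0 R alpha T dS S f alpha02.
Let iwt := @integrable_weight R alpha T dS S mu f alpha02 mf iY.

Variable phi : comb -> R.
Hypothesis nphi : negative_type phi.
Hypothesis npsiphi : negative_type (fun Z => psi Z - phi Z).
Hypothesis phi0 : phi [::] = 0.

Let levy_functionalB p : levy_functional (fun Z => psi Z - phi Z) p =
  levy_functional psi p - levy_functional phi p.
Proof.
rewrite /levy_functional opprK addrC -opprB; congr (- _); rewrite -sumrB.
by apply: eq_bigr => c _; rewrite mulrBr.
Qed.

(** The functional of $\varphi$ localised by the weight $1 - \cos b$; unlike
    the functional itself it is defined on all trigonometric polynomials. *)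
Let L b p := levy_functional phi (tmul p (one_minus_cos b)).

Let vanish p b : tev (fun=> 0) (tmul p (one_minus_cos b)) = 0.
Proof. by rewrite tev_mul tev_one_minus_cos lin0 cos0 subrr mulr0. Qed.

Let L_ext b p q : (forall g, tev g p = tev g q) -> L b p = L b q.
Proof.
move=> pq; apply: negative_type_ext => // g; first by rewrite !tev_mul pq.
Qed.

Let L_add b p q : L b (p ++ q) = L b p + L b q.
Proof.
rewrite /L -levy_functional_cat; apply: negative_type_ext => // g.
by rewrite tev_cat !tev_mul tev_cat mulrDl.
Qed.

Let L_scale b c p : L b (tscale c p) = c * L b p.
Proof.
rewrite /L -levy_functional_scale; apply: negative_type_ext => // g.
by rewrite tev_scale !tev_mul tev_scale mulrA.
Qed.

Let L_one b : L b [:: (1, [::])] = phi b.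
Proof.
rewrite -(levy_functional_one_minus_cos b phi0) /L; apply: negative_type_ext => // g.
by rewrite tev_mul tev_one mul1r.
Qed.

Let L_square_ge0 b p : 0 <= L b (tmul p p).
Proof.
apply: nphi => // g; rewrite !tev_mul mulr_ge0//.
  by rewrite -expr2 sqr_ge0.
by rewrite tev_one_minus_cos one_minus_cos_ge0.
Qed.

(** The only place where the negative type of $\psi - \varphi$ enters; it gives
    both the continuity of $L_b$ in $L^2$ and the bound $h \le 1$. *)
Let L_square_le b p : L b (tmul p p) <= \int[Pi]_z (ev p z * ev p z * weight b z).
Proof.
rewrite -subr_ge0.
have -> : \int[Pi]_z (ev p z * ev p z * weight b z) =
    levy_functional psi (tmul (tmul p p) (one_minus_cos b)).
  rewrite (levy_functional_psi alpha02 mf iY)//; apply: eq_Rintegral => z _.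
  by rewrite weightE /ev !tev_mul mulrA.
rewrite -levy_functionalB; apply: npsiphi => // g; rewrite !tev_mul mulr_ge0//.
  by rewrite -expr2 sqr_ge0.
by rewrite tev_one_minus_cos one_minus_cos_ge0.
Qed.

Let phi_ge0 b : 0 <= phi b.
Proof.
rewrite -L_one (@L_ext b _ (tmul [:: (1, [::])] [:: (1, [::])]))// => g.
by rewrite tev_mul tev_one mulr1.
Qed.

(** The Cauchy-Schwarz inequality for the nonnegative form
    $(p, q) \mapsto L_b(p q)$, taken at $q = 1$. *)
Let L_bounded b p :
  L b p ^+ 2 <= phi b * \int[Pi]_z (ev p z * ev p z * weight b z).
Proof.
apply: (@le_trans _ _ (L b (tmul p p) * phi b)); last first.
  by rewrite mulrC ler_wpM2l.
apply: quadratic_ge0_discr => // t.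
have := L_square_ge0 b (p ++ tscale t [:: (1, [::])]).
rewrite (@L_ext b _ (tmul p p ++ (tscale (2 * t) p ++ tscale (t ^+ 2) [:: (1, [::])]))).
  by rewrite !L_add !L_scale L_one addrA.
move=> g; rewrite tev_mul [in RHS]tev_cat [in RHS]tev_mul !tev_cat !tev_scale.
by rewrite !tev_one; ring.
Qed.

Let is_local_density b h := [/\ measurable_wrt G h, forall z, 0 <= h z <= 1 &
  forall p, L b p = \int[Pi]_z (ev p z * (h z * weight b z))].

(** Riesz gives $h$; testing it on squares gives $0 \le h \le 1$ where the weight
    is positive, and truncation does the rest. *)
Let local_density b : exists h : E -> R, is_local_density b h.
Proof.
have evb p : exists M, forall z, `|ev p z| <= M.
  by have [M pM] := tev_bounded p; exists M => z; exact: pM.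
have evD p q z : ev (p ++ q) z = ev p z + ev q z by rewrite /ev tev_cat.
have evZ c p z : ev (tscale c p) z = c * ev p z by rewrite /ev tev_scale.
have [h [mh ih hL]] := riesz_density [::] mev evb evD evZ (L_add b)
  (L_scale b) (wt0 b) (iwt b) (phi_ge0 b) (L_bounded b).
have hge0 : {ae Pi, forall z, 0 <= h z * weight b z}.
  apply: (square_positive_ae mev (ev_bounded_algebra f) mh) => //.
  move=> p; have := L_square_ge0 b p; rewrite hL; congr (0 <= _).
  by apply: eq_Rintegral => z _; rewrite /ev tev_mul expr2.
have mhw1 : measurable_wrt G (fun z => 1 - h z).
  by move/measurable_wrtP : mh => mh; apply/measurable_wrtP; exact: measurable_funB.
have hle1 : {ae Pi, forall z, 0 <= (1 - h z) * weight b z}.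
  apply: (square_positive_ae mev (ev_bounded_algebra f) mhw1) => //.
  - have := integrable_add (iwt b) (integrable_scale (-1) ih).
    by congr (_.-integrable _ _); apply/funext => z /=; rewrite mulN1r mulrBl mul1r.
  move=> p; have [M pM] := evb p.
  have mp2 : measurable_fun setT (fun z => ev p z * ev p z).
    by apply: measurable_funM; exact: mev.
  have pM2 z : `|ev p z * ev p z| <= M * M by rewrite normrM ler_pM.
  have -> : \int[Pi]_z (ev p z ^+ 2 * ((1 - h z) * weight b z)) =
      \int[Pi]_z (ev p z * ev p z * weight b z) -
      \int[Pi]_z (ev p z * ev p z * (h z * weight b z)).
    rewrite -RintegralB//.
    - by apply: eq_Rintegral => z _; rewrite expr2; ring.
    - exact: integrable_mul_bounded mp2 pM2 (iwt b).
    - exact: integrable_mul_bounded mp2 pM2 ih.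
  rewrite subr_ge0; apply: le_trans (L_square_le b p); rewrite hL.
  rewrite le_eqVlt; apply/orP; left; apply/eqP.
  by apply: eq_Rintegral => z _; rewrite /ev tev_mul.
pose k z := Num.max 0 (Num.min 1 (h z)).
have mk : measurable_wrt G k.
  move/measurable_wrtP : mh => mh; apply/measurable_wrtP.
  by apply: measurable_maxr => //; exact: measurable_minr.
have kw : {ae Pi, forall z, k z * weight b z = h z * weight b z}.
  apply: filterS2 hge0 hle1 => z.
  have := wt0 b z; rewrite le_eqVlt => /predU1P[<-|w0]; first by rewrite !mulr0.
  rewrite !pmulr_lge0// subr_ge0 => h0 h1; congr (_ * _); rewrite /k.
  by rewrite min_r// max_r.
exists k; split=> //.
  by move=> z; rewrite /k le_max lexx/= ge_max ler01 ge_min lexx.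
move=> p; rewrite hL; rewrite /Rintegral; congr fine.
have mhw : measurable_fun setT (fun z => h z * weight b z).
  by apply: measurable_funM; [exact: (G_measurable mf)|exact: mwt].
have mkw : measurable_fun setT (fun z => k z * weight b z).
  by apply: measurable_funM; [exact: (G_measurable mf)|exact: mwt].
apply: ae_eq_integral => //.
- by apply/measurable_EFinP; apply: measurable_funM => //; exact: mev.
- by apply/measurable_EFinP; apply: measurable_funM => //; exact: mev.
- by apply: filterS kw => z kwz _; rewrite kwz.
Qed.

(** Both densities represent the functional localised by the product of the two
    weights. *)
Let local_density_consistent b c hb hc :
  is_local_density b hb -> is_local_density c hc ->
  {ae Pi, forall z, weight b z != 0 -> weight c z != 0 -> hb z = hc z}.
Proof.
move=> [mb hb01 Lb] [mc hc01 Lc].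
pose w z := ev (one_minus_cos c) z * weight b z.
have wC z : w z = ev (one_minus_cos b) z * weight c z.
  by rewrite /w !weightE; ring.
have ec0 a z : 0 <= ev (one_minus_cos a) z.
  by rewrite /ev tev_one_minus_cos one_minus_cos_ge0.
have [M cM] := tev_bounded (one_minus_cos c).
have iw : Pi.-integrable setT (EFin \o w).
  apply: (integrable_mul_bounded (mev _) _ (iwt b)) => z.
  exact: cM.
have n1 a z : 0 <= a z <= 1 -> `|a z| <= 1 by move=> /andP[a0 a1]; rewrite ger0_norm.
have : {ae Pi, forall z, w z != 0 -> hb z = hc z}.
  apply: (weighted_unique mf mb mc).
  - by move=> z; rewrite mulr_ge0// wt0.
  - by apply: integrable_mul_bounded iw => [|z]; [exact: (G_measurable mf)|exact: n1].
  - by apply: integrable_mul_bounded iw => [|z]; [exact: (G_measurable mf)|exact: n1].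
  move=> p.
  have -> : \int[Pi]_z (ev p z * (hb z * w z)) = L b (tmul p (one_minus_cos c)).
    rewrite Lb; apply: eq_Rintegral => z _; rewrite /w /ev tev_mul; ring.
  have -> : \int[Pi]_z (ev p z * (hc z * w z)) = L c (tmul p (one_minus_cos b)).
    rewrite Lc; apply: eq_Rintegral => z _; rewrite wC /ev tev_mul; ring.
  rewrite /L; apply: negative_type_ext => // g; rewrite !tev_mul; ring.
apply: filterS => z wz bz cz; apply: wz; rewrite mulf_neq0//.
by move: cz; rewrite weightE mulf_eq0 negb_or => /andP[].
Qed.

Variable b_ : nat -> comb.
Hypothesis b_cover : {ae Pi, forall z, exists n, weight (b_ n) z != 0}.

(** The local densities agree where two weights are positive, so they glue along
    a countable family of weights with no common zero. *)
Lemma levy_density_exists : exists h : E -> R,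
  [/\ measurable_wrt G h, forall z, 0 <= h z <= 1 &
      forall Z, phi Z = \int[Pi]_z (h z * weight Z z)].
Proof.
have [hloc hlocP] := choice local_density.
pose h := first_value (fun n z => weight (b_ n) z != 0) (fun n => hloc (b_ n)).
have hE z n : weight (b_ n) z != 0 -> exists2 k,
    weight (b_ k) z != 0 & h z = hloc (b_ k) z.
  move=> wn; have [k [wk _ hk]] := first_valueP (P := fun n z => weight (b_ n) z != 0)
    (fun n => hloc (b_ n)) wn.
  by exists k.
have h01 z : 0 <= h z <= 1.
  have [[n wn]|/forallNP wz] := pselect (exists n, weight (b_ n) z != 0).
    by have [k _ ->] := hE z n wn; have [_ + _] := hlocP (b_ k); exact.
  by rewrite /h first_value_none ?lexx ?ler01// => n; apply/negP/wz.
pose GE := g_sigma_algebraType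
  (\bigcup_(i : tpoly) preimage_set_system setT (ev i) measurable).
have mevG p : measurable_fun [set: GE] (ev p : GE -> R).
  apply/measurable_wrtP; exact: (@measurable_wrt_generator _ _ _ ev p).
have mh : measurable_wrt G h.
  apply/measurable_wrtP; apply: measurable_first_value => n; last first.
    by apply/measurable_wrtP; have [] := hlocP (b_ n).
  rewrite (_ : (fun _ => _) = \1_(ev (one_minus_cos (b_ n)) @^-1` (~` [set 0]))).
    apply/measurable_indicP; rewrite -[X in measurable X]setTI; apply: mevG => //.
    exact: measurableC.
  apply/funext => z.
  rewrite indicE weightE mulf_eq0 (gt_eqF (density_gt0 alpha02 z)) orbF.
  congr (_ %:R); congr nat_of_bool; apply/idP/idP; rewrite inE /= => /eqP//.
exists h; split=> // Z; have [mZ hZ LZ] := hlocP Z.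
rewrite -(L_one Z) LZ /Rintegral; congr fine.
have hae : {ae Pi, forall z, weight Z z != 0 -> hloc Z z = h z}.
  have : {ae Pi, forall z, forall n,
      weight Z z != 0 -> weight (b_ n) z != 0 -> hloc Z z = hloc (b_ n) z}.
    by apply: ae_foralln => n; exact: local_density_consistent (hlocP _) (hlocP _).
  move=> cons; apply: filterS2 b_cover cons => z [n wn] cons wZ.
  by have [k wk ->] := hE z n wn; exact: cons.
apply: ae_eq_integral => //.
- apply/measurable_EFinP; apply: measurable_funM; first exact: mev.
  by apply: measurable_funM; [exact: (G_measurable mf)|exact: mwt].
- apply/measurable_EFinP.
  by apply: measurable_funM; [exact: (G_measurable mf)|exact: mwt].
- apply: filterS hae => z hz _; congr (_%:E).
  rewrite /trig tev_one !mul1r.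
  by have [->|/hz ->//] := eqVneq (weight Z z) 0; rewrite !mulr0.
Qed.

End density_of_negative_type.

(** * Exhaustion by countable subfamilies, limits of trigonometric functions *)

Section exhaustion.
Context {R : realType} {d : measure_display} {S : measurableType d}.
Variable mu : {sigma_finite_measure set S -> \bar R}.
Context {I : Type} (B : I -> set S).
Hypothesis mB : forall i, measurable (B i).

Let Bo (o : option I) : set S := if o is Some i then B i else set0.
Let U (s : nat -> option I) := \bigcup_n Bo (s n).

Let mU s : measurable (U s).
Proof. by apply: bigcupT_measurable => n; rewrite /Bo; case: (s n). Qed.

(** Maximising the measure of countable unions, inside sets of finite measure,
    yields an essential union of an uncountable family. *)
Lemma countable_exhaustion : exists s : nat -> option I,
  forall i, mu (B i `\` \bigcup_n (if s n is Some j then B j else set0)) = 0%E.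
Proof.
have [F FT Ffin] := sigma_finiteT mu.
have mF n : measurable (F n) := (Ffin n).1.
pose v n s := fine (mu (F n `&` U s)).
have vfin n s : mu (F n `&` U s) \is a fin_num.
  rewrite ge0_fin_numE//; apply: le_lt_trans (Ffin n).2.
  by apply: le_measure; rewrite ?inE//; exact: measurableI.
have vsup n : has_sup (range (v n)).
  split; first by exists (v n (fun=> None)); exists (fun=> None).
  exists (fine (mu (F n))) => _ [s _ <-]; apply: fine_le => //.
    by rewrite ge0_fin_numE//; exact: (Ffin n).2.
  by apply: le_measure; rewrite ?inE//; exact: measurableI.
have [s0 s0P] : {s0 : nat * nat -> nat -> option I & forall p : nat * nat,
    sup (range (v p.1)) - p.2.+1%:R^-1 < v p.1 (s0 p)}.
  suff h (p : nat * nat) : exists s, sup (range (v p.1)) - p.2.+1%:R^-1 < v p.1 s.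
    exact: choice h.
  have e0 : (0 : R) < p.2.+1%:R^-1 by rewrite invr_gt0.
  by have [_ [s _ <-] sP] := sup_adherent e0 (vsup p.1); exists s.
pose s k := if @unpickle (nat * nat * nat)%type k is Some q then s0 q.1 q.2 else None.
have s0s p : U (s0 p) `<=` U s.
  move=> x [l _ xl]; exists (pickle (p, l)) => //.
  by rewrite /s pickleK.
have vs n : sup (range (v n)) <= v n s.
  apply/ler_addgt0Pr => e e0; have [j] := ltr_add_invr e0.
  rewrite add0r => je; rewrite -lerBlDr.
  apply: (le_trans (lerB (lexx _) (ltW je))).
  apply: (le_trans (ltW (s0P (n, j)))); apply: fine_le => //.
  by apply: le_measure; rewrite ?inE//; [exact: measurableI|exact: measurableI|exact: setIS].
exists s => i; rewrite -[X in _ `\` X]/(U s).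
have null n : mu (F n `&` (B i `\` U s)) = 0%E.
  pose s' k := if k is k'.+1 then s k' else Some i.
  have s'E : U s' = U s `|` B i.
    apply/seteqP; split=> [x [[|k] _ xk]|x [[k _ xk]|xi]].
    - by right.
    - by left; exists k.
    - by exists k.+1.
    - by exists 0%N.
  have mD : measurable (F n `&` (B i `\` U s)).
    by apply: measurableI => //; exact: measurableD.
  have split' : mu (F n `&` U s') = (mu (F n `&` U s) + mu (F n `&` (B i `\` U s)))%E.
    rewrite -measureU//; last 2 first.
    - exact: measurableI.
    - by apply/seteqP; split=> // x [[_ Ux] [_ [_ nUx]]]; exact: nUx.
    rewrite -setIUr s'E; congr (mu (_ `&` _)).
    apply/seteqP; split=> x.
      by case=> [Ux|Bx]; [left|have [|] := pselect (U s x); [left|right]].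
    by case=> [|[]]; [left|right].
  have : v n s' <= v n s by apply: le_trans (vs n); apply: sup_upper_bound => //; exists s'.
  rewrite /v -lee_fin !fineK// split' -[leRHS]adde0 leeD2lE//.
  by move=> h; apply/eqP; rewrite eq_le h measure_ge0.
have mD n : measurable (F n `&` (B i `\` U s)).
  by apply: measurableI => //; exact: measurableD.
have BE : \bigcup_n (F n `&` (B i `\` U s)) = B i `\` U s.
  apply/seteqP; split=> [x [n _ []]//|x Bx].
  have [n _ Fnx] : (\bigcup_n F n) x by rewrite -FT.
  by exists n.
have negl : mu.-negligible (\bigcup_n (F n `&` (B i `\` U s))).
  by apply: negligible_bigcup => n; apply/negligibleP; [exact: mD|exact: null].
rewrite BE in negl; apply/negligibleP => //; exact: measurableD.
Qed.

End exhaustion.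

Section real_function_limits.
Context {R : realType}.
Implicit Types y : R.

(** Countably many dyadic multiples of a nonzero combination thus give weights
    without common zero. *)
Lemma cos_dyadic_neq1 y : y != 0 -> exists j, cos (2^-1 ^+ j * y) != 1.
Proof.
move=> y0; have ny : 0 < `|y| by rewrite normr_gt0.
have [j jP] : exists j, 2^-1 ^+ j * `|y| < 1.
  have c0 : (2^-1 ^+ j * `|y|) @[j --> \oo] --> (0 : R).
    rewrite -[X in _ --> X](mul0r `|y|); apply: cvgMl.
    by apply: cvg_expr; rewrite ger0_norm//; lra.
  have [N _ NP] := cvgr_lt (0 : R) c0 _ (@ltr01 R).
  by exists N; apply: NP => /=.
exists j; have -> : cos (2^-1 ^+ j * y) = cos (2^-1 ^+ j * `|y|).
  by case: (ger0P y) => // _; rewrite mulrN cosN.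
have p0 : 0 < 2^-1 ^+ j * `|y| by rewrite mulr_gt0// exprn_gt0.
have : cos (2^-1 ^+ j * `|y|) < cos 0.
  by have p1 := pihalf_ge1 R; rewrite ltr_cos ?in_itv//=; apply/andP; split; lra.
by rewrite cos0 => /lt_eqF ->.
Qed.

(** Recovers a coordinate from trigonometric functions of its multiples. *)
Lemma cvg_sin_div y : n.+1%:R * sin (n.+1%:R^-1 * y) @[n --> \oo] --> y.
Proof.
have [c cP] : {c : nat -> R & forall n, `|c n| <= n.+1%:R^-1 * `|y| /\
    sin (n.+1%:R^-1 * y) = cos (c n) * (n.+1%:R^-1 * y)}.
  suff h (n : nat) : exists c, `|c| <= n.+1%:R^-1 * `|y| /\
      sin (n.+1%:R^-1 * y) = cos c * (n.+1%:R^-1 * y) by exact: choice h.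
  have [c c1 c2] := sin_mean_value (n.+1%:R^-1 * y); exists c; split=> //.
  by rewrite (le_trans c1)// normrM ger0_norm.
have c0 : c n @[n --> \oo] --> (0 : R).
  apply/norm_cvg0P.
  apply: (@squeeze_cvgr _ _ _ _ (fun=> 0) (fun n => n.+1%:R^-1 * `|y|)).
  - by apply: nearW => n; rewrite normr_ge0/=; have [] := cP n.
  - exact: cvg_cst.
  - rewrite -[X in _ --> X](mul0r `|y|); apply: cvgMl; exact: cvg_harmonic.
have cc : cos (c n) @[n --> \oo] --> (1 : R).
  rewrite -[X in _ --> X]cos0; apply: continuous_cvg => //; exact: continuous_cos.
have -> : (fun n => n.+1%:R * sin (n.+1%:R^-1 * y)) = (fun n => cos (c n) * y).
  apply/funext => n; have [_ ->] := cP n; field.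
  by apply/lt0r_neq0; have := ler0n R n; lra.
by rewrite -[X in _ --> X]mul1r; exact: cvgMl.
Qed.

Lemma cvg_one_minus_cos y :
  2 * (n.+1%:R ^+ 2 * (1 - cos (n.+1%:R^-1 * y))) @[n --> \oo] --> y ^+ 2.
Proof.
have -> : (fun n => 2 * (n.+1%:R ^+ 2 * (1 - cos (n.+1%:R^-1 * y)))) =
    (fun n => 4 * ((n.+1%:R * sin (n.+1%:R^-1 * (y / 2))) *
                   (n.+1%:R * sin (n.+1%:R^-1 * (y / 2))))).
  apply/funext => n.
  have -> : n.+1%:R^-1 * y = (n.+1%:R^-1 * (y / 2)) *+ 2.
    by rewrite mulr2n -mulrDr -splitr.
  by rewrite cos_mulr2n cos2sin2 !mulr2n; ring.
have -> : y ^+ 2 = 4 * (y / 2 * (y / 2)) by field.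
by apply: cvgMr; apply: cvgM; exact: cvg_sin_div.
Qed.

Lemma measurable_invr : measurable_fun setT (fun x : R => x^-1).
Proof.
rewrite (_ : (fun _ => _) = fun x : R => x * (x ^+ 2) `^ (-1)).
  apply: measurable_funM => //; apply: (measurableT_comp (measurable_powR (-1))).
  exact: measurable_funX.
apply/funext => x; rewrite powR_inv1 ?sqr_ge0//.
have [->|x0] := eqVneq x 0; first by rewrite invr0 mul0r.
by field.
Qed.

End real_function_limits.

(** * From the Levy measure to the sigma-algebra of ratios *)

Section ratio_densities.
Context {R : realType} (alpha : R) (T : Type).
Context {dS : measure_display} {S : measurableType dS}.
Variable mu : {sigma_finite_measure set S -> \bar R}.
Variable f : T -> S -> R.
Hypothesis alpha02 : 0 < alpha < 2.
Hypothesis mf : forall t, measurable_fun setT (f t).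

Local Notation E := (S * measurableTypeR R)%type.
Local Notation leb := (@lebesgue_measure R).
Local Notation Pi := (mu \x leb)%E.
Local Notation comb := (seq (R * T)).
Local Notation tpoly := (seq (R * seq (R * T))).
Local Notation lin_fun := (lin_comb f).
Local Notation ev := (trig f).
Local Notation weight := (cos_weight alpha f).
Local Notation psi := (psi alpha mu f).
Local Notation G := (sigma_of ev).
Implicit Types (Z b : comb) (p q : tpoly) (h : E -> R).

Hypothesis iY : forall Z,
  mu.-integrable setT (EFin \o (fun s => `|lin_fun Z s| `^ alpha)).

Variable sel : nat -> option T.
Let fsel n s := if sel n is Some t then f t s else 0.
Hypothesis sel_cover : {ae mu, forall s, exists n, fsel n s != 0}.

(** The multiples $2^{-j} f_t$ of the selected functions, enumerated along
    pairs $(n, j)$. *)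
Let b_ k : comb :=
  if @unpickle (nat * nat)%type k is Some nj then
    lscale (2^-1 ^+ nj.2) (if sel nj.1 is Some t then [:: (1, t)] else [::])
  else [::].

Lemma ae_fst (P : S -> Prop) : {ae mu, forall s, P s} -> {ae Pi, forall z, P z.1}.
Proof.
case=> N [mN N0 sub]; exists (N `*` setT); split.
- exact: measurableX.
- transitivity (mu N * leb setT)%E; first exact: product_measure1E.
  by rewrite [mu N]N0 mul0e.
- by move=> z /= nP; split=> //; exact: sub.
Qed.

(** The fibres of $N \times R$ have positive length. *)
Lemma ae_fst_inv (N : set S) : measurable N ->
  {ae Pi, forall z, ~ N z.1} -> {ae mu, forall s, ~ N s}.
Proof.
move=> mN [N' [mN' N'0 sub]]; exists N; split=> //; last first.
  by move=> s /= /contrapT.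
have l1 : leb `[0%R, 1%R]%classic = 1%E.
  by rewrite lebesgue_measure_itv/= lte_fin ltr01 -EFinB subr0.
have PN : Pi (N `*` `[0%R, 1%R]%classic) = mu N.
  transitivity (mu N * leb `[0%R, 1%R]%classic)%E; first exact: product_measure1E.
  by rewrite l1 mule1.
have : (mu N <= Pi N')%E.
  rewrite -PN; apply: le_measure; rewrite ?inE//; first exact: measurableX.
  by move=> z [Nz _]; apply: sub => /=; exact.
by rewrite [Pi N']N'0 => h; apply/eqP; rewrite eq_le h measure_ge0.
Qed.

Let b_cover : {ae Pi, forall z, exists k, weight (b_ k) z != 0}.
Proof.
apply: filterS (ae_fst sel_cover) => z [n fn].
have y0 : expR z.2 * fsel n z.1 != 0 by rewrite mulf_neq0// gt_eqF// expR_gt0.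
have [j cj] := cos_dyadic_neq1 y0; exists (pickle (n, j)).
rewrite /b_ pickleK /= weightE; apply: mulf_neq0; last first.
  by rewrite gt_eqF// density_gt0.
rewrite /trig tev_one_minus_cos lin_lscale lin_scale subr_eq0 eq_sym.
rewrite (_ : lin _ _ = fsel n z.1)//.
rewrite /fsel; case: (sel n) => [t|]; last exact: lin_nil.
by rewrite /lin big_seq1 mul1r.
Qed.

Lemma levy_density_unique_ae h h' M :
  measurable_wrt G h -> measurable_wrt G h' ->
  (forall z, `|h z| <= M) -> (forall z, `|h' z| <= M) ->
  (forall Z, \int[Pi]_z (h z * weight Z z) = \int[Pi]_z (h' z * weight Z z)) ->
  {ae Pi, forall z, h z = h' z}.
Proof.
move=> mh mh' hM hM' hw.
have : {ae Pi, forall z, forall k, weight (b_ k) z != 0 -> h z = h' z}.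
  apply: ae_foralln => k.
  exact: (levy_density_unique alpha02 mf iY (b_ k) mh mh' hM hM' hw).
by move=> cons; apply: filterS2 b_cover cons => z [k wk] /(_ k wk).
Qed.

Let Pi_sigma_finite : @sigma_finite _ E R setT Pi.
Proof.
have [F FT Ffin] := sigma_finiteT mu.
have [H HT Hfin] := sigma_finiteT leb.
exists (fun k => if @unpickle (nat * nat)%type k is Some nm
                 then F nm.1 `*` H nm.2 else set0).
  apply/esym/seteqP; split=> // -[s x] _.
  have [n _ Fs] : (\bigcup_n F n) s by rewrite -FT.
  have [m _ Hx] : (\bigcup_n H n) x by rewrite -HT.
  by exists (pickle (n, m)) => //; rewrite pickleK.
move=> k; case: unpickle => [[n m]|]; last by rewrite measure0; split.
split; first exact: measurableX (Ffin n).1 (Hfin m).1.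
have -> : Pi (F n `*` H m) = (mu (F n) * leb (H m))%E.
  exact: product_measure1E (Ffin n).1 (Hfin m).1.
have [_ fF] := Ffin n; have [_ fH] := Hfin m.
by rewrite lte_mul_pinfty// ge0_fin_numE.
Qed.

Let PiS : {sigma_finite_measure set E -> \bar R} :=
  HB.pack_for {sigma_finite_measure set E -> \bar R} Pi
    (@Measure_isSigmaFinite.Build _ _ _ Pi Pi_sigma_finite).

Let measurable_shift (c : R) :
  measurable_fun setT (fun z : E => (z.1, z.2 + c) : E).
Proof.
apply: measurable_fun_pair; first exact: measurable_fst.
by apply: measurable_funD => //; exact: measurable_snd.
Qed.

Lemma integral_Pi_shift (F : E -> \bar R) c : measurable_fun setT F ->
  (forall z, (0 <= F z)%E) ->
  (\int[Pi]_z F (z.1, z.2 + c)%R = \int[Pi]_z F z)%E.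
Proof.
move=> mF F0; rewrite (@fubini_tonelli1 _ _ S (measurableTypeR R) R mu leb); last 2 first.
- exact: measurableT_comp mF (measurable_shift c).
- by move=> z; exact: F0.
rewrite [RHS](@fubini_tonelli1 _ _ S (measurableTypeR R) R mu leb)//.
apply: eq_integral => s _; rewrite /fubini_F /=.
rewrite (@integral_lebesgue_shift _ c (fun x => F (s, x)))//.
exact: measurableT_comp mF (measurable_pair1 s).
Qed.

Lemma weight_shift Z z c :
  weight Z (z.1, z.2 + c) = expR (- (alpha * c)) * weight (lscale (expR c) Z) z.
Proof.
by rewrite /cos_weight /lin_comb /= stable_kernel_shift lin_lscale mulrCA.
Qed.

Lemma measurable_wrt_shift h c : measurable_wrt G h ->
  measurable_wrt G (fun z : E => h (z.1, z.2 + c)).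
Proof.
move=> mh; apply: (measurable_wrt_comp (phi := fun z : E => (z.1, z.2 + c) : E)) mh => p.
pose p' := [seq (e.1, lscale (expR c) e.2) | e <- p].
have -> : ev p \o (fun z : E => (z.1, z.2 + c) : E) = ev p'.
  apply/funext => z; rewrite /trig /tev big_map; apply: eq_bigr => e _ /=.
  by rewrite lin_lscale !lin_scale expRD mulrA (mulrC (expR c)).
exact: (@measurable_wrt_generator _ _ _ ev p').
Qed.

(** A nonvanishing gauge; dividing by it is measurable for the ratios, since the
    indicator of $\{f_t \ne 0\}$ is the ratio $f_t / f_t$. *)
Let g0 := first_value (fun n s => fsel n s != 0) fsel.

Let mfsel n : measurable_fun setT (fsel n).
Proof. by rewrite /fsel; case: (sel n). Qed.

Let mg0 : measurable_fun setT g0.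
Proof.
apply: measurable_first_value => // n.
rewrite (_ : (fun _ => _) = \1_(fsel n @^-1` (~` [set 0]))).
  apply/measurable_indicP; rewrite -[X in measurable X]setTI; apply: mfsel => //.
  exact: measurableC.
apply/funext => s; rewrite indicE; congr (_ %:R); congr nat_of_bool.
by apply/idP/idP; rewrite inE /= => /eqP.
Qed.

Let g0_neq0 : {ae mu, forall s, g0 s != 0}.
Proof.
apply: filterS sel_cover => s [n fn].
by have [k [fk _ e]] := first_valueP (P := fun n s => fsel n s != 0) fsel fn; rewrite /g0 e.
Qed.

Local Notation Rt := (ratio_sigma f).
Let RtT := g_sigma_algebraType (\bigcup_(i : T * T)
  preimage_set_system setT (fun s => f i.1 s / f i.2 s) measurable).

Let mratio t u : measurable_fun [set: RtT] ((fun s => f t s / f u s) : RtT -> R).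
Proof.
apply/measurable_wrtP.
exact: (@measurable_wrt_generator _ _ _ (fun p : T * T => fun s => f p.1 s / f p.2 s) (t, u)).
Qed.

Let mP n : measurable_fun [set: RtT] ((fun s => (fsel n s != 0)%:R) : RtT -> R).
Proof.
rewrite /fsel; case: (sel n) => [t|]; last by rewrite eqxx.
rewrite (_ : (fun _ => _) = (fun s => f t s / f t s)); first exact: mratio.
by apply/funext => s; have [->|n0] := eqVneq (f t s) 0; rewrite ?mul0r ?divff.
Qed.

Let rho t := first_value (fun n s => fsel n s != 0) (fun n s => f t s / fsel n s).

Let mrho t : measurable_fun [set: RtT] (rho t : RtT -> R).
Proof.
apply: measurable_first_value => // n; rewrite /fsel.
case: (sel n) => [u|]; first exact: mratio.
by rewrite (_ : (fun _ => _) = cst 0)//; apply/funext => s; rewrite invr0 mulr0.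
Qed.

Let rhoE t s : g0 s != 0 -> rho t s = f t s / g0 s.
Proof.
have [[n fn]|/forallNP nof] := pselect (exists n, fsel n s != 0).
  have [k [fk kmin e]] := first_valueP (P := fun n s => fsel n s != 0) fsel fn.
  have [k' [fk' kmin' e']] := first_valueP (P := fun n s => fsel n s != 0)
    (fun n s => f t s / fsel n s) fn.
  rewrite /rho e' /g0 e => _; congr (_ / fsel _ _).
  by apply/eqP; rewrite eqn_leq kmin// kmin'.
by rewrite /g0 first_value_none ?eqxx// => n; apply/negP/nof.
Qed.

Let lin_rho Z s : g0 s != 0 -> lin (rho ^~ s) Z = lin_fun Z s / g0 s.
Proof.
move=> g0s; rewrite /lin_comb /lin mulr_suml; apply: eq_bigr => c _.
by rewrite rhoE// mulrA.
Qed.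

Let mdelta : measurable_fun [set: RtT] ((fun s => (g0 s != 0)%:R) : RtT -> R).
Proof.
rewrite (_ : (fun _ => _) = first_value (fun n s => fsel n s != 0) (fun _ _ => 1)).
  by apply: measurable_first_value => // n; exact: mP.
apply/funext => s.
have [[n fn]|/forallNP nof] := pselect (exists n, fsel n s != 0).
  have [k [fk _ e]] := first_valueP (P := fun n s => fsel n s != 0) fsel fn.
  have [k' [_ _ ->]] := first_valueP (P := fun n s => fsel n s != 0) (fun _ _ => 1 : R) fn.
  by rewrite /g0 e fk.
by rewrite /g0 !first_value_none ?eqxx// => n; apply/negP/nof.
Qed.

Lemma measurable_Rt (q : S -> R) : measurable_wrt Rt q -> measurable_fun setT q.
Proof.
move=> mq; have mg (p : T * T) : measurable_fun setT (fun s => f p.1 s / f p.2 s).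
  by apply: measurable_funM => //; exact: measurableT_comp measurable_invr (mf p.2).
exact: (measurable_wrt_measurable mg mq).
Qed.

(** The squares $(e^x Y)^2$ are limits of $2 n^2 (1 - \cos(e^x Y / n))$, their
    polarisations are the $e^{2x} f_t f_u$, and the scale cancels in ratios. *)
Lemma measurable_wrt_fst (q : S -> R) :
  measurable_wrt Rt q -> measurable_wrt G (q \o (fst : E -> S)).
Proof.
apply: measurable_wrt_comp => -[t u]; apply/measurable_wrtP.
set GE := g_sigma_algebraType _.
have mev p : measurable_fun [set: GE] (ev p : GE -> R).
  apply/measurable_wrtP; exact: (@measurable_wrt_generator _ _ _ ev p).
pose sq Z (z : E) := (expR z.2 * lin_fun Z z.1) ^+ 2.
have msq Z : measurable_fun [set: GE] (sq Z : GE -> R).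
  apply: (@measurable_fun_cvg _ GE R setT (fun n z =>
    2 * (n.+1%:R ^+ 2 * ev (one_minus_cos (lscale n.+1%:R^-1 Z)) z))).
    by move=> n; do 2 apply: measurable_funM => //.
  move=> z _; rewrite /sq; under eq_fun do
    rewrite /trig tev_one_minus_cos lin_scale lin_lscale (mulrCA (expR z.2)).
  exact: cvg_one_minus_cos.
have -> : (fun s => f (t, u).1 s / f (t, u).2 s) \o (fst : E -> S) = fun z =>
    ((sq [:: (1, t); (1, u)] z - sq [:: (1, t); (-1, u)] z) * 4^-1) *
    (sq [:: (1, u)] z) `^ (-1).
  apply/funext => z; rewrite /sq powR_inv1 ?sqr_ge0//= /lin_comb /lin.
  rewrite !big_cons !big_nil /= !addr0 !mul1r mulN1r.
  have [->|fu] := eqVneq (f u z.1) 0.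
    by rewrite !mulr0 !(addr0, subr0, oppr0) expr0n/= invr0 !mulr0.
  by field; rewrite fu gt_eqF// expR_gt0.
apply: measurable_funM.
  by apply: measurable_funM => //; exact: measurable_funB.
by apply: (measurableT_comp (measurable_powR (-1))).
Qed.

(** Following, in the logarithmic variable, the curve along which $e^x |g_0|$
    is constant turns functions of the $e^x f_t$, up to a common sign, into
    functions of the ratios.  On the null set where $g_0 = 0$ a single point is
    used, so that nothing but the indicator of this set enters. *)
Let slice (v : R) (s : S) : E := if g0 s == 0 then (point, 0) else (s, v - ln `|g0 s|).

Let measurable_slice h v : measurable_wrt G h -> measurable_wrt Rt (h \o slice v).
Proof.
apply: measurable_wrt_comp => p; apply/measurable_wrtP.
have -> : ev p \o slice v = fun s =>
    (1 - (g0 s != 0)%:R) * ev p (point, 0) +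
    (g0 s != 0)%:R * (\sum_(c <- p) c.1 * cos (expR v * lin (rho ^~ s) c.2)).
  apply/funext => s; rewrite /slice /=; have [g0s|g0s] := eqVneq (g0 s) 0.
    by rewrite subr0 mul1r mul0r addr0.
  rewrite subrr mul0r add0r mul1r evE /=; apply: eq_bigr => c _; congr (_ * _).
  have ng : 0 < `|g0 s| by rewrite normr_gt0.
  rewrite lin_rho// expRD expRN lnK ?posrE//.
  (* The sign of $g_0$ disappears because the cosine is even. *)
  case: (ger0P (g0 s)) => _; first by rewrite mulrA mulrAC.
  by rewrite invrN mulrN mulNr cosN -!mulrA (mulrC (g0 s)^-1).
apply: measurable_funD; apply: measurable_funM => //.
  exact: measurable_funB.
apply: measurable_sum => c; apply: measurable_funM => //.
apply: measurable_cos_fun; apply: measurable_funM => //.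
by apply: measurable_sum => e; apply: measurable_funM.
Qed.

Section existence.
Variable phi : comb -> R.
Hypothesis nphi : negative_type phi.
Hypothesis npsiphi : negative_type (fun Z => psi Z - phi Z).
Hypothesis phi_scale : forall a Z, 0 < a -> phi (lscale a Z) = a `^ alpha * phi Z.

Let phi_nil : phi [::] = 0.
Proof.
have := phi_scale [::] (@ltr0Sn R 1); rewrite /lscale /= => /eqP.
rewrite eq_sym -subr_eq0 -[X in _ - X]mul1r -mulrBl mulf_eq0 => /orP[|/eqP//].
have /andP[a0 _] := alpha02.
rewrite subr_eq0 => /eqP e; have : (1 : R) `^ alpha < 2 `^ alpha.
  by apply: gt0_ltr_powR; rewrite ?nnegrE//; lra.
by rewrite e powR1 ltxx.
Qed.

(** By homogeneity of $\varphi$ the translates of $h$ are densities of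
    $\varphi$ too. *)
Let shift_invariant h : measurable_wrt G h -> (forall z, 0 <= h z <= 1) ->
  (forall Z, phi Z = \int[Pi]_z (h z * weight Z z)) ->
  forall c, {ae Pi, forall z, h (z.1, z.2 + c) = h z}.
Proof.
move=> mh h01 hphi c.
have n1 z : `|h z| <= 1 by have /andP[h0 h1] := h01 z; rewrite ger0_norm.
apply: (levy_density_unique_ae (M := 1)) => //; first exact: measurable_wrt_shift.
move=> Z; rewrite -hphi.
pose F z := (h z * weight Z (z.1, z.2 - c))%:E.
have mh' := G_measurable mf mh.
have -> : \int[Pi]_z (h (z.1, z.2 + c) * weight Z z) = fine (\int[Pi]_z F z)%E.
  rewrite -(integral_Pi_shift c); last 2 first.
  - apply/measurable_EFinP; apply: measurable_funM => //.
    exact: measurableT_comp (measurable_weight alpha mf Z) (measurable_shift (- c)).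
  - move=> z; rewrite lee_fin mulr_ge0 ?weight_ge0//.
    by have /andP[] := h01 z.
  by apply: eq_Rintegral => -[s x] _; rewrite /= addrK.
have -> : fine (\int[Pi]_z F z)%E =
    expR (alpha * c) * \int[Pi]_z (h z * weight (lscale (expR (- c)) Z) z).
  rewrite -RintegralZl//; last first.
    exact: (integrable_mul_weight alpha02 mf iY mh' n1 (lscale (expR (- c)) Z)).
  by apply: eq_Rintegral => z _; rewrite weight_shift mulrN opprK mulrCA.
rewrite -hphi phi_scale ?expR_gt0// /powR gt_eqF ?expR_gt0// expRK mulrA -expRD.
by rewrite mulrN addrN expR0 mul1r.
Qed.

(** For each $(s, x)$ the translation by $c = v - \ln |g_0(s)| - x$ reaches the
    curve; as $v$ runs through $R$ so does $c$, and Tonelli's theorem exchanges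
    almost every $c$ for almost every $v$. *)
Let slice_ae h : measurable_fun setT h ->
  (forall c, {ae Pi, forall z, h (z.1, z.2 + c) = h z}) ->
  exists v : R, {ae Pi, forall z, h (z.1, v - ln `|g0 z.1|) = h z}.
Proof.
move=> mh inv.
pose k (w : E * measurableTypeR R) := `|h (w.1.1, w.1.2 + w.2) - h w.1|%:E.
pose k2 (w : E * measurableTypeR R) := `|h (w.1.1, w.2 - ln `|g0 w.1.1|) - h w.1|%:E.
have mw11 : measurable_fun setT (fun w : E * measurableTypeR R => w.1.1).
  exact: measurableT_comp measurable_fst measurable_fst.
have mw12 : measurable_fun setT (fun w : E * measurableTypeR R => w.1.2 : R).
  exact: measurableT_comp measurable_snd measurable_fst.
have mw2 : measurable_fun setT (fun w : E * measurableTypeR R => w.2 : R).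
  exact: measurable_snd.
have mhw1 : measurable_fun setT (fun w : E * measurableTypeR R => h w.1).
  exact: measurableT_comp mh measurable_fst.
have mk : measurable_fun setT k.
  apply/measurable_EFinP; apply: measurableT_comp => //; apply: measurable_funB => //.
  apply: (measurableT_comp mh); apply: measurable_fun_pair => //.
  exact: measurable_funD.
have mk2 : measurable_fun setT k2.
  apply/measurable_EFinP; apply: measurableT_comp => //; apply: measurable_funB => //.
  apply: (measurableT_comp mh); apply: measurable_fun_pair => //.
  apply: measurable_funB => //; apply: (measurableT_comp (@measurable_ln R)).
  by apply: measurableT_comp => //; exact: measurableT_comp mg0 mw11.
have k_ge0 w : (0 <= k w)%E by rewrite lee_fin.
have k2_ge0 w : (0 <= k2 w)%E by rewrite lee_fin.
have int0 : (\int[Pi]_z \int[leb]_c k (z, c) = 0)%E.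
  transitivity (\int[leb]_c \int[Pi]_z k (z, c))%E.
    exact: (@fubini_tonelli _ _ _ (measurableTypeR R) R PiS leb k mk k_ge0).
  apply: integral0_eq => c _.
  have mc : measurable_fun setT (fun z : E => (h (z.1, z.2 + c) - h z)%:E).
    apply/measurable_EFinP; apply: measurable_funB => //.
    exact: measurableT_comp mh (measurable_shift c).
  suff : (\int[Pi]_z `|(h (z.1, z.2 + c) - h z)%:E| = 0)%E by [].
  apply/(ae_eq_integral_abs _ measurableT mc).
  have [N [mN N0 sub]] := inv c; exists N; split=> // z /= nz; apply: sub => /= e.
  by apply: nz => _; rewrite e subrr.
have int20 : (\int[leb]_v \int[Pi]_z k2 (z, v) = 0)%E.
  transitivity (\int[Pi]_z \int[leb]_v k2 (z, v))%E.
    exact/esym/(@fubini_tonelli _ _ _ (measurableTypeR R) R PiS leb k2 mk2 k2_ge0).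
  rewrite -[RHS]int0.
  apply: eq_integral => z _.
  have -> : (\int[leb]_v k2 (z, v) =
      \int[leb]_v k (z, (v : R) + (- ln `|g0 z.1| - z.2))%R)%E.
    apply: eq_integral => v _; rewrite /k2 /k /=.
    by congr (`|h (_, _) - _|%:E); ring.
  rewrite (@integral_lebesgue_shift _ _ (fun v => k (z, v)))//.
  exact: measurableT_comp mk (measurable_pair1 z).
have mI : measurable_fun setT (fun v : measurableTypeR R => \int[Pi]_z k2 (z, v))%E.
  exact: (@measurable_fun_fubini_tonelli_G _ _ _ (measurableTypeR R) R PiS k2 mk2 k2_ge0).
have I0 v : (0 <= \int[Pi]_z k2 (z, v))%E by apply: integral_ge0.
have : {ae leb, forall v : measurableTypeR R, (\int[Pi]_z k2 (z, v) = 0)%E}.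
  have : (\int[leb]_v `|\int[Pi]_z k2 (z, v)| = 0)%E.
    by under eq_integral do rewrite gee0_abs//.
  by move/(ae_eq_integral_abs _ measurableT mI); apply: filterS => v /(_ I).
move=> [N [mN N0 sub]].
have [v Nv] : exists v, ~ N v.
  apply/existsNP => allN.
  have : (leb `[0%R, 1%R]%classic <= leb N)%E.
    by apply: le_measure; rewrite ?inE// => x _; exact: allN.
  by rewrite [leb N]N0 lebesgue_measure_itv/= lte_fin ltr01 sube0 lee_fin ler10.
exists v; have kv0 : (\int[Pi]_z k2 (z, v) = 0)%E by apply: contrapT => /sub.
have mkv : measurable_fun setT (fun z : E => (h (z.1, v - ln `|g0 z.1|) - h z)%:E).
  apply/measurable_EFinP; apply: measurable_funB => //.
  apply: (measurableT_comp mh); apply: measurable_fun_pair; first exact: measurable_fst.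
  apply: measurable_funB => //; apply: (measurableT_comp (@measurable_ln R)).
  by apply: measurableT_comp => //; exact: measurableT_comp mg0 measurable_fst.
have /(ae_eq_integral_abs _ measurableT mkv) : (\int[Pi]_z
    `|(h (z.1, v - ln `|g0 z.1|) - h z)%:E| = 0)%E by exact: kv0.
apply: filterS => z /(_ I) /= [] /eqP; rewrite subr_eq0 => /eqP //.
Qed.

(** A negative type functional dominated by $\psi$ has a density on
    $S \times R$, invariant along $x$; its values on the curve depend on the
    ratios only. *)
Lemma ratio_density_exists : exists q : S -> R,
  [/\ measurable_wrt Rt q, forall s, 0 <= q s <= 1 &
      forall Z, phi Z = \int[mu]_s (q s * `|lin_fun Z s| `^ alpha)].
Proof.
have [h [mh h01 hphi]] := levy_density_exists alpha02 mf iY nphi npsiphi phi_nil b_cover.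
have mh' := G_measurable mf mh.
have [v hv] := slice_ae mh' (shift_invariant mh h01 hphi).
exists (h \o slice v); split; first exact: measurable_slice.
  by move=> s; exact: h01.
move=> Z.
have mq : measurable_fun setT (h \o slice v) by apply: measurable_Rt; exact: measurable_slice.
rewrite -(Rintegral_weight mu alpha02 mf)//; last first.
  by move=> s; have /andP[] := h01 (slice v s).
rewrite hphi /Rintegral; congr fine; apply: ae_eq_integral => //.
- apply/measurable_EFinP; apply: measurable_funM => //; exact: measurable_weight.
- apply/measurable_EFinP; apply: measurable_funM; last exact: measurable_weight.
  exact: measurableT_comp mq measurable_fst.
- apply: filterS2 (ae_fst g0_neq0) hv => z g0z hz _.
  by rewrite /= /slice (negbTE g0z) hz.
Qed.

End existence.

(** Functions of the ratios are functions of the trigonometric polynomials, so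
    the uniqueness on $S \times R$ applies. *)
Lemma ratio_density_unique (q q' : S -> R) M :
  measurable_wrt Rt q -> measurable_wrt Rt q' ->
  (forall s, 0 <= q s <= M) -> (forall s, 0 <= q' s <= M) ->
  (forall Z, \int[mu]_s (q s * `|lin_fun Z s| `^ alpha) =
             \int[mu]_s (q' s * `|lin_fun Z s| `^ alpha)) ->
  {ae mu, forall s, q s = q' s}.
Proof.
move=> mq mq' q01 q01' qq'.
have mq1 := measurable_Rt mq; have mq1' := measurable_Rt mq'.
have bound r z : (forall s, 0 <= r s <= M) -> `|(r \o fst) (z : E)| <= M.
  by move=> r01; have /andP[r0 r1] := r01 z.1; rewrite /= ger0_norm.
have : {ae Pi, forall z, (q \o fst) z = (q' \o fst) z}.
  apply: (levy_density_unique_ae (M := M)) => [||z|z|Z].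
  - exact: measurable_wrt_fst.
  - exact: measurable_wrt_fst.
  - exact: bound.
  - exact: bound.
  rewrite /= !(Rintegral_weight mu alpha02 mf)//.
  - by move=> s; have /andP[] := q01' s.
  - by move=> s; have /andP[] := q01 s.
move=> ae1.
have mN : measurable [set s | q s - q' s != 0].
  have : measurable_fun setT (fun s => q s - q' s) by exact: measurable_funB.
  move=> /(_ measurableT (~` [set 0])); rewrite setTI.
  move=> /(_ (measurableC (measurable_set1 0))).
  by congr measurable; apply/seteqP; split=> s /= /eqP.
have := @ae_fst_inv _ mN; case=> [|N [mN' N0 sub]].
  by apply: filterS ae1 => z /= ->; rewrite subrr eqxx.
exists N; split=> // s /= qs; apply: sub => /= nn; apply: qs.
by apply/eqP; rewrite -subr_eq0; apply/negPn/negP.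
Qed.

End ratio_densities.

(** * Characteristic functions and finite-dimensional laws *)

Section bounded_measurable_induction.
Context {R : realType} {d : measure_display} {X : measurableType d}.

Lemma sum_nat_lt (N k : nat) : (\sum_(i < N) (i < k)%N%:R = (minn N k)%:R :> R).
Proof.
elim: N => [|N IH]; first by rewrite big_ord0 min0n.
rewrite big_ord_recr/= IH -natrD; congr (_%:R).
by case: ltnP => [Nk|kN]; lia.
Qed.

(** Rounding $g$ down to a multiple of $1 / (N + 1)$, written as a combination
    of indicators. *)
Let level (g : X -> R) N x : R :=
  \sum_(i < N.+1) N.+1%:R^-1 * \1_[set y | i.+1%:R / N.+1%:R <= g y] x.

Let level_close g N x : 0 <= g x <= 1 -> `|g x - level g N x| <= N.+1%:R^-1.
Proof.
move=> /andP[g0 g1]; have N0 : (0 : R) < N.+1%:R by rewrite ltr0n.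
pose k := Num.trunc (N.+1%:R * g x).
have /andP[k1 k2] : k%:R <= N.+1%:R * g x < k.+1%:R.
  by apply: truncn_itv; rewrite mulr_ge0// ltW.
have kN : (k <= N.+1)%N.
  by rewrite -(ler_nat R) (le_trans k1)// ler_piMr// ltW.
have -> : level g N x = N.+1%:R^-1 * k%:R.
  rewrite /level -mulr_sumr; congr (_ * _).
  rewrite -[in RHS](minn_idPr kN) -sum_nat_lt; apply: eq_bigr => i _.
  rewrite indicE; congr (_%:R); congr nat_of_bool; apply/idP/idP; rewrite inE/=.
    rewrite ler_pdivrMr// mulrC => h.
    by rewrite -ltnS -(ltr_nat R) (le_lt_trans h).
  move=> ik; rewrite ler_pdivrMr// mulrC (le_trans _ k1)// ler_nat.
  exact: ik.
have -> : g x - N.+1%:R^-1 * k%:R = N.+1%:R^-1 * (N.+1%:R * g x - k%:R).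
  by rewrite mulrBr mulKf// gt_eqF.
rewrite normrM ger0_norm ?invr_ge0 ?(ltW N0)// ler_piMr ?invr_ge0 ?(ltW N0)//.
rewrite ger0_norm ?subr_ge0// lerBlDr; move: k2; rewrite -natr1; lra.
Qed.

(** Uniform approximation by rounded functions. *)
Lemma bounded_measurable_ind (Q : (X -> R) -> Prop) :
  (forall C, measurable C -> Q (\1_C)) ->
  (forall f g : X -> R, Q f -> Q g -> Q (fun x => f x + g x)) ->
  (forall c (f : X -> R), Q f -> Q (fun x => c * f x)) ->
  (forall (f_ : nat -> X -> R) (f : X -> R) M, (forall n, Q (f_ n)) ->
    (forall n x, `|f_ n x| <= M) ->
    (forall x, f_ n x @[n --> \oo] --> f x) -> Q f) ->
  forall (f : X -> R) M, measurable_fun setT f ->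
    (forall x, `|f x| <= M) -> Q f.
Proof.
move=> Q1 Qadd Qscale Qlim f M mf fM.
pose K := `|M| + 1; have K0 : 0 < K by rewrite ltr_wpDl.
pose g x := (2 * K)^-1 * (f x + K).
have g01 x : 0 <= g x <= 1.
  have := fM x; have := ler_norm M; rewrite ler_norml => hM /andP[f1 f2].
  have K20 : 0 < 2 * K by rewrite mulr_gt0.
  rewrite /g mulrC ler_pdivrMr// mul1r divr_ge0 ?(ltW K20)//=.
    by rewrite /K; lra.
  by rewrite /K; lra.
have mg : measurable_fun setT g.
  by apply: measurable_funM => //; exact: measurable_funD.
have Qg : Q g.
  apply: (Qlim (level g) _ 2) => [N|N x|x].
  - suff part n : Q (fun x => \sum_(i < n)
        N.+1%:R^-1 * \1_[set y | i.+1%:R / N.+1%:R <= g y] x) by exact: part.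
    elim: n => [|n IH].
      rewrite (_ : (fun _ => _) = fun x => 0 * \1_setT x); last first.
        by apply/funext => x; rewrite big_ord0 mul0r.
      by apply: (Qscale _ (\1_(_))); exact: Q1.
    under eq_fun do rewrite big_ord_recr/=.
    apply: Qadd => //; apply: (Qscale _ (\1_(_))); apply: Q1.
    have := mg measurableT _ (measurable_itv `[n.+1%:R / N.+1%:R, +oo[).
    by rewrite setTI; congr measurable; apply/seteqP; split=> y /=; rewrite in_itv/= andbT.
  - have := level_close N (g01 x); rewrite -normrN opprB => h.
    have /andP[g0 g1] := g01 x.
    have -> : level g N x = (level g N x - g x) + g x by ring.
    rewrite (le_trans (ler_normD _ _))// (_ : 2 = 1 + 1)// lerD//.
      by rewrite (le_trans h)// invf_le1// ler1n.
    by rewrite ger0_norm.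
  - apply/cvgrPdist_le => e e0.
    have /cvgrPdist_le /(_ e e0) := @cvg_harmonic R.
    apply: filterS => N; rewrite sub0r normrN ger0_norm ?harmonic_ge0// => h.
    exact: le_trans (level_close N (g01 x)) h.
have -> : f = fun x => 2 * K * g x + (- K) * \1_setT x.
  apply/funext => x; rewrite indicT /g /= mulr1 mulrA divff ?mul1r ?addrK//.
  by rewrite gt_eqF// mulr_gt0.
by apply: Qadd; apply: Qscale => //; exact: Q1.
Qed.

End bounded_measurable_induction.

Section characteristic_functions.
Context {R : realType} {d : measure_display} {Omega : measurableType d}.
Variable P : probability Omega R.
Implicit Types X Y : Omega -> R.

Lemma integrable_bounded X M : measurable_fun setT X -> (forall w, `|X w| <= M) ->
  P.-integrable setT (EFin \o X).
Proof.
move=> mX XM; apply: measurable_bounded_integrable => //.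
  by rewrite -ge0_fin_numE// fin_num_measure.
by exists M; split; rewrite ?num_real// => x Mx w _; exact: le_trans (XM w) (ltW Mx).
Qed.

Lemma cvg_expectation (X_ : nat -> Omega -> R) X M :
  (forall n, measurable_fun setT (X_ n)) ->
  (forall w, X_ n w @[n --> \oo] --> X w) -> (forall n w, `|X_ n w| <= M) ->
  \int[P]_w X_ n w @[n --> \oo] --> \int[P]_w X w.
Proof.
move=> mX XX XM.
apply: (proj2 (@cvg_Rintegral_dominated _ _ _ P X_ X (fun=> M) mX _ _ _ _)).
- exact: aeW.
- by apply: (measurable_fun_cvg mX) => w _; exact: XX.
- by apply: aeW => w n; exact: XM.
- exact: (@integrable_bounded (fun=> M) `|M|).
Qed.

Lemma Rintegral_indicator A : measurable A -> \int[P]_w \1_A w = fine (P A).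
Proof.
move=> mA; rewrite /Rintegral; congr fine.
by rewrite integral_indic// setIT.
Qed.

Lemma integrable_cos X : measurable_fun setT X ->
  P.-integrable setT (EFin \o (fun w => cos (X w))).
Proof.
move=> mX; apply: (integrable_bounded (M := 1)); first exact: measurable_cos_fun.
by move=> w; exact: cos_max.
Qed.

Lemma integrable_sin X : measurable_fun setT X ->
  P.-integrable setT (EFin \o (fun w => sin (X w))).
Proof.
move=> mX; apply: (integrable_bounded (M := 1)); first exact: measurable_sin_fun.
by move=> w; exact: sin_max.
Qed.

Lemma measurable_lin (T : Type) (X : T -> Omega -> R) Z :
  (forall t, measurable_fun setT (X t)) ->
  measurable_fun setT (fun w => lin (X ^~ w) Z).
Proof. by move=> mX; apply: measurable_sum => c; exact: measurable_funM. Qed.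

End characteristic_functions.

Section finite_dimensional_laws.
Context {R : realType} {T : Type}.
Context {d : measure_display} {Omega : measurableType d} {P : probability Omega R}.
Context {d' : measure_display} {Omega' : measurableType d'}.
Context {P' : probability Omega' R}.
Variables (X : T -> Omega -> R) (Y : T -> Omega' -> R).
Hypothesis mX : forall t, measurable_fun setT (X t).
Hypothesis mY : forall t, measurable_fun setT (Y t).

Let measurable_tuple_map d1 (O : measurableType d1) (U : T -> O -> R) m
    (t : 'I_m -> T) : (forall t, measurable_fun setT (U t)) ->
  measurable_fun setT (fun w => [tuple U (t j) w | j < m]).
Proof.
move=> mU; apply/measurable_fun_tnthP => j.
by rewrite (_ : _ \o _ = U (t j))//; apply/funext => w; rewrite /= tnth_mktuple.
Qed.

Lemma eq_fdd_integral m (t : 'I_m -> T) (phi : m.-tuple R -> R) M :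
  eq_fdd P X P' Y -> measurable_fun setT phi -> (forall x, `|phi x| <= M) ->
  \int[P]_w phi [tuple X (t j) w | j < m] = \int[P']_w phi [tuple Y (t j) w | j < m].
Proof.
move=> XY; have mtX := measurable_tuple_map t mX; have mtY := measurable_tuple_map t mY.
pose Q (h : m.-tuple R -> R) := [/\ measurable_fun setT h,
  exists N, forall x, `|h x| <= N &
  \int[P]_w h [tuple X (t j) w | j < m] = \int[P']_w h [tuple Y (t j) w | j < m]].
move=> mphi phiM; suff [] : Q phi by [].
move: phi M mphi phiM; apply: bounded_measurable_ind.
- move=> C mC; split.
  + exact: measurable_indic.
  + by exists 1 => x; rewrite indicE; case: (_ \in _); rewrite ?normr1 ?normr0.
  + have := XY m t C mC.
    have mCX : measurable [set w | C [tuple X (t j) w | j < m]].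
      by have := mtX measurableT C mC; rewrite setTI.
    have mCY : measurable [set w | C [tuple Y (t j) w | j < m]].
      by have := mtY measurableT C mC; rewrite setTI.
    by move=> /(congr1 fine); rewrite -!Rintegral_indicator.
- move=> h1 h2 [m1 [N1 b1] e1] [m2 [N2 b2] e2]; split.
  + exact: measurable_funD.
  + by exists (N1 + N2) => x; rewrite (le_trans (ler_normD _ _))// lerD.
  + rewrite !RintegralD ?e1 ?e2//.
    * by apply: (@integrable_bounded _ _ _ _ _ N1) => //; exact: measurableT_comp m1 mtY.
    * by apply: (@integrable_bounded _ _ _ _ _ N2) => //; exact: measurableT_comp m2 mtY.
    * by apply: (@integrable_bounded _ _ _ _ _ N1) => //; exact: measurableT_comp m1 mtX.
    * by apply: (@integrable_bounded _ _ _ _ _ N2) => //; exact: measurableT_comp m2 mtX.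
- move=> c h1 [m1 [N1 b1] e1]; split.
  + exact: measurable_funM.
  + by exists (`|c| * N1) => x; rewrite normrM ler_wpM2l.
  + rewrite !RintegralZl ?e1//.
    * by apply: (@integrable_bounded _ _ _ _ _ N1) => //; exact: measurableT_comp m1 mtY.
    * by apply: (@integrable_bounded _ _ _ _ _ N1) => //; exact: measurableT_comp m1 mtX.
- move=> h_ h N Qh hN hl; have mh : measurable_fun setT h.
    by apply: (@measurable_fun_cvg _ _ _ _ h_) => [n|x _]; [have [] := Qh n|exact: hl].
  split=> //; first by exists N => x; exact: lim_norm_le (fun n => hN n x) (hl x).
  have cX : \int[P]_w h_ n [tuple X (t j) w | j < m] @[n --> \oo] -->
      \int[P]_w h [tuple X (t j) w | j < m].
    apply: (@cvg_expectation _ _ _ _ _ _ N) => [n|w|n w]; [|exact: hl|exact: hN].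
    by apply: measurableT_comp mtX; have [] := Qh n.
  have cY : \int[P']_w h_ n [tuple Y (t j) w | j < m] @[n --> \oo] -->
      \int[P']_w h [tuple Y (t j) w | j < m].
    apply: (@cvg_expectation _ _ _ _ _ _ N) => [n|w|n w]; [|exact: hl|exact: hN].
    by apply: measurableT_comp mtY; have [] := Qh n.
  have E : (fun n => \int[P]_w h_ n [tuple X (t j) w | j < m]) =
      (fun n => \int[P']_w h_ n [tuple Y (t j) w | j < m]).
    by apply/funext => n; have [] := Qh n.
  by rewrite -(cvg_lim _ cX)// -(cvg_lim _ cY)// E.
Qed.

Lemma eq_fdd_cos_sin Z : eq_fdd P X P' Y ->
  \int[P]_w cos (lin (X ^~ w) Z) = \int[P']_w cos (lin (Y ^~ w) Z) /\
  \int[P]_w sin (lin (X ^~ w) Z) = \int[P']_w sin (lin (Y ^~ w) Z).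
Proof.
move=> XY; pose t (j : 'I_(size Z)) := (tnth (in_tuple Z) j).2.
pose l (x : (size Z).-tuple R) := \sum_j (tnth (in_tuple Z) j).1 * tnth x j.
have ml : measurable_fun setT l.
  apply: measurable_sum => j; apply: measurable_funM => //.
  exact: measurable_tnth.
have lE d1 (O : measurableType d1) (U : T -> O -> R) w :
    lin (U ^~ w) Z = l [tuple U (t j) w | j < size Z].
  by rewrite /lin big_tnth; apply: eq_bigr => j _; rewrite tnth_mktuple.
under eq_Rintegral do rewrite lE; under [in RHS]eq_Rintegral do rewrite lE.
split.
- apply: (@eq_fdd_integral _ t (fun x => cos (l x)) 1) => //.
    exact: measurable_cos_fun.
  by move=> x; exact: cos_max.
- under eq_Rintegral do rewrite lE; under [in RHS]eq_Rintegral do rewrite lE.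
  apply: (@eq_fdd_integral _ t (fun x => sin (l x)) 1) => //.
    exact: measurable_sin_fun.
  by move=> x; exact: sin_max.
Qed.

(** The trigonometric polynomials, with phases carried by an extra coordinate
    equal to $1$, form an algebra that generates the Borel sets of $R^m$. *)
Lemma cos_sin_eq_fdd :
  (forall Z, \int[P]_w cos (lin (X ^~ w) Z) = \int[P']_w cos (lin (Y ^~ w) Z)) ->
  (forall Z, \int[P]_w sin (lin (X ^~ w) Z) = \int[P']_w sin (lin (Y ^~ w) Z)) ->
  eq_fdd P X P' Y.
Proof.
move=> hcos hsin m t B mB.
have mtX := measurable_tuple_map t mX; have mtY := measurable_tuple_map t mY.
pose pt (x : m.-tuple R) (o : option 'I_m) : R := if o is Some j then tnth x j else 1.
pose g p (x : m.-tuple R) := tev (pt x) p.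
have mpt o : measurable_fun setT (fun x => pt x o).
  by case: o => [j|] //=; exact: measurable_tnth.
have mg p : measurable_fun setT (g p).
  apply: measurable_sum => c; apply: measurable_funM => //.
  by apply: measurable_cos_fun; exact: measurable_lin.
have galg : bounded_algebra (range g).
  split.
  - by exists [:: (1, [::])] => //; apply/funext => z; rewrite /g tev_one.
  - move=> c _ [p _ <-]; exists (tscale c p) => //; apply/funext => z.
    by rewrite /g tev_scale.
  - move=> _ _ [p _ <-] [q _ <-]; exists (p ++ q) => //; apply/funext => z.
    by rewrite /g tev_cat.
  - move=> _ _ [p _ <-] [q _ <-]; exists (tmul p q) => //; apply/funext => z.
    by rewrite /g tev_mul.
  - by move=> _ [p _ <-]; have [M pM] := tev_bounded p; exists M => z; exact: pM.
have split_lin (Z : seq (R * option 'I_m)) : exists (Z' : seq (R * T)) theta,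
    (forall w, lin (pt [tuple X (t j) w | j < m]) Z = lin (X ^~ w) Z' + theta) /\
    (forall w, lin (pt [tuple Y (t j) w | j < m]) Z = lin (Y ^~ w) Z' + theta).
  elim: Z => [|[a [j|]] Z [Z' [th [IHX IHY]]]].
  - by exists [::], 0; split=> w; rewrite !lin_nil addr0.
  - exists ((a, t j) :: Z'), th; split=> w.
      by rewrite /lin !big_cons -!/(lin _ _) IHX /= tnth_mktuple addrA.
    by rewrite /lin !big_cons -!/(lin _ _) IHY /= tnth_mktuple addrA.
  - exists Z', (th + a); split=> w.
      by rewrite /lin !big_cons -!/(lin _ _) IHX /= mulr1 addrC addrA.
    by rewrite /lin !big_cons -!/(lin _ _) IHY /= mulr1 addrC addrA.
have gE p : \int[P]_w g p [tuple X (t j) w | j < m] =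
    \int[P']_w g p [tuple Y (t j) w | j < m].
  elim: p => [|c p IH].
    by under eq_Rintegral do rewrite /g /tev big_nil;
       under [in RHS]eq_Rintegral do rewrite /g /tev big_nil;
       rewrite !Rintegral_cst// !mul0r.
  have [M pM] := tev_bounded p.
  under eq_Rintegral do rewrite /g -cat1s tev_cat.
  under [in RHS]eq_Rintegral do rewrite /g -cat1s tev_cat.
  have [Z' [th [EX EY]]] := split_lin c.2.
  have e1 : \int[P]_w tev (pt [tuple X (t j) w | j < m]) [:: c] =
      c.1 * (cos th * \int[P]_w cos (lin (X ^~ w) Z') -
             sin th * \int[P]_w sin (lin (X ^~ w) Z')).
    have iC := integrable_cos P (measurable_lin Z' mX).
    have iS := integrable_sin P (measurable_lin Z' mX).
    rewrite -!RintegralZl// -RintegralB//; last 2 first.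
    - exact: integrable_scale iC.
    - exact: integrable_scale iS.
    rewrite -RintegralZl//; last first.
      have := integrable_add (integrable_scale (cos th) iC) (integrable_scale (- sin th) iS).
      by congr (_.-integrable _ _); apply/funext => w /=; rewrite mulNr.
    apply: eq_Rintegral => w _; rewrite /tev big_seq1 EX cosD.
    by congr (_ * _); rewrite [_ * cos th]mulrC [_ * sin th]mulrC.
  have e2 : \int[P']_w tev (pt [tuple Y (t j) w | j < m]) [:: c] =
      c.1 * (cos th * \int[P']_w cos (lin (Y ^~ w) Z') -
             sin th * \int[P']_w sin (lin (Y ^~ w) Z')).
    have iC := integrable_cos P' (measurable_lin Z' mY).
    have iS := integrable_sin P' (measurable_lin Z' mY).
    rewrite -!RintegralZl// -RintegralB//; last 2 first.
    - exact: integrable_scale iC.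
    - exact: integrable_scale iS.
    rewrite -RintegralZl//; last first.
      have := integrable_add (integrable_scale (cos th) iC) (integrable_scale (- sin th) iS).
      by congr (_.-integrable _ _); apply/funext => w /=; rewrite mulNr.
    apply: eq_Rintegral => w _; rewrite /tev big_seq1 EY cosD.
    by congr (_ * _); rewrite [_ * cos th]mulrC [_ * sin th]mulrC.
  have [N cN] := tev_bounded [:: c].
  rewrite !RintegralD//.
  - by rewrite e1 e2 hcos hsin; congr (_ + _); exact: IH.
  - by apply: (@integrable_bounded _ _ _ _ _ N) => //; exact: measurableT_comp (mg [:: c]) mtY.
  - by apply: (@integrable_bounded _ _ _ _ _ M) => //; exact: measurableT_comp (mg p) mtY.
  - by apply: (@integrable_bounded _ _ _ _ _ N) => //; exact: measurableT_comp (mg [:: c]) mtX.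
  - by apply: (@integrable_bounded _ _ _ _ _ M) => //; exact: measurableT_comp (mg p) mtX.
have closE h : bclosure (range g) h ->
    \int[P]_w h [tuple X (t j) w | j < m] = \int[P']_w h [tuple Y (t j) w | j < m].
  elim=> [_ [p _ <-]//|h_ {}h M Bh IH hM hl].
  have mh n := bclosure_measurable mg (Bh n).
  have cX : \int[P]_w h_ n [tuple X (t j) w | j < m] @[n --> \oo] -->
      \int[P]_w h [tuple X (t j) w | j < m].
    apply: (@cvg_expectation _ _ _ _ _ _ M) => [n|w|n w]; [|exact: hl|exact: hM].
    exact: measurableT_comp (mh n) mtX.
  have cY : \int[P']_w h_ n [tuple Y (t j) w | j < m] @[n --> \oo] -->
      \int[P']_w h [tuple Y (t j) w | j < m].
    apply: (@cvg_expectation _ _ _ _ _ _ M) => [n|w|n w]; [|exact: hl|exact: hM].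
    exact: measurableT_comp (mh n) mtY.
  have E : (fun n => \int[P]_w h_ n [tuple X (t j) w | j < m]) =
      (fun n => \int[P']_w h_ n [tuple Y (t j) w | j < m]).
    by apply/funext => n; exact: IH.
  by rewrite -(cvg_lim _ cX)// -(cvg_lim _ cY)// E.
pose GE := g_sigma_algebraType (\bigcup_(p : seq (R * seq (R * option 'I_m)))
  preimage_set_system setT (g p) measurable).
have mgG p : measurable_fun [set: GE] (g p : GE -> R).
  apply/measurable_wrtP; exact: (@measurable_wrt_generator _ _ _ g p).
have mcoord j : measurable_fun [set: GE] ((fun x : m.-tuple R => tnth x j) : GE -> R).
  apply: (@measurable_fun_cvg _ GE R setT (fun n x => n.+1%:R *
    g [:: (1, [:: (n.+1%:R^-1, Some j); (- (pi / 2), None)])] x)).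
    by move=> n; apply: measurable_funM.
  move=> x _; under eq_fun do
    rewrite /g /tev big_seq1 mul1r /lin !big_cons big_nil addr0 /= mulr1 cosBpihalf.
  exact: cvg_sin_div.
have BG : sigma_of g B.
  have : measurable_fun [set: GE] (id : GE -> m.-tuple R).
    by apply/measurable_fun_tnthP => j; exact: mcoord.
  by move=> /(_ measurableT B mB); rewrite setTI preimage_id.
have : bclosure (range g) (\1_B).
  apply: (bclosure_sigma_of galg) BG => p c; apply: (bclosure_lt galg).
  by apply: bclosure_base; exists p.
move=> /closE.
have mBX : measurable [set w | B [tuple X (t j) w | j < m]].
  by have := mtX measurableT B mB; rewrite setTI.
have mBY : measurable [set w | B [tuple Y (t j) w | j < m]].
  by have := mtY measurableT B mB; rewrite setTI.
move=> e; have := Rintegral_indicator P mBX; have := Rintegral_indicator P' mBY.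
move=> eY eX; apply/eqP; rewrite -(fineK (fin_num_measure P _ mBX)).
by rewrite -(fineK (fin_num_measure P' _ mBY)) -eX -eY; apply/eqP; congr (_%:E).
Qed.

End finite_dimensional_laws.

(** * Sums of independent processes *)

Section independence.
Context {R : realType} {T : Type} {d : measure_display} {Omega : measurableType d}.
Variables (P : probability Omega R) (n : nat) (X : 'I_n -> T -> {RV P >-> R}).
Hypothesis hindep : independent_processes X.

Local Notation sig k := (sigma_of (fun t => X k t : Omega -> R)).

Let sig_measurable k C : sig k C -> measurable C.
Proof. by apply: sigma_of_measurable => t. Qed.

Definition bounded_wrt k (H : Omega -> R) :=
  measurable_wrt (sig k) H /\ exists M, forall w, `|H w| <= M.

Lemma bounded_wrt_measurable k H : bounded_wrt k H -> measurable_fun setT H.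
Proof. by move=> [mH _]; apply: measurable_wrt_measurable mH => t. Qed.

Let bounded_wrt_indic k C : sig k C -> bounded_wrt k (\1_C).
Proof.
move=> sC; split.
  by apply/measurable_wrtP; apply/measurable_indicP.
by exists 1 => w; rewrite indicE; case: (_ \in _); rewrite ?normr1 ?normr0.
Qed.

Lemma bounded_wrt_integrable k H : bounded_wrt k H -> P.-integrable setT (EFin \o H).
Proof.
by move=> bH; have [_ [M HM]] := bH; apply: integrable_bounded HM; exact: bounded_wrt_measurable bH.
Qed.

Let prod_bounded (p : pred 'I_n) (G : 'I_n -> Omega -> R) :
  (forall k, bounded_wrt k (G k)) ->
  measurable_fun setT (fun w => \prod_(k < n | p k) G k w) /\
  exists M, forall w, `|\prod_(k < n | p k) G k w| <= M.
Proof.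
move=> bG; split.
  under eq_fun do rewrite big_mkcond/=.
  apply: measurable_prod => k _; case: (p k) => //.
  exact: bounded_wrt_measurable.
have /choice[M GM] : forall k, exists M, forall w, `|G k w| <= M.
  by move=> k; have [_] := bG k.
exists (\prod_(k < n | p k) M k) => w; rewrite normr_prod.
by apply: ler_prod => k _; rewrite normr_ge0 GM.
Qed.

(** The product rule passes from events to bounded functions, one factor at a
    time. *)
Lemma independent_expectation_prod (G : 'I_n -> Omega -> R) :
  (forall k, bounded_wrt k (G k)) ->
  \int[P]_w \prod_(k < n) G k w = \prod_(k < n) \int[P]_w G k w.
Proof.
(* The functions of index below m are arbitrary, the others are indicators. *)
suff step m : forall H : 'I_n -> Omega -> R,
    (forall k : 'I_n, if (k < m)%N then bounded_wrt k (H k)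
              else exists2 C, sig k C & H k = \1_C) ->
    \int[P]_w \prod_(k < n) H k w = \prod_(k < n) \int[P]_w H k w.
  by move=> bG; apply: (step n) => k; rewrite ltn_ord.
elim: m => [|m IH] H Hm.
  have /choice[C CP] : forall k, exists C, sig k C /\ H k = \1_C.
    by move=> k; have [C ? ?] := Hm k; exists C.
  have mC k : measurable (C k) by apply: (@sig_measurable k); exact: (CP k).1.
  have -> : \int[P]_w \prod_(k < n) H k w =
      \int[P]_w \1_(\bigcap_(k in [set: 'I_n]) C k) w.
    apply: eq_Rintegral => w _.
    under eq_bigr => k _ do rewrite (CP k).2 indicE.
    rewrite indicE; have [wC|wC] := boolP (w \in _).
      rewrite big1// => k _; rewrite mem_set//.
      by move: wC; rewrite inE => /(_ k I).
    have [k wk] : exists k, ~ C k w.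
      apply/existsNP => allC; move/negP: wC; apply; rewrite inE => k _.
      exact: allC.
    by rewrite (bigD1 k)//= memNset// mul0r.
  rewrite Rintegral_indicator; last by apply: fin_bigcap_measurable => //; exact: finite_finset.
  have -> : P (\bigcap_(k in [set: 'I_n]) C k) = (\prod_(k < n) P (C k))%E.
    by apply: hindep => k; exact: (CP k).1.
  have -> : (\prod_(k < n) P (C k))%E = (\prod_(k < n) fine (P (C k)))%:E.
    elim/big_rec2 : _ => // k y1 y2 _ ->.
    by rewrite EFinM fineK// fin_num_measure.
  rewrite /=; apply: eq_bigr => k _.
  by rewrite (CP k).2 Rintegral_indicator.
have [nm|mn] := leqP n m.
  apply: IH => k; have := Hm k.
  by rewrite (leq_trans (ltn_ord k) nm) (leq_trans (ltn_ord k) (leqW nm)).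
pose o := Ordinal mn.
have bH k : bounded_wrt k (H k).
  have := Hm k; case: ifP => // _ [C sC ->]; exact: bounded_wrt_indic.
pose W w := \prod_(k < n | k != o) H k w.
pose c := \prod_(k < n | k != o) \int[P]_w H k w.
have [mW [N WN]] := prod_bounded (fun k => k != o) bH.
pose Q (h : Omega -> R) := bounded_wrt o h /\
  \int[P]_w (W w * h w) = c * \int[P]_w h w.
have iW h : bounded_wrt o h -> P.-integrable setT (EFin \o (fun w => W w * h w)).
  by move=> bh; apply: (integrable_mul_bounded mW WN); exact: bounded_wrt_integrable bh.
suff [_ QH] : Q (H o).
  under eq_Rintegral do rewrite (bigD1 o)//= mulrC.
  by rewrite (bigD1 o)//= QH mulrC.
have [/measurable_wrtP mHo [M HoM]] := bH o.
pose GX := g_sigma_algebraType (\bigcup_(t : T)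
  preimage_set_system setT (X o t : Omega -> R) measurable).
apply: (@bounded_measurable_ind R _ GX Q _ _ _ _ (H o) M mHo HoM).
- move=> C sC; split; first exact: bounded_wrt_indic.
  have := IH (fun k => if k == o then \1_C else H k).
  rewrite (bigD1 o)//= eqxx [X in _ * X](eq_bigr (fun k => \int[P]_w H k w)); last first.
    by move=> k /negbTE ->.
  rewrite -/c mulrC => <-.
    apply: eq_Rintegral => w _; rewrite [RHS](bigD1 o)//= eqxx mulrC; congr (_ * _).
    by apply: eq_bigr => k /negbTE ->.
  move=> k; have := Hm k; have [->|ko] := eqVneq k o.
    by rewrite ltnn => _; exists C.
  by rewrite ltnS leq_eqVlt -[m]/(nat_of_ord o) val_eqE (negbTE ko).
- move=> f g [[mf [M1 fM]] ef] [[mg [M2 gM]] eg].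
  have bf : bounded_wrt o f by split=> //; exists M1.
  have bg : bounded_wrt o g by split=> //; exists M2.
  split.
    split; last by exists (M1 + M2) => w; rewrite (le_trans (ler_normD _ _))// lerD.
    by apply/measurable_wrtP; apply: measurable_funD; apply/measurable_wrtP.
  under eq_Rintegral do rewrite mulrDr.
  rewrite !RintegralD ?ef ?eg ?mulrDr//; try exact: iW.
    exact: bounded_wrt_integrable bf.
  exact: bounded_wrt_integrable bg.
- move=> a f [[mf [M1 fM]] ef].
  have bf : bounded_wrt o f by split=> //; exists M1.
  split.
    split; last by exists (`|a| * M1) => w; rewrite normrM ler_wpM2l.
    by apply/measurable_wrtP; apply: measurable_funM => //; apply/measurable_wrtP.
  under eq_Rintegral do rewrite mulrCA.
  rewrite (RintegralZl _ measurableT (iW _ bf)).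
  by rewrite (RintegralZl _ measurableT (bounded_wrt_integrable bf)) ef mulrCA.
- move=> f_ f Mf Qf fM fl.
  have bf : bounded_wrt o f.
    split; last by exists Mf => w; exact: lim_norm_le (fun k => fM k w) (fl w).
    apply/measurable_wrtP; apply: (@measurable_fun_cvg _ _ _ _ f_) => [k|w _].
      by have [[mf _] _] := Qf k; apply/measurable_wrtP.
    exact: fl.
  split=> //.
  have mf k : measurable_fun [set: Omega] (f_ k : Omega -> R).
    by have [bfk _] := Qf k; exact: (bounded_wrt_measurable bfk).
  have c1 : \int[P]_w (W w * f_ k w) @[k --> \oo] --> \int[P]_w (W w * f w).
    apply: (@cvg_expectation _ _ _ P _ _ (N * Mf)) => [k|w|k w].
    - exact: measurable_funM.
    - by apply: cvgMr; exact: fl.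
    - by rewrite normrM; apply: ler_pM => //; exact: WN.
  have c2 : \int[P]_w (W w * f_ k w) @[k --> \oo] --> c * \int[P]_w f w.
    under eq_fun => k do rewrite (Qf k).2.
    by apply: cvgMr; apply: (@cvg_expectation _ _ _ P _ _ Mf).
  by rewrite -(cvg_lim _ c1)// (cvg_lim _ c2).
Qed.

Variable U : 'I_n -> Omega -> R.
Hypothesis mU : forall k, measurable_wrt (sig k) (U k).
Hypothesis sinU : forall k, \int[P]_w sin (U k w) = 0.

Let bcosU k : bounded_wrt k (fun w => cos (U k w)).
Proof.
split; last by exists 1 => w; exact: cos_max.
by apply/measurable_wrtP; apply: measurable_cos_fun; apply/measurable_wrtP; exact: mU.
Qed.

Let bsinU k : bounded_wrt k (fun w => sin (U k w)).
Proof.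
split; last by exists 1 => w; exact: sin_max.
by apply/measurable_wrtP; apply: measurable_sin_fun; apply/measurable_wrtP; exact: mU.
Qed.

Let mU' k : measurable_fun setT (U k).
Proof.
by move: (@mU k); apply: measurable_wrt_measurable => t.
Qed.

(** Independent symmetric summands: adding them one by one to the argument of
    the cosine, the sine terms vanish. *)
Let partial_cos_sum m : (m <= n)%N -> forall G : 'I_n -> Omega -> R,
  (forall k, bounded_wrt k (G k)) ->
  \int[P]_w (cos (\sum_(k < n | (k < m)%N) U k w) * \prod_(k < n | (m <= k)%N) G k w) =
  (\prod_(k < n | (k < m)%N) \int[P]_w cos (U k w)) *
    \prod_(k < n | (m <= k)%N) \int[P]_w G k w /\
  \int[P]_w (sin (\sum_(k < n | (k < m)%N) U k w) * \prod_(k < n | (m <= k)%N) G k w) = 0.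
Proof.
elim: m => [|m IH] mn G bG.
  under eq_Rintegral do rewrite big_pred0 // cos0 mul1r.
  under [X in _ /\ X = _]eq_Rintegral do rewrite big_pred0 // sin0 mul0r.
  rewrite [X in X * _]big_pred0// mul1r; split.
    exact: independent_expectation_prod.
  by rewrite Rintegral_cst// mul0r.
pose o := Ordinal mn.
have ltS (k : 'I_n) : (k < m.+1)%N && (k != o) = (k < m)%N.
  rewrite ltnS leq_eqVlt -[m]/(nat_of_ord o) val_eqE.
  by have [->|] := eqVneq k o; rewrite ?ltnn//= andbT.
have geS (k : 'I_n) : (m <= k)%N && (k != o) = (m < k)%N.
  rewrite leq_eqVlt eq_sym -[m]/(nat_of_ord o) val_eqE.
  by have [->|] := eqVneq k o; rewrite ?ltnn//= andbT.
pose S w := \sum_(k < n | (k < m)%N) U k w.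
have sumE w : \sum_(k < n | (k < m.+1)%N) U k w = U o w + S w.
  rewrite (bigD1 o)/= ?leqnn//; congr (_ + _); apply: eq_bigl => k.
  exact: ltS.
pose W w := \prod_(k < n | (m < k)%N) G k w.
have upd (h : Omega -> R) : let G' k := if k == o then h else G k in
    (forall w, \prod_(k < n | (m <= k)%N) G' k w = h w * W w) /\
    \prod_(k < n | (m <= k)%N) \int[P]_w G' k w =
    (\int[P]_w h w) * \prod_(k < n | (m < k)%N) \int[P]_w G k w.
  move=> G'; split=> [w|].
    rewrite (bigD1 o)/= ?leqnn// /G' eqxx; congr (_ * _).
    apply: eq_big => [k|k /andP[_ /negbTE -> //]]; exact: geS.
  rewrite (bigD1 o)/= ?leqnn// {1}/G' eqxx; congr (_ * _).
  apply: eq_big => [k|k /andP[_ ko]]; first exact: geS.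
  by rewrite /G' (negbTE ko).
have bG' h : bounded_wrt o h -> forall k, bounded_wrt k (if k == o then h else G k).
  by move=> bh k; have [->|] := eqVneq k o.
have [cE cP] := upd (fun w => cos (U o w)).
have [sE sP] := upd (fun w => sin (U o w)).
have [cc1 cc2] := IH (ltnW mn) _ (bG' _ (bcosU o)).
have [ss1 ss2] := IH (ltnW mn) _ (bG' _ (bsinU o)).
rewrite cP in cc1; rewrite sP in ss1.
have {}cc1 : \int[P]_w (cos (S w) * (cos (U o w) * W w)) =
    \prod_(k < n | (k < m)%N) \int[P]_w cos (U k w) *
    (\int[P]_w cos (U o w) * \prod_(k < n | (m < k)%N) \int[P]_w G k w).
  by rewrite -cc1; apply: eq_Rintegral => w _; rewrite -cE.
have {}cc2 : \int[P]_w (sin (S w) * (cos (U o w) * W w)) = 0.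
  by rewrite -cc2; apply: eq_Rintegral => w _; rewrite -cE.
have {}ss1 : \int[P]_w (cos (S w) * (sin (U o w) * W w)) = 0.
  transitivity (\prod_(k < n | (k < m)%N) \int[P]_w cos (U k w) *
      (\int[P]_w sin (U o w) * \prod_(k < n | (m < k)%N) \int[P]_w G k w)).
    by rewrite -ss1; apply: eq_Rintegral => w _; rewrite -sE.
  by rewrite sinU mul0r mulr0.
have {}ss2 : \int[P]_w (sin (S w) * (sin (U o w) * W w)) = 0.
  by rewrite -ss2; apply: eq_Rintegral => w _; rewrite -sE.
have [mW [N WN]] := prod_bounded (fun k => (m < k)%N) bG.
have mS : measurable_fun setT S.
  rewrite /S; under eq_fun do rewrite big_mkcond/=.
  by apply: measurable_sum => k; case: (k < m)%N; [exact: mU'|exact: measurable_cst].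
have int4 (f g : Omega -> R) : measurable_fun setT f -> measurable_fun setT g ->
    (forall w, `|f w| <= 1) -> (forall w, `|g w| <= 1) ->
    P.-integrable setT (EFin \o (fun w => f w * (g w * W w))).
  move=> mf mg f1 g1; apply: (@integrable_bounded _ _ _ P _ (1 * (1 * N))).
    by apply: measurable_funM => //; exact: measurable_funM.
  by move=> w; rewrite !normrM; apply: ler_pM => //; apply: ler_pM => //; exact: WN.
have mcS := measurable_cos_fun mS; have msS := measurable_sin_fun mS.
have mcU := measurable_cos_fun (mU' o); have msU := measurable_sin_fun (mU' o).
have prodE : \prod_(k < n | (k < m.+1)%N) \int[P]_w cos (U k w) =
    (\prod_(k < n | (k < m)%N) \int[P]_w cos (U k w)) * \int[P]_w cos (U o w).
  by rewrite (bigD1 o)/= ?leqnn// mulrC; congr (_ * _); apply: eq_bigl => k; exact: ltS.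
split.
- rewrite prodE -mulrA -cc1 -[RHS]subr0 -[X in _ = _ - X]ss2 -RintegralB//; last 2 first.
  - by apply: int4 => // w; exact: cos_max.
  - by apply: int4 => // w; exact: sin_max.
  by apply: eq_Rintegral => w _; rewrite sumE cosD -/(W w); ring.
- rewrite -[RHS](addr0 0) -[X in _ = X + _]cc2 -[X in _ = _ + X]ss1 -RintegralD//; last 2 first.
  - by apply: int4 => // w; [exact: sin_max|exact: cos_max].
  - by apply: int4 => // w; [exact: cos_max|exact: sin_max].
  by apply: eq_Rintegral => w _; rewrite sumE sinD -/(W w); ring.
Qed.

(** With vanishing sine integrals the product of the characteristic functions
    involves the cosines only. *)
Lemma independent_cos_sum :
  \int[P]_w cos (\sum_(k < n) U k w) = \prod_(k < n) \int[P]_w cos (U k w) /\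
  \int[P]_w sin (\sum_(k < n) U k w) = 0.
Proof.
have b1 k : bounded_wrt k (fun=> 1).
  split; last by exists 1 => w; rewrite normr1.
  by apply/measurable_wrtP; exact: measurable_cst.
have lt_n (k : 'I_n) : (k < n)%N = true by rewrite ltn_ord.
have ge_n (k : 'I_n) : (n <= k)%N = false by rewrite leqNgt ltn_ord.
have [c s] := partial_cos_sum (leqnn n) b1.
split.
- rewrite [X in _ = _ * X](eq_bigl _ _ ge_n) big_pred0// mulr1 (eq_bigl _ _ lt_n) in c.
  rewrite -c; apply: eq_Rintegral => w _.
  by rewrite (eq_bigl _ _ ge_n) big_pred0// mulr1 (eq_bigl _ _ lt_n).
- rewrite -[RHS]s; apply: eq_Rintegral => w _.
  by rewrite (eq_bigl _ _ ge_n) big_pred0// mulr1 (eq_bigl _ _ lt_n).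
Qed.

End independence.

(** * Stable exponents are of negative type *)
Section stable_exponents.
Context {R : realType} {T : Type} {d : measure_display} {Omega : measurableType d}.
Variable P : probability Omega R.

(** The derivative of the exponential at $0$, from
    $1 - t \le e^{-t} \le 1 - t + t^2$. *)
Lemma cvg_expR_slope (x : R) : 0 <= x ->
  n.+1%:R * (expR (- (n.+1%:R^-1 * x)) - 1) @[n --> \oo] --> - x.
Proof.
move=> x0.
apply: (@squeeze_cvgr _ _ _ _ (fun=> - x) (fun n => - x + x * x * n.+1%:R^-1)).
- apply: nearW => n; have N0 : (0 : R) < n.+1%:R by rewrite ltr0n.
  set t := n.+1%:R^-1 * x; have t0 : 0 <= t by rewrite mulr_ge0// invr_ge0 ltW.
  have xE : x = n.+1%:R * t by rewrite /t mulVKf// gt_eqF.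
  have e1 : 1 - t <= expR (- t) by exact: expR_ge1Dx.
  have e2 : expR (- t) <= 1 - t + t * t.
    rewrite expRN; have t1 : 0 < 1 + t by rewrite ltr_wpDr.
    have h : (expR t)^-1 <= (1 + t)^-1 by rewrite lef_pV2 ?posrE ?expR_gt0// expR_ge1Dx.
    apply: (le_trans h); rewrite -[leLHS]mul1r ler_pdivrMr//.
    have : 0 <= t * t * t by rewrite !mulr_ge0.
    lra.
  apply/andP; split.
    by rewrite xE -mulrN ler_pM2l//; lra.
  have -> : - x + x * x * n.+1%:R^-1 = n.+1%:R * (- t + t * t).
    rewrite xE; field.
    by apply/lt0r_neq0; have := ler0n R n; lra.
  by rewrite ler_pM2l//; lra.
- exact: cvg_cst.
- rewrite -[X in _ --> X]addr0; apply: cvgD; first exact: cvg_cst.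
  by rewrite -[X in _ --> X](mulr0 (x * x)); apply: cvgMr; exact: cvg_harmonic.
Qed.

(** Schoenberg: the exponent is the limit of $n (1 - E \cos(n^{-1/\alpha} X))$,
    hence of negative type. *)
Lemma stable_negative_type (alpha : R) (X : T -> Omega -> R) (phi : seq (R * T) -> R) :
  0 < alpha -> (forall t, measurable_fun setT (X t)) -> (forall Z, 0 <= phi Z) ->
  (forall a Z, 0 < a ->
    \int[P]_w cos (a * lin (X ^~ w) Z) = expR (- (a `^ alpha * phi Z))) ->
  negative_type phi.
Proof.
move=> alpha0 mX phi0 hphi p pos vanish.
pose a n : R := (n.+1%:R^-1) `^ (alpha^-1).
have a0 n : 0 < a n by rewrite powR_gt0// invr_gt0.
have aE n : a n `^ alpha = n.+1%:R^-1.
  by rewrite /a -powRrM mulVf ?gt_eqF// powRr1// invr_ge0.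
have sum0 : \sum_(c <- p) c.1 = 0.
  rewrite -[RHS]vanish /tev; apply: eq_bigr => c _.
  by rewrite lin0 cos0 mulr1.
have int_tev n (q : seq (R * seq (R * T))) :
    \int[P]_w tev (fun t => a n * X t w) q =
    \sum_(c <- q) c.1 * expR (- (n.+1%:R^-1 * phi c.2)).
  elim: q => [|c q IH].
    rewrite big_nil; under eq_Rintegral do rewrite /tev big_nil.
    by rewrite Rintegral_cst// mul0r.
  have mt Z : measurable_fun setT (fun w => lin (fun t => a n * X t w) Z).
    apply: measurable_sum => e; apply: measurable_funM => //.
    exact: measurable_funM.
  have [M qM] := tev_bounded q.
  under eq_Rintegral do rewrite /tev big_cons.
  rewrite RintegralD//.
  - rewrite big_cons -IH RintegralZl//; last exact: integrable_cos.
    congr (_ * _ + _); rewrite -aE -hphi//.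
    by apply: eq_Rintegral => w _; rewrite lin_scale.
  - by apply: integrable_scale; exact: integrable_cos.
  - apply: (@integrable_bounded _ _ _ P _ M) => [|w]; last exact: qM.
    apply: measurable_sum => e; apply: measurable_funM => //.
    exact: measurable_cos_fun.
have cv : \sum_(c <- p) c.1 * (n.+1%:R * (expR (- (n.+1%:R^-1 * phi c.2)) - 1))
    @[n --> \oo] --> \sum_(c <- p) c.1 * - phi c.2.
  elim: p {pos vanish sum0} => [|c p IH].
    by under eq_fun do rewrite big_nil; rewrite big_nil; exact: cvg_cst.
  under eq_fun do rewrite big_cons; rewrite big_cons.
  by apply: cvgD => //; apply: cvgMr; exact: cvg_expR_slope.
have -> : levy_functional phi p = \sum_(c <- p) c.1 * - phi c.2.
  by rewrite /levy_functional -sumrN; apply: eq_bigr => c _; rewrite mulrN.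
rewrite -(cvg_lim _ cv)//; apply: limr_ge; first exact: cvgP cv.
apply: nearW => n.
have -> : \sum_(c <- p) c.1 * (n.+1%:R * (expR (- (n.+1%:R^-1 * phi c.2)) - 1)) =
    n.+1%:R * \int[P]_w tev (fun t => a n * X t w) p.
  rewrite int_tev -[RHS]subr0 -[X in _ - X](mulr0 n.+1%:R) -[in X in _ - X]sum0.
  by rewrite -mulrBr -sumrB mulr_sumr; apply: eq_bigr => c _; ring.
by rewrite mulr_ge0// Rintegral_ge0.
Qed.

End stable_exponents.

(** * Exponents of stable processes and of stable integrals *)

Section exponents.
Context {R : realType} (alpha : R) (T : Type).
Hypothesis alpha0 : 0 < alpha.
Context {d : measure_display} {Omega : measurableType d} (P : probability Omega R).

Lemma char_fun_cos_sin (Z : Omega -> R) t c : char_fun P Z t = c%:C%C ->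
  \int[P]_w cos (t * Z w) = c /\ \int[P]_w sin (t * Z w) = 0.
Proof. by rewrite /char_fun unlock => -[<- <-]. Qed.

Variable X : T -> {RV P >-> R}.
Hypothesis hX : SaS_process alpha X.

Local Notation linX Z := (fun w => lin (fun t => X t w) Z).

Lemma SaS_lin Z : exists2 s, 0 <= s & forall u,
  \int[P]_w cos (u * linX Z w) = expR (- (s * `|u| `^ alpha)) /\
  \int[P]_w sin (u * linX Z w) = 0.
Proof.
have [s s0 hs] := hX (fun j => (tnth (in_tuple Z) j).2) (fun j => (tnth (in_tuple Z) j).1).
exists (s `^ alpha) => [|u]; first exact: powR_ge0.
have [hc hsin] := char_fun_cos_sin (hs u).
split; [rewrite -hc|rewrite -hsin]; apply: eq_Rintegral => w _; rewrite /lin big_tnth//.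
Qed.

(** The logarithm recovers $\sigma^\alpha$ without choosing $\sigma$. *)
Definition exponent Z : R := - ln (\int[P]_w cos (linX Z w)).

Lemma exponent_props Z : 0 <= exponent Z /\ forall u,
  \int[P]_w cos (u * linX Z w) = expR (- (`|u| `^ alpha * exponent Z)) /\
  \int[P]_w sin (u * linX Z w) = 0.
Proof.
have [s s0 hs] := SaS_lin Z.
have -> : exponent Z = s.
  rewrite /exponent; have [+ _] := hs 1; under eq_Rintegral do rewrite mul1r.
  by move=> ->; rewrite normr1 powR1 mulr1 expRK opprK.
by split=> // u; rewrite [_ * s]mulrC.
Qed.

Lemma exponent_ge0 Z : 0 <= exponent Z.
Proof. by have [] := exponent_props Z. Qed.

Lemma cos_exponent Z : \int[P]_w cos (linX Z w) = expR (- exponent Z).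
Proof.
have [_ /(_ 1)[+ _]] := exponent_props Z.
by under eq_Rintegral do rewrite mul1r; rewrite normr1 powR1 mul1r.
Qed.

Lemma sin_exponent Z : \int[P]_w sin (linX Z w) = 0.
Proof.
have [_ /(_ 1)[_ +]] := exponent_props Z.
by under eq_Rintegral do rewrite mul1r.
Qed.

Lemma negative_type_exponent : negative_type exponent.
Proof.
apply: (@stable_negative_type _ _ _ _ P alpha (fun t => X t : Omega -> R)) => //.
  exact: exponent_ge0.
by move=> a Z a0; have [_ /(_ a)[-> _]] := exponent_props Z; rewrite gtr0_norm.
Qed.

Lemma exponent_scale a Z : 0 < a -> exponent (lscale a Z) = a `^ alpha * exponent Z.
Proof.
move=> a0; have [_ /(_ a)[+ _]] := exponent_props Z.
rewrite gtr0_norm// => e; apply: oppr_inj; apply: expR_inj.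
rewrite -e -cos_exponent; apply: eq_Rintegral => w _.
by rewrite lin_lscale.
Qed.

End exponents.

Section spectral_functions.
Context {R : realType} (alpha : R) (T : Type).
Hypothesis alpha0 : 0 < alpha.
Context {dS : measure_display} {S : measurableType dS}.
Variable mu : {measure set S -> \bar R}.

(** Membership in $L^\alpha$ in terms of an integral, for every
    $\alpha > 0$; for $\alpha < 1$ there is no norm to rely on. *)
Lemma Lfun_powRP (g : S -> R) : g \in Lfun mu alpha%:E <->
  measurable_fun setT g /\ mu.-integrable setT (EFin \o (fun s => `|g s| `^ alpha)).
Proof.
have mp : measurable_fun setT g ->
    measurable_fun setT (EFin \o (fun s => `|g s| `^ alpha)).
  move=> mg; apply/measurable_EFinP.
  by apply: (measurableT_comp (measurable_powR alpha)); exact: measurableT_comp.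
have nE : (('N[mu]_alpha%:E[EFin \o g] `^ alpha) =
    \int[mu]_s `|(`|g s| `^ alpha)%:E|)%E.
  rewrite poweR_Lnorm ?gt_eqF//; apply: eq_integral => s _ /=.
  by rewrite (ger0_norm (powR_ge0 _ _)).
split.
  rewrite inE => /andP[/[!inE]/= mg lg]; split=> //; apply/integrableP; split; first exact: mp.
  by rewrite -[X in (X < _)%E]nE; apply: poweR_lty.
move=> [mg /integrableP[_ ig]]; rewrite inE; apply/andP; split; rewrite inE//=.
rewrite /finite_norm; apply: (@lty_poweRy _ _ alpha); first by rewrite gt_eqF.
by rewrite nE.
Qed.

Variable f : T -> S -> R.
Hypothesis hf : forall t, f t \in Lfun mu alpha%:E.

Lemma Lfun_measurable t : measurable_fun setT (f t).
Proof. by have /Lfun_powRP[] := hf t. Qed.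

(** From $|x + y|^\alpha \le 2^\alpha (|x|^\alpha + |y|^\alpha)$, which holds also
    for $\alpha < 1$, where the triangle inequality fails. *)
Lemma integrable_lin_powR Z :
  mu.-integrable setT (EFin \o (fun s => `|lin_comb f Z s| `^ alpha)).
Proof.
have mlin Z' : measurable_fun setT (fun s => `|lin_comb f Z' s| `^ alpha).
  apply: (measurableT_comp (measurable_powR alpha)); apply: measurableT_comp => //.
  exact: measurable_lin_fun Lfun_measurable Z'.
elim: Z => [|[a t] Z IH].
  rewrite (_ : _ \o _ = cst 0%E); first exact: integrable0.
  by apply/funext => s /=; rewrite /lin_comb lin_nil normr0 powR0// gt_eqF.
have /Lfun_powRP[_ it] := hf t.
have := integrable_scale (2 `^ alpha) (integrable_add (integrable_scale (`|a| `^ alpha) it) IH).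
apply: le_integrable => //; first by apply/measurable_EFinP; exact: mlin.
move=> s _ /=; rewrite lee_fin (ger0_norm (powR_ge0 _ _)) [X in _ <= X]ger0_norm; last first.
  by rewrite mulr_ge0 ?addr_ge0 ?mulr_ge0 ?powR_ge0.
rewrite -(powRM alpha (normr_ge0 a) (normr_ge0 (f t s))) -normrM.
set x := a * f t s; set y := lin_comb f Z s.
have -> : lin_comb f ((a, t) :: Z) s = x + y by rewrite /lin_comb /lin big_cons.
have pn : alpha \is Num.nneg by rewrite nnegrE ltW.
wlog xy : x y / `|x| <= `|y|.
  by move=> h; have [/h//|/ltW/h] := leP `|x| `|y|; rewrite addrC [X in _ <= _ * X]addrC.
apply: (@le_trans _ _ ((2 * `|y|) `^ alpha)).
  rewrite ge0_ler_powR ?nnegrE ?mulr_ge0 ?(ltW alpha0)//.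
  by rewrite (le_trans (ler_normD _ _))// mulr2n mulrDl mul1r lerD2r.
by rewrite powRM// ler_wpM2l ?powR_ge0// lerDr powR_ge0.
Qed.

Lemma Lfun_bounded_mul (r : S -> R) t : measurable_fun setT r ->
  (forall s, `|r s| <= 1) -> (fun s => r s * f t s) \in Lfun mu alpha%:E.
Proof.
move=> mr r1; have /Lfun_powRP[mf it] := hf t; apply/Lfun_powRP.
have mrf : measurable_fun setT (fun s => r s * f t s) by exact: measurable_funM.
split=> //; apply: le_integrable it => //.
  apply/measurable_EFinP.
  by apply: (measurableT_comp (measurable_powR alpha)); exact: measurableT_comp.
move=> s _ /=; rewrite lee_fin !(ger0_norm (powR_ge0 _ _)).
rewrite ge0_ler_powR ?nnegrE ?(ltW alpha0)// normrM ler_piMl//.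
Qed.

Section integral.
Context {dQ : measure_display} {OmegaQ : measurableType dQ} {Q : probability OmegaQ R}.
Variable M : (S -> R) -> {RV Q >-> R}.
Hypothesis hM : SaS_integral alpha mu M.

Lemma SaS_integral_cos_sin (r : S -> R) Z : measurable_fun setT r ->
  (forall s, `|r s| <= 1) ->
  \int[Q]_w cos (lin (fun t => M (fun s => r s * f t s) w) Z) =
    expR (- \int[mu]_s (`|r s| `^ alpha * `|lin_comb f Z s| `^ alpha)) /\
  \int[Q]_w sin (lin (fun t => M (fun s => r s * f t s) w) Z) = 0.
Proof.
move=> mr r1.
have := hM (fun j => (tnth (in_tuple Z) j).1)
  (fun j => Lfun_bounded_mul (tnth (in_tuple Z) j).2 mr r1).
move=> /char_fun_cos_sin[hc hs].
have E w : \sum_j (tnth (in_tuple Z) j).1 * M (fun s => r s * f (tnth (in_tuple Z) j).2 s) w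
    = lin (fun t => M (fun s => r s * f t s) w) Z.
  by rewrite /lin [in RHS]big_tnth.
(* The characteristic function is prescribed at $-1$; parity brings it to $1$. *)
split.
  under eq_Rintegral do rewrite -cosN -mulN1r -E; rewrite hc; congr (expR (- _)).
  apply: eq_Rintegral => s _; rewrite -powRM ?normr_ge0// -normrM -lin_scale.
  by rewrite /lin [in RHS]big_tnth.
apply: oppr_inj; rewrite oppr0 -[RHS]hs; set I := Rintegral _ _ _; rewrite -(mulN1r I).
rewrite -RintegralZl//; last by apply: integrable_sin; apply: measurable_lin => t.
by apply: eq_Rintegral => w _; rewrite !mulN1r sinN E.
Qed.

End integral.

End spectral_functions.

Section cover.
Context {R : realType} (T : Type).
Context {dS : measure_display} {S : measurableType dS}.
Variable mu : {sigma_finite_measure set S -> \bar R}.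

(** The index set may be uncountable; up to a null set, countably many of the
    sets $\{f_t \ne 0\}$ cover all of them, and full support says that they
    cover the space. *)
Lemma full_support_countable_cover (f : T -> S -> R) :
  (forall t, measurable_fun setT (f t)) -> full_support mu f ->
  exists sel : nat -> option T,
    {ae mu, forall s, exists n, (if sel n is Some t then f t s else 0) != 0}.
Proof.
move=> mf full; pose B t := f t @^-1` (~` [set 0]).
have mB t : measurable (B t).
  rewrite -[B t]setTI; apply: mf => //; exact: measurableC.
have [sel selP] := countable_exhaustion mu mB.
exists sel; pose U := \bigcup_n (if sel n is Some t then B t else set0).
have mU : measurable U by apply: bigcupT_measurable => n; case: (sel n).
exists (~` U); split; first exact: measurableC.
  apply/eqP; rewrite eq_le measure_ge0 andbT leNgt; apply/negP => U0; apply: full.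
  exists (~` U); split=> //; first exact: measurableC.
  move=> t; exists (B t `\` U); split; [exact: measurableD|exact: selP|].
  by move=> s /= /not_implyP[].
move=> s /= nex [n _]; case E : (sel n) => [t|//] Bt; apply: nex.
by exists n; rewrite E; apply/eqP.
Qed.

End cover.

(** * Decompositions of a stable process *)

Section decompositions.
Context {R : realType} (alpha : R) (T : Type).
Context {dS : measure_display} {S : measurableType dS}.
Variable mu : {sigma_finite_measure set S -> \bar R}.
Variable f : T -> S -> R.
Hypothesis alpha02 : 0 < alpha < 2.
Hypothesis hf : forall t, f t \in Lfun mu alpha%:E.

Let alpha0 : 0 < alpha. Proof. by case/andP: alpha02. Qed.
Let mf t : measurable_fun setT (f t). Proof. exact: (Lfun_measurable alpha0 hf). Qed.
Let iY Z : mu.-integrable setT (EFin \o (fun s => `|lin_comb f Z s| `^ alpha)).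
Proof. exact: (integrable_lin_powR alpha0 hf). Qed.

Local Notation expo q := (fun Z => \int[mu]_s (q s * `|lin_comb f Z s| `^ alpha)).
Local Notation rho_measurable := (measurable_wrt (ratio_sigma f)).

Let iqY (q : S -> R) Z : measurable_fun setT q -> (forall s, 0 <= q s <= 1) ->
  mu.-integrable setT (EFin \o (fun s => q s * `|lin_comb f Z s| `^ alpha)).
Proof.
move=> mq q01; apply: (integrable_mul_bounded (M := 1) mq _ (iY Z)) => s.
by have /andP[q0 q1] := q01 s; rewrite ger0_norm.
Qed.

Lemma expo_ae (q q' : S -> R) Z : measurable_fun setT q -> measurable_fun setT q' ->
  {ae mu, forall s, q s = q' s} -> expo q Z = expo q' Z.
Proof.
move=> mq mq' qq'; have mY := measurable_int _ (iY Z).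
rewrite /Rintegral; congr fine; apply: ae_eq_integral => //.
- apply/measurable_EFinP; apply: measurable_funM => //; exact/measurable_EFinP.
- apply/measurable_EFinP; apply: measurable_funM => //; exact/measurable_EFinP.
- by apply: filterS qq' => s -> _.
Qed.

Lemma expo_sum n (q : 'I_n -> S -> R) Z : (forall k, measurable_fun setT (q k)) ->
  (forall k s, 0 <= q k s <= 1) ->
  expo (fun s => \sum_(k < n) q k s) Z = \sum_(k < n) expo (q k) Z.
Proof.
move=> mq q01; apply: EFin_inj.
have fin k : (\int[mu]_s (q k s * `|lin_comb f Z s| `^ alpha)%:E \is a fin_num)%E.
  exact: integrable_fin_num (iqY Z (mq k) (q01 k)).
rewrite -sumEFin; under [RHS]eq_bigr => k _ do rewrite /Rintegral fineK//.
rewrite -integral_sum//; last by move=> k; exact: iqY.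
have E s : ((\sum_(k < n) q k s) * `|lin_comb f Z s| `^ alpha)%:E =
    (\sum_(k < n) (q k s * `|lin_comb f Z s| `^ alpha)%:E)%E.
  by rewrite sumEFin mulr_suml.
under [in RHS]eq_integral => s _ do rewrite -E.
rewrite /Rintegral fineK//; apply: integrable_fin_num => //.
under eq_fun do rewrite /= E.
by apply: integrable_sum => // k _; exact: iqY.
Qed.

Lemma sum_rho_measurable n (q : 'I_n -> S -> R) :
  (forall k, rho_measurable (q k)) -> rho_measurable (fun s => \sum_(k < n) q k s).
Proof.
move=> mq; apply/measurable_wrtP; apply: measurable_sum => k.
by apply/measurable_wrtP; exact: mq.
Qed.

Lemma rho_measurable_comp (h : R -> R) (q : S -> R) : measurable_fun setT h ->
  rho_measurable q -> rho_measurable (h \o q).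
Proof. by move=> mh mq B mB; have := mq _ (mh measurableT B mB); rewrite setTI. Qed.

Hypothesis hfull : full_support mu f.

(** Both $\sum_k q_k$ and $1$ are densities of $\psi$ depending on the ratios
    only. *)
Lemma sum_density1 n (q : 'I_n -> S -> R) : (forall k, rho_measurable (q k)) ->
  (forall k s, 0 <= q k s <= 1) ->
  (forall Z, \sum_(k < n) expo (q k) Z = psi alpha mu f Z) ->
  {ae mu, forall s, \sum_(k < n) q k s = 1}.
Proof.
move=> mq q01 qpsi; have [sel cover] := full_support_countable_cover mf hfull.
apply: (ratio_density_unique alpha02 mf iY cover (M := n%:R + 1)) => [||s|s|Z].
- exact: sum_rho_measurable.
- by apply/measurable_wrtP; exact: measurable_cst.
- apply/andP; split; first by apply: sumr_ge0 => k _; have /andP[] := q01 k s.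
  apply: (@le_trans _ _ (\sum_(k < n) 1)); last by rewrite sumr_const card_ord lerDl.
  by apply: ler_sum => k _; have /andP[] := q01 k s.
- by rewrite ler01 lerDr ler0n.
- rewrite expo_sum ?qpsi//; last by move=> k; exact: measurable_Rt (mq k).
  by apply: eq_Rintegral => s _; rewrite mul1r.
Qed.

Context {dQ : measure_display} {OmegaQ : measurableType dQ} {Q : probability OmegaQ R}.
Variable M : (S -> R) -> {RV Q >-> R}.
Hypothesis hM : SaS_integral alpha mu M.

(** Both laws are symmetric, so only the cosine transforms matter, and these are
    exponentials of minus the two sides. *)
Lemma eq_fdd_SaS_integral (d : measure_display) (Omega : measurableType d)
    (P : probability Omega R) (X : T -> {RV P >-> R}) (r : S -> R) :
  SaS_process alpha X -> measurable_fun setT r -> (forall s, `|r s| <= 1) ->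
  eq_fdd P (fun t => X t) Q (fun t => M (fun s => r s * f t s)) <->
  forall Z, exponent X Z = expo (fun s => `|r s| `^ alpha) Z.
Proof.
move=> hX mr r1; have cs Z := SaS_integral_cos_sin alpha0 hf hM Z mr r1.
have mX t : measurable_fun setT (X t : Omega -> R) by [].
have mM t : measurable_fun setT (M (fun s => r s * f t s) : OmegaQ -> R) by [].
split=> [XM Z|XM]; last apply: (cos_sin_eq_fdd mX mM) => Z.
- have [+ _] := eq_fdd_cos_sin mX mM Z XM.
  by rewrite (cos_exponent hX) (cs Z).1 => /expR_inj/oppr_inj.
- by rewrite (cos_exponent hX) (cs Z).1 XM.
- by rewrite (sin_exponent hX) (cs Z).2.
Qed.

Context {dX : measure_display} {OmegaX : measurableType dX} {PX : probability OmegaX R}.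
Variable X : T -> {RV PX >-> R}.
Hypothesis hX : SaS_process alpha X.
Hypothesis hrep : eq_fdd PX (fun t => X t) Q (fun t => M (f t)).
Variable n : nat.
Context {dY : measure_display} {OmegaY : measurableType dY} {PY : probability OmegaY R}.
Variable Xk : 'I_n -> T -> {RV PY >-> R}.
Hypothesis hXk : forall k, SaS_process alpha (Xk k).
Hypothesis hindep : independent_processes Xk.

Lemma exponent_spectral Z : exponent X Z = psi alpha mu f Z.
Proof.
have E : (fun t => M (fun s => cst 1 s * f t s) : OmegaQ -> R) = fun t => M (f t).
  by apply/funext => t; congr (M _ : OmegaQ -> R); apply/funext => s; rewrite mul1r.
have n1 s : `|(cst 1 : S -> R) s| <= 1 by rewrite normr1.
have [+ _] := eq_fdd_SaS_integral hX (@measurable_cst _ _ S R setT 1) n1.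
rewrite E => /(_ hrep) ->.
by apply: eq_Rintegral => s _; rewrite normr1 powR1 mul1r.
Qed.

Lemma cos_sin_independent_sum Z :
  \int[PY]_w cos (lin (fun t => \sum_(k < n) Xk k t w) Z) =
    expR (- \sum_(k < n) exponent (Xk k) Z) /\
  \int[PY]_w sin (lin (fun t => \sum_(k < n) Xk k t w) Z) = 0.
Proof.
have E w : lin (fun t => \sum_(k < n) Xk k t w) Z =
    \sum_(k < n) lin (fun t => Xk k t w) Z.
  by rewrite /lin exchange_big; apply: eq_bigr => c _; rewrite mulr_sumr.
have [||hc hs] := independent_cos_sum hindep (U := fun k w => lin (fun t => Xk k t w) Z).
- move=> k; apply/measurable_wrtP; set GX := g_sigma_algebraType _.
  apply: (@measurable_lin _ _ GX T (fun t => Xk k t : GX -> R)) => t.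
  apply/measurable_wrtP.
  exact: (@measurable_wrt_generator _ _ _ (fun t => Xk k t : OmegaY -> R) t).
- by move=> k; exact: sin_exponent.
split; [under eq_Rintegral do rewrite E|under eq_Rintegral do rewrite E] => //.
rewrite hc -sumrN expR_sum; apply: eq_bigr => k _.
by rewrite (cos_exponent (hXk k)).
Qed.

Local Notation D := (eq_fdd PX (fun t => X t) PY (fun t w => \sum_(k < n) Xk k t w)).

Lemma decomposition_exponents :
  D <-> forall Z, psi alpha mu f Z = \sum_(k < n) exponent (Xk k) Z.
Proof.
have mX t : measurable_fun setT (X t : OmegaX -> R) by [].
have mS t : measurable_fun setT (fun w => \sum_(k < n) Xk k t w) by exact: measurable_sum.
split=> [XY Z|XY]; last apply: (cos_sin_eq_fdd mX mS) => Z.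
- have [+ _] := eq_fdd_cos_sin mX mS Z XY.
  rewrite (cos_exponent hX) (cos_sin_independent_sum Z).1 exponent_spectral.
  by move=> /expR_inj/oppr_inj.
- by rewrite (cos_exponent hX) (cos_sin_independent_sum Z).1 exponent_spectral XY.
- by rewrite (sin_exponent hX) (cos_sin_independent_sum Z).2.
Qed.

(** The exponents of the other components add up to $\psi - \psi_k$, which is
    therefore of negative type. *)
Lemma component_density k : D -> exists q : S -> R,
  [/\ rho_measurable q, forall s, 0 <= q s <= 1 & exponent (Xk k) =1 expo q].
Proof.
move=> /decomposition_exponents DE.
have [sel cover] := full_support_countable_cover mf hfull.
apply: (ratio_density_exists alpha02 mf iY cover).
- exact: (negative_type_exponent alpha0 (hXk k)).
- move=> p p0 pz; rewrite (_ : levy_functional _ p =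
      \sum_(j < n | j != k) levy_functional (exponent (Xk j)) p).
    by apply: sumr_ge0 => j _; exact: (negative_type_exponent alpha0 (hXk j)).
  rewrite /levy_functional sumrN exchange_big; congr (- _); apply: eq_bigr => c _.
  by rewrite -mulr_sumr DE (bigD1 k)//= addrC addrK.
- exact: (exponent_scale (hXk k)).
Qed.

End decompositions.

Theorem theorem1p1 (R : realType) (alpha : R)
  (halpha0 : 0 < alpha) (halpha2 : alpha < 2)
  (T : metricType R) (hTc : complete_space T) (hTs : separable_space T)
  (dS : measure_display) (S : measurableType dS)
  (hS : standard_borel R S) (mu : {sigma_finite_measure set S -> \bar R})
  (dQ : measure_display) (OmegaQ : measurableType dQ)
  (Q : probability OmegaQ R)
  (M : (S -> R) -> {RV Q >-> R}) (hM : SaS_integral alpha mu M)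
  (f : T -> S -> R) (hf : forall t, f t \in Lfun mu alpha%:E)
  (hfull : full_support mu f)
  (dX : measure_display) (OmegaX : measurableType dX)
  (PX : probability OmegaX R)
  (X : T -> {RV PX >-> R}) (hX : SaS_process alpha X)
  (hrep : eq_fdd PX (fun t => X t) Q (fun t => M (f t)))
  (n : nat) (hn : (0 < n)%N)
  (dY : measure_display) (OmegaY : measurableType dY)
  (PY : probability OmegaY R)
  (Xk : 'I_n -> T -> {RV PY >-> R})
  (hXk : forall k, SaS_process alpha (Xk k))
  (hindep : independent_processes Xk) :
  let D := eq_fdd PX (fun t => X t)
                  PY (fun t w => \sum_(k < n) Xk k t w) in
  let Rep (r : 'I_n -> S -> R) := forall k : 'I_n,
    eq_fdd PY (fun t => Xk k t) Q (fun t => M (fun s => r k s * f t s)) in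
  let sum_one (r : 'I_n -> S -> R) :=
    {ae mu, forall s, \sum_(k < n) `|r k s| `^ alpha = 1} in
  [/\ D <-> exists r : 'I_n -> S -> R,
        [/\ forall k, measurable_fun setT (r k),
            forall k s, -1 <= r k s <= 1, Rep r & sum_one r],
      D -> forall r : 'I_n -> S -> R,
        (forall k, measurable_fun setT (r k)) ->
        (forall k s, -1 <= r k s <= 1) ->
        (forall k, exists2 h : S -> R, measurable_wrt (ratio_sigma f) h &
           {ae mu, forall s, `|r k s| = h s}) ->
        Rep r -> sum_one r,
      D -> exists r : 'I_n -> S -> R,
        [/\ forall k, measurable_wrt (ratio_sigma f) (r k),
            forall k s, 0 <= r k s <= 1, Rep r & sum_one r] &
      D -> forall r r' : 'I_n -> S -> R,
        (forall k, measurable_wrt (ratio_sigma f) (r k)) ->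
        (forall k s, 0 <= r k s <= 1) -> Rep r ->
        (forall k, measurable_wrt (ratio_sigma f) (r' k)) ->
        (forall k s, 0 <= r' k s <= 1) -> Rep r' ->
        forall k, {ae mu, forall s, r k s = r' k s}].
Proof.
move=> D Rep sum_one.
have alpha02 : 0 < alpha < 2 by rewrite halpha0.
have mf t : measurable_fun setT (f t) by exact: (Lfun_measurable halpha0 hf).
have iY := integrable_lin_powR halpha0 hf.
have DE : D <-> forall Z, psi alpha mu f Z = \sum_(k < n) exponent (Xk k) Z.
  exact: (decomposition_exponents alpha02 hf hM hX hrep hXk hindep).
have abs1 (r : S -> R) : (forall s, -1 <= r s <= 1) -> forall s, `|r s| <= 1.
  by move=> r1 s; rewrite ler_norml.
have abs01 (r : S -> R) : (forall s, 0 <= r s <= 1) -> forall s, `|r s| <= 1.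
  by move=> r1 s; have /andP[r0 ?] := r1 s; rewrite ger0_norm.
have RepE (r : 'I_n -> S -> R) : (forall k, measurable_fun setT (r k)) ->
    (forall k s, `|r k s| <= 1) -> Rep r -> forall k Z, exponent (Xk k) Z =
      \int[mu]_s (`|r k s| `^ alpha * `|lin_comb f Z s| `^ alpha).
  move=> mr r1 rep k Z.
  by have [+ _] := eq_fdd_SaS_integral alpha02 hf hM (hXk k) (mr k) (r1 k); apply.
have mpow (r : S -> R) a : measurable_fun setT r -> measurable_fun setT (fun s => r s `^ a).
  by move=> mr; exact: (measurableT_comp (measurable_powR a) mr).
have pow01 (x a : R) : 0 <= a -> 0 <= x <= 1 -> 0 <= x `^ a <= 1.
  move=> a0 /andP[x0 x1]; rewrite powR_ge0/=.
  have <- : 1 `^ a = 1 :> R by rewrite powR1.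
  by rewrite ge0_ler_powR// nnegrE.
have iii : D -> exists r : 'I_n -> S -> R,
    [/\ forall k, measurable_wrt (ratio_sigma f) (r k),
        forall k s, 0 <= r k s <= 1, Rep r & sum_one r].
  move=> hD; have /choice[q qP] := fun k => component_density alpha02 hf hfull hM hX
    hrep hXk hindep k hD.
  have mq k : measurable_wrt (ratio_sigma f) (q k) by have [] := qP k.
  have q01 k s : 0 <= q k s <= 1 by have [_ + _] := qP k; apply.
  pose r k s := q k s `^ alpha^-1.
  have rq k s : `|r k s| `^ alpha = q k s.
    rewrite ger0_norm ?powR_ge0// -powRrM mulVf ?gt_eqF// powRr1//.
    by have /andP[] := q01 k s.
  have mr k : measurable_wrt (ratio_sigma f) (r k).
    exact: (rho_measurable_comp (measurable_powR _) (mq k)).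
  have r01 k s : 0 <= r k s <= 1 by apply: pow01 => //; rewrite invr_ge0 ltW.
  exists r; split=> //.
    move=> k; apply/(eq_fdd_SaS_integral alpha02 hf hM (hXk k) (measurable_Rt mf (mr k))).
      exact: abs01.
    move=> Z; have [_ _ ->] := qP k; apply: eq_Rintegral => s _; congr (_ * _).
    exact/esym/rq.
  apply: filterS (sum_density1 alpha02 hf hfull mq q01 _) => [s|Z].
    by under [in X in _ -> X]eq_bigr do rewrite rq.
  by rewrite (DE.1 hD); apply: eq_bigr => k _; have [_ _ ->] := qP k.
split=> //.
- split=> [/iii[r [mr r01 rep sum1]]|[r [mr r1 rep sum1]]].
    exists r; split=> // [k|k s]; first exact: (measurable_Rt mf (mr k)).
    by have /andP[r0 ->] := r01 k s; rewrite (le_trans _ r0)// lerN10.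
  apply/DE => Z; under [RHS]eq_bigr => k _ do
    rewrite (RepE r mr (fun k => abs1 _ (r1 k)) rep k Z).
  have a01 k s : 0 <= `|r k s| `^ alpha <= 1.
    by apply: pow01; [exact: ltW|rewrite normr_ge0 abs1].
  have ma k : measurable_fun setT (fun s => `|r k s| `^ alpha).
    by apply: mpow; exact: measurableT_comp.
  rewrite -(expo_sum alpha02 hf Z ma a01) (expo_ae alpha02 hf Z _ _ sum1)//.
    by apply: eq_Rintegral => s _; rewrite mul1r.
  exact: measurable_sum.
- move=> hD r mr r1 rh rep.
  have /choice[h hP] : forall k, exists h : S -> R,
      measurable_wrt (ratio_sigma f) h /\ {ae mu, forall s, `|r k s| = h s}.
    by move=> k; have [h mh rE] := rh k; exists h.
  (* The function h equals |r k| only almost everywhere; clipping brings it into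
     the unit interval everywhere and keeps it measurable for the ratios. *)
  pose clip (x : R) := Num.max 0 (Num.min 1 x).
  have mclip : measurable_fun setT (fun x => clip x `^ alpha).
    apply: (measurableT_comp (measurable_powR alpha)).
    by apply: measurable_maxr => //; exact: measurable_minr.
  pose q k s := clip (h k s) `^ alpha.
  have mq k : measurable_wrt (ratio_sigma f) (q k).
    exact: (rho_measurable_comp mclip (hP k).1).
  have q01 k s : 0 <= q k s <= 1.
    apply: pow01; first exact: ltW.
    by rewrite /clip le_max lexx/= ge_max ler01 ge_min lexx.
  have rq k : {ae mu, forall s, `|r k s| `^ alpha = q k s}.
    apply: filterS (hP k).2 => s rs; rewrite /q -rs /clip min_r ?max_r//.
    exact: abs1.
  have sum1 : {ae mu, forall s, \sum_(k < n) q k s = 1}.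
    apply: (sum_density1 alpha02 hf hfull mq q01) => Z; rewrite (DE.1 hD).
    apply: eq_bigr => k _; rewrite (RepE r mr (fun k => abs1 _ (r1 k)) rep k Z).
    apply: (expo_ae alpha02 hf); last by apply: filterS (rq k).
      exact: measurable_Rt (mq k).
    by apply: mpow; exact: measurableT_comp.
  have rqs : {ae mu, forall s, forall k, `|r k s| `^ alpha = q k s}.
    exact: filter_forall.
  apply: filterS2 rqs sum1 => s rs <-.
  by apply: eq_bigr => k _; exact: rs.
- move=> hD r r' mr r01 rep mr' r01' rep' k.
  have [sel cover] := full_support_countable_cover mf hfull.
  have mrS k' : measurable_fun setT (r k') by exact: measurable_Rt (mr k').
  have mrS' k' : measurable_fun setT (r' k') by exact: measurable_Rt (mr' k').
  have a0 : 0 <= alpha by exact: ltW.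
  have nr (x : R) : 0 <= x <= 1 -> `|x| = x by move=> /andP[? _]; rewrite ger0_norm.
  have := ratio_density_unique alpha02 mf iY cover (M := 1)
    (rho_measurable_comp (measurable_powR alpha) (mr k))
    (rho_measurable_comp (measurable_powR alpha) (mr' k))
    (fun s => pow01 _ _ a0 (r01 k s)) (fun s => pow01 _ _ a0 (r01' k s)).
  case=> [Z|].
    have e := RepE r mrS (fun k => abs01 _ (r01 k)) rep k Z.
    have e' := RepE r' mrS' (fun k => abs01 _ (r01' k)) rep' k Z.
    transitivity (exponent (Xk k) Z); [rewrite e|rewrite e'].
      by apply: eq_Rintegral => s _; rewrite /= (nr _ (r01 k s)).
    by apply: eq_Rintegral => s _; rewrite /= (nr _ (r01' k s)).
  move=> N HN; exists N; move: HN => [mN N0 sub]; split=> // s /= ne; apply: sub => /= e.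
  apply: ne; apply: (powR_injective halpha0) e; rewrite nnegrE.
    by have /andP[] := r01 k s.
  by have /andP[] := r01' k s.
Qed.
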